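(* Let $T$ be the translation by an irrational $\alpha$ on $\mathbb T$, let $\phi$ be a real step function on $\mathbb T$ with zero integral, with jumps $-s_j$ at the distinct points $\beta_j$ ($0\le j\le m$, $m\ge1$), and let $t\in\mathbb T$. Consider the following condition (C): there exists a partition $\mathcal P$ of $\{0,\dots,m\}$ such that, for every $J\in\mathcal P$ and $\beta_J\in\{\beta_j:\ j\in J\}$: (i) the sum $\sum_{j\in J}s_j$ is an integer; (ii) for every $j\in J$ there exists a sequence of integers $(b_n^j)_{n\ge0}$ such that $$\beta_j=\beta_J+\sum_{n\ge0}b_n^jq_n\alpha\mod 1,$$ with $\displaystyle\sum_{n\ge0}\frac{|b_n^j|}{a_{n+1}}<+\infty$ and $\displaystyle\sum_{n\ge0}\Bigl\|\sum_{j\in J}b_n^js_j\Bigr\|^2<+\infty$; (iii) there exists an integer $k'$ such that $t=k'\alpha-\sum_{J\in\mathcal P}t_J$, where $$t_J=\beta_J\sum_{j\in J}s_j+\sum_{n\ge0}\Bigl[\sum_{j\in J}b_n^js_j\Bigr]q_n\alpha\mod 1 .$$ If condition (C) holds, then there exists a measurable function $f$ of modulus $1$ satisfying (almost everywhere) the equation $$e^{2i\pi\phi}=e^{2i\pi t}\,\frac{f}{f\circ T}.$$ Conversely, if $\sum_{j\in J}s_j\notin\mathbb Z$ for every non-empty proper subset $J$ of $\{0,\dots,m\}$, then condition (C) is necessary for this equation to admit a measurable solution $f$ of modulus $1$.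
   Context: $\mathbb T=\mathbb R/\mathbb Z$ with Lebesgue measure; $\alpha\in\,]0,1[$. $(a_n)_{n\ge1}$ are the partial quotients and $(p_n/q_n)_{n\ge0}$ the convergents of the continued fraction of $\alpha$ ($p_0=0$, $q_0=1$). $\|x\|$ is the distance from the real $x$ to the nearest integer, denoted $[x]$. The jump of $\phi$ at a point is its right limit minus its left limit (on $\mathbb T$ oriented as usual); the $\beta_j$ are all the discontinuities of $\phi$ (so $\sum_j s_j=0$). Infinite sums ''mod 1'' are convergent series in $\mathbb T$. The product $\beta_J\sum_{j\in J}s_j$ is well defined in $\mathbb T$ because $\sum_{j\in J}s_j\in\mathbb Z$. The sequences $(b^j_n)$ in (iii) are those of (ii), and (i)–(iii) are understood for a choice of one point $\beta_J$ for each $J\in\mathcal P$, whichever choice is made. *)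

(* Defs.v *)
(* MathComp-Analysis; complex numbers R[i] from mathcomp-real-closed. *)
From HB Require Import structures.
From mathcomp Require Import all_boot all_order all_algebra.
From mathcomp Require Import complex.
From mathcomp Require Import all_classical all_reals all_analysis.

Set Implicit Arguments.
Unset Strict Implicit.
Unset Printing Implicit Defensive.

Import Order.TTheory GRing.Theory Num.Theory.
Import numFieldNormedType.Exports.

Local Open Scope classical_set_scope.
Local Open Scope ring_scope.

(* A point of the circle R/Z is given by any of its real representatives, so
   that equality in R/Z is [eqmod1]; a function on R/Z is a 1-periodic function
   on R, the integral over R/Z is the integral over [0, 1], and "almost
   everywhere" on R/Z is "almost everywhere" on R for 1-periodic properties. *)
Section circle.
Context {R : realType}.
Implicit Types x y : R.

Definition eqmod1 x y : Prop := x - y \is a Num.int.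

(* Nearest integer; a half-integer is rounded upwards. *)
Definition nearest_int x : int := Num.floor (x + 2^-1).

Definition dist_int x : R := `|x - (nearest_int x)%:~R|.

(* Convergence in R/Z, metrized by [dist_int (x - y)]. *)
Definition cvg_mod1 (u : R^nat) (l : R) : Prop :=
  dist_int (u n - l) @[n --> \oo] --> (0 : R).

(* The series of general term u converges in R/Z, with sum l. *)
Definition series_mod1 (u : R^nat) (l : R) : Prop := cvg_mod1 (series u) l.

Definition e2ipi x : R[i] := Complex (cos (2 * pi * x)) (sin (2 * pi * x)).

End circle.

Section continued_fraction.
Context {R : realType}.
Variable alpha : R.

(* Iterates of the Gauss map x |-> 1/x - floor (1/x) at alpha. *)
Fixpoint cf_remainder (n : nat) : R :=
  if n is n'.+1 then
    (cf_remainder n')^-1 - (Num.truncn (cf_remainder n')^-1)%:R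
  else alpha.

(* a_n, meaningful for n >= 1: alpha = 1/(a_1 + 1/(a_2 + ...)). *)
Definition partial_quotient (n : nat) : nat :=
  Num.truncn (cf_remainder n.-1)^-1.

(* q_0 = 1, q_1 = a_1, q_(n+2) = a_(n+2) q_(n+1) + q_n. *)
Fixpoint cf_denominator (n : nat) : nat :=
  if n is n'.+1 then
    if n' is n''.+1 then
      (partial_quotient n * cf_denominator n' + cf_denominator n'')%N
    else partial_quotient 1
  else 1%N.

End continued_fraction.

Section step_function.
Context {R : realType}.
Implicit Types phi : R -> R.

(* The intervals may be degenerate: no convention is imposed on the values of
   phi at its discontinuities. *)
Definition step_function phi : Prop :=
  periodic phi 1 /\
  exists (n : nat) (c : 'I_n -> R) (I : 'I_n -> interval R),
    forall x, 0 <= x < 1 -> phi x = \sum_(i < n) c i * \1_[set` I i] x.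

Definition jump phi (x : R) : R :=
  lim (phi y @[y --> x^'+]) - lim (phi y @[y --> x^'-]).

End step_function.

(* f : R/Z -> C measurable of modulus 1 with
   e^(2 i pi phi) = e^(2 i pi t) f / (f o T) a.e., where T x = x + alpha. *)
Definition cobounding (R : realType) (alpha : R) (phi : R -> R) (t : R)
    (f : R -> R[i]) : Prop :=
  [/\ periodic f 1,
      measurable_fun [set: R] (fun x => complex.Re (f x)),
      measurable_fun [set: R] (fun x => complex.Im (f x)),
      (forall x, `|f x| = 1) &
      {ae @lebesgue_measure R,
         forall x, e2ipi (phi x) = e2ipi t * (f x / f (x + alpha))}].

(* [c J] is the index of the chosen point beta_J, for J in the partition P.
   The sequences b may depend on the choice c. *)
Definition condition_C (R : realType) (alpha : R) (m : nat)
    (beta s : 'I_m.+1 -> R) (t : R) : Prop :=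
  let a := partial_quotient alpha in
  let q := cf_denominator alpha in
  exists2 P : {set {set 'I_m.+1}}, finset.partition P [set: 'I_m.+1]%SET &
  forall c : {set 'I_m.+1} -> 'I_m.+1, (forall J, J \in P -> c J \in J) ->
  (* (i) *)
  (forall J, J \in P -> \sum_(j in J) s j \is a Num.int) /\
  exists b : 'I_m.+1 -> nat -> int,
  [/\ (* (ii) *)
      (forall J, J \in P ->
        (forall j, j \in J ->
           series_mod1 (fun n => (b j n)%:~R * (q n)%:R * alpha)
                       (beta j - beta (c J)) /\
           (\sum_(0 <= n <oo)
              (`|(b j n)%:~R| / (a n.+1)%:R : R)%:E < +oo)%E) /\
        (\sum_(0 <= n <oo)
           (dist_int (\sum_(j in J) (b j n)%:~R * s j) ^+ 2)%:E < +oo)%E)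
    & (* (iii) *)
      exists (k' : int) (tau : {set 'I_m.+1} -> R),
        (forall J, J \in P ->
           series_mod1
             (fun n => (nearest_int (\sum_(j in J) (b j n)%:~R * s j))%:~R
                       * (q n)%:R * alpha)
             (tau J - beta (c J) * \sum_(j in J) s j)) /\
        eqmod1 t (k'%:~R * alpha - \sum_(J in P) tau J)].

(* Main.v *)
Require Import Defs.
From HB Require Import structures.
From mathcomp Require Import all_boot all_order all_algebra.
From mathcomp Require Import complex.
From mathcomp Require Import all_classical all_reals all_analysis.
From mathcomp Require Import measurable_realfun.
From mathcomp Require Import ring lra zify.

(** Write e(x) for exp(2 i pi x) and psi(x) for the fractional part of x minus
    1/2. A step function with mean 0 is almost everywhere the combination of the
    functions s_j psi(x - beta_j) ([step_function_sawtooth]), so the equation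
    concerns sums of sawtooth functions.

    Sufficiency. The function psi(x - K alpha) - psi(x) is a coboundary; its
    transfer function [trans] is a sum of |K| translates of psi. Let K_N^j be the
    sum of the b_n^j q_n for n < N. The combination of the transfer functions of
    the K_N^j, centered at beta_J, solves an equation in which beta_j is replaced
    by its approximation beta_J + K_N^j alpha. When N increases by 1, it changes by
    (sum_j b_N^j s_j) psi(q_N (x - beta_J)), up to a constant and off a small set
    ([trans_increment]); the measures of these sets are summable along with the
    |b_N^j| / a_(N+1). The nearest integer to sum_j b_N^j s_j produces a character, which is divided out; the
    rest is small in quadratic mean, and the terms obtained for different N are
    almost orthogonal since the q_N are lacunary. So the normalized transfer
    functions converge in the mean ([block_converge]). The characters change the
    constant in the equation, and this is how the series t_J arises
    ([condition_C_sufficient]).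

    Necessity. The partition has a single block. Since f is close in the mean to
    its translates by small u, the quotient f(x + u) / f(x) is close to 1 along
    most orbits, whereas it is multiplied by e(s_j) at each visit to the arc of
    length u that ends at beta_j. The partial sums of the s_j are not integers, so
    the arcs of all the beta_j have to be visited at almost the same time: the
    q_n (beta_j - beta_0) tend to 0 modulo 1 ([discontinuities_aligned]), and the
    differences have expansions with b_n^j / a_(n+1) tending to 0
    ([aligned_expansions]).

    Both summability conditions come from the fact that e of the Birkhoff sum of
    the step function along M steps is almost constant when M alpha is close to an
    integer ([birkhoff_almost_constant]). If M is the sum of the q_n over the levels
    n, in some range, at which some b_n^j is not 0, this exponential is a product of
    almost independent factors; the factor of level n differs from 1 on a set of
    measure of the order of the largest |b_n^j| / a_(n+1), and there it is far from
    1, so the sum of these measures is bounded ([densities_summable]). If M is the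
    sum of the numbers q_n a_(n+1) / 2, rounded, the exponential is close to a
    product of almost independent factors e(eps_n chi_n), where eps_n is the signed
    distance from sum_j b_n^j s_j to the integers and chi_n is the indicator function
    of arcs that fill between a quarter and three quarters of the circle; each of
    these factors decreases the modulus of the mean by a quantity of order eps_n^2,
    so the sum of the eps_n^2 is bounded ([eps_summable]).

    The solutions built for sufficiency then converge, and the quotient of f by
    their limit is an eigenfunction of the rotation. Its eigenvalue is e(k alpha) for
    an integer k ([eigenvalue_multiple]), and it is also the limit of the constants
    e(t + sum_n [sum_j b_n^j s_j] q_n alpha): this is the third part of condition
    (C) ([block_int_series]). *)

Set Implicit Arguments.
Unset Strict Implicit.
Unset Printing Implicit Defensive.

Import Order.TTheory GRing.Theory Num.Theory.
Import numFieldNormedType.Exports.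

Local Open Scope classical_set_scope.
Local Open Scope ring_scope.

Local Arguments cf_denominator : simpl never.
Local Arguments cf_remainder : simpl never.

(** * Distance to the nearest integer *)
Section distance.
Context {R : realType}.
Implicit Types x y : R.

Lemma dist_int_ge0 x : 0 <= dist_int x.
Proof. exact: normr_ge0. Qed.

Lemma nearest_int_itv x :
  (nearest_int x)%:~R - 2^-1 <= x < (nearest_int x)%:~R + 2^-1.
Proof. by rewrite /nearest_int; have := floor_itv (x + 2^-1); rewrite intrD; lra. Qed.

Lemma dist_int_le_half x : dist_int x <= 2^-1.
Proof. by rewrite /dist_int ler_norml; have := nearest_int_itv x; lra. Qed.

Lemma dist_int_le x (l : int) : dist_int x <= `|x - l%:~R|.
Proof.
rewrite /dist_int; have := nearest_int_itv x; set N := nearest_int x => xN.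
have [->//|lN] := eqVneq l N.
have : (1 : R) <= `|l%:~R - N%:~R|.
  rewrite -intrB; apply: norm_intr_ge1; first exact: intr_int.
  by rewrite intr_eq0 subr_eq0.
have : `|x - N%:~R| <= 2^-1 by rewrite ler_norml; lra.
have := ler_distD x l%:~R N%:~R.
rewrite (distrC l%:~R x); lra.
Qed.

Lemma dist_int_int (l : int) : dist_int (l%:~R : R) = 0.
Proof.
apply/eqP; rewrite eq_le dist_int_ge0 andbT.
by have := dist_int_le l%:~R l; rewrite subrr normr0.
Qed.

Lemma dist_intD x y : dist_int (x + y) <= dist_int x + dist_int y.
Proof.
have := dist_int_le (x + y) (nearest_int x + nearest_int y).
rewrite intrD; move/le_trans; apply; rewrite /dist_int.
by rewrite opprD addrACA ler_normD.
Qed.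

Lemma dist_int_normr x : dist_int x <= `|x|.
Proof. by have := dist_int_le x 0; rewrite subr0. Qed.

Lemma dist_intN x : dist_int (- x) = dist_int x.
Proof.
suff H y : dist_int (- y) <= dist_int y.
  by apply/eqP; rewrite eq_le H -{1}(opprK x) H.
have := dist_int_le (- y) (- nearest_int y).
by rewrite intrN -opprD normrN.
Qed.

Lemma dist_intDz x (l : int) : dist_int (x + l%:~R) = dist_int x.
Proof.
apply/eqP; rewrite eq_le; apply/andP; split.
  by apply: (le_trans (dist_intD _ _)); rewrite dist_int_int addr0.
rewrite -{1}(addrK l%:~R x); apply: (le_trans (dist_intD _ _)).
by rewrite dist_intN dist_int_int addr0.
Qed.

Lemma dist_intBz x (l : int) : dist_int (x - l%:~R) = dist_int x.
Proof. by rewrite -intrN dist_intDz. Qed.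

Lemma dist_intMz (k : int) x : dist_int (k%:~R * x) <= `|k%:~R| * dist_int x.
Proof.
have := dist_int_le (k%:~R * x) (k * nearest_int x).
by rewrite intrM -mulrBr normrM.
Qed.

Lemma dist_intMn (k : nat) x : dist_int (k%:R * x) <= k%:R * dist_int x.
Proof. by have := dist_intMz k x; rewrite -pmulrn normr_nat. Qed.

Lemma dist_int_eq0 x : (dist_int x == 0) = (x \is a Num.int).
Proof.
apply/eqP/intrP => [/eqP|[l ->]]; last exact: dist_int_int.
by rewrite /dist_int normr_eq0 subr_eq0 => /eqP; exists (nearest_int x).
Qed.

Lemma dist_int_small x : `|x| <= 2^-1 -> dist_int x = `|x|.
Proof.
move=> x2; apply/eqP; rewrite eq_le dist_int_normr /=.
rewrite /dist_int; have [->|n0] := eqVneq (nearest_int x) 0; first by rewrite subr0.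
have : (1 : R) <= `|(nearest_int x)%:~R|.
  by apply: norm_intr_ge1; [exact: intr_int|rewrite intr_eq0].
have := ler_distD 0 x (nearest_int x)%:~R.
have := ler_normB x (x - (nearest_int x)%:~R).
by rewrite opprB addrCA subrr addr0; lra.
Qed.

(** As long as the multiples of x stay away from 1/2, no wrapping occurs. *)
Lemma dist_intMn_small (a : nat) x :
  (forall j : nat, (j <= a)%N -> dist_int (j%:R * x) < 4^-1) ->
  dist_int (a%:R * x) = a%:R * dist_int x.
Proof.
move=> H; set d := x - (nearest_int x)%:~R.
have dE (j : nat) : dist_int (j%:R * x) = dist_int (j%:R * d).
  by rewrite /d mulrBr pmulrn -intrM dist_intBz.
have [a0|a0] := posnP a; first by rewrite a0 !mul0r (dist_int_int 0).
have d4 : `|d| < 4^-1 by have := H 1%N a0; rewrite mul1r.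
have K (j : nat) : (j <= a)%N -> `|j%:R * d| < 4^-1.
  elim: j => [|j IH] ja; first by rewrite mul0r normr0; lra.
  have {IH}J := IH (ltnW ja).
  have J2 : `|j.+1%:R * d| <= 2^-1.
    by rewrite -natr1 mulrDl mul1r; apply: (le_trans (ler_normD _ _)); lra.
  by rewrite -(dist_int_small J2) -dE; exact: H.
rewrite dE dist_int_small; last by apply/ltW/(lt_trans (K _ (leqnn a))); lra.
by rewrite normrM normr_nat.
Qed.

End distance.

(** * Continued fractions *)
Section continued_fraction.
Context {R : realType} (alpha : R).
Hypothesis alpha_itv : 0 < alpha < 1.
Hypothesis alpha_irr : irrational alpha.

Local Notation r := (cf_remainder alpha).
Local Notation a := (partial_quotient alpha).
Local Notation q := (cf_denominator alpha).

Fixpoint cf_numerator (n : nat) : int :=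
  if n is n'.+1 then
    if n' is n''.+1 then (a n)%:Z * cf_numerator n' + cf_numerator n'' else 1
  else 0.
Local Notation p := cf_numerator.

Lemma cf_remainderS n : r n.+1 = (r n)^-1 - (a n.+1)%:R.
Proof. by []. Qed.

Lemma cf_denominator0 : q 0 = 1%N. Proof. by []. Qed.

Lemma cf_denominator1 : q 1 = a 1. Proof. by []. Qed.

Lemma cf_denominatorSS n : q n.+2 = (a n.+2 * q n.+1 + q n)%N.
Proof. by []. Qed.

Lemma cf_numeratorSS n : p n.+2 = (a n.+2)%:Z * p n.+1 + p n.
Proof. by []. Qed.

Lemma cf_remainder_itv n : 0 < r n < 1 /\ irrational (r n).
Proof.
elim: n => [//|n [/andP[r0 r1] irr]]; rewrite cf_remainderS /partial_quotient /=.
have rV0 : 0 <= (r n)^-1 by rewrite invr_ge0 ltW.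
have irr' : irrational ((r n)^-1 - (Num.truncn (r n)^-1)%:R).
  move=> [x _ xE]; apply: irr; exists (x + (Num.truncn (r n)^-1)%:R)^-1 => //.
  by rewrite fmorphV /= rmorphD /= ratr_nat xE subrK invrK.
split=> //; have /andP[t1 t2] := truncn_itv rV0.
rewrite lt_neqAle subr_ge0 t1 andbT; apply/andP; split.
  by apply/eqP => E; apply: irr'; exists 0 => //; rewrite rmorph0 E.
by rewrite ltrBlDl natr1.
Qed.

Lemma cf_remainder_gt0 n : 0 < r n.
Proof. by have [/andP[]] := cf_remainder_itv n. Qed.

Lemma cf_remainder_lt1 n : r n < 1.
Proof. by have [/andP[]] := cf_remainder_itv n. Qed.

Lemma partial_quotient_gt0 n : (0 < a n.+1)%N.
Proof.
rewrite /partial_quotient /= truncn_gt0 invr_ge1; first exact/ltW/cf_remainder_lt1.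
  by rewrite unitfE gt_eqF// cf_remainder_gt0.
exact: cf_remainder_gt0.
Qed.

Lemma cf_denominator_gt0 n : (0 < q n)%N.
Proof.
suff: (0 < q n)%N && (0 < q n.+1)%N by case/andP.
elim: n => [|n /andP[h1 h2]]; first by rewrite cf_denominator0 cf_denominator1 partial_quotient_gt0.
by rewrite h2 cf_denominatorSS addn_gt0 h1 orbT.
Qed.

Lemma leq_cf_denominatorS n : (q n <= q n.+1)%N.
Proof.
case: n => [|n]; first exact: partial_quotient_gt0.
rewrite cf_denominatorSS; apply: leq_trans (leq_addr _ _).
by rewrite leq_pmull// partial_quotient_gt0.
Qed.

Lemma cf_denominatorSS_ge n : (q n + q n.+1 <= q n.+2)%N.
Proof.
rewrite cf_denominatorSS addnC leq_add2r leq_pmull//.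
exact: partial_quotient_gt0.
Qed.

Lemma cf_denominator_ge_id n : (n <= q n)%N.
Proof.
elim: n => [//|[|n] IH]; first exact: cf_denominator_gt0.
have := cf_denominatorSS_ge n; have := cf_denominator_gt0 n; lia.
Qed.

Lemma leq_partial_quotientM n : (a n.+1 * q n <= q n.+1)%N.
Proof. by case: n => [|n]; [rewrite cf_denominator0 muln1|rewrite cf_denominatorSS leq_addr]. Qed.

Lemma leq_cf_denominatorM n : (q n.+1 <= a n.+1 * q n + q n)%N.
Proof.
case: n => [|n]; first by rewrite cf_denominator0 muln1 leq_addr.
by rewrite cf_denominatorSS leq_add2l leq_cf_denominatorS.
Qed.

Lemma leq_cf_denominator_double n : (q n.+1 <= 2 * (a n.+1 * q n))%N.
Proof.
have := leq_cf_denominatorM n; have := partial_quotient_gt0 n.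
have := cf_denominator_gt0 n; nia.
Qed.

(** Since q grows at least like the Fibonacci numbers, sums of its values are
    comparable to their largest term, and the tails of the series of the
    inverses to their first one. *)
Lemma sum_cf_denominator n : (\sum_(0 <= i < n.+1) q i <= 3 * q n)%N.
Proof.
suff: (\sum_(0 <= i < n.+1) q i <= 3 * q n)%N &&
      (\sum_(0 <= i < n.+2) q i <= 3 * q n.+1)%N by case/andP.
elim: n => [|n /andP[h1 h2]].
  rewrite !big_nat_recr //= big_geq // cf_denominator0 cf_denominator1.
  by have := partial_quotient_gt0 0; lia.
rewrite h2 /= big_nat_recr // big_nat_recr //=.
have := cf_denominatorSS_ge n; have := leq_cf_denominatorS n; lia.
Qed.

Lemma cf_denominatorR_gt0 n : 0 < (q n)%:R :> R.
Proof. by rewrite ltr0n cf_denominator_gt0. Qed.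

Lemma cf_denominatorR_ge1 n : 1 <= (q n)%:R :> R.
Proof. by rewrite ler1n cf_denominator_gt0. Qed.

Lemma sum_cf_denominatorV n N :
  \sum_(n <= i < N) (q i)%:R^-1 <= 4 / (q n)%:R :> R.
Proof.
have V0 i : 0 <= (q i)%:R^-1 :> R by rewrite invr_ge0 ler0n.
have [k] := ubnP (N - n)%N; elim: k n => // k IH n Nk.
have [Nn|nN] := leqP N n; first by rewrite big_geq// mulr_ge0.
have [Nn|nN2] := leqP N n.+1.
  have -> : N = n.+1 by lia.
  rewrite big_nat1 -{1}[_^-1]mul1r ler_pM2r ?invr_gt0 ?cf_denominatorR_gt0//; lra.
have qmono : (q n.+1)%:R^-1 <= (q n)%:R^-1 :> R.
  by rewrite lef_pV2 ?posrE ?cf_denominatorR_gt0// ler_nat leq_cf_denominatorS.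
have q2 : (q n.+2)%:R^-1 <= (q n)%:R^-1 / 2 :> R.
  rewrite -invfM lef_pV2 ?posrE ?mulr_gt0 ?cf_denominatorR_gt0//.
  rewrite -natrM ler_nat.
  have := cf_denominatorSS_ge n; have := leq_cf_denominatorS n; lia.
rewrite big_ltn// big_ltn//.
have : (N - n.+2 < k)%N by lia.
by move=> /IH h; lra.
Qed.

(** The sign makes it positive, so that it is the distance from q_n alpha to the
    integer p_n. *)
Definition cf_delta n : R := (-1) ^+ n * ((q n)%:R * alpha - (p n)%:~R).
Local Notation delta := cf_delta.

Lemma cf_deltaSS n : delta n.+2 = delta n - (a n.+2)%:R * delta n.+1.
Proof.
rewrite /delta cf_denominatorSS cf_numeratorSS !exprS natrD natrM intrD intrM -pmulrn.
by ring.
Qed.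

Lemma cf_delta0 : delta 0 = alpha.
Proof. by rewrite /delta expr0 cf_denominator0 !mul1r subr0. Qed.

Lemma cf_deltaS n : delta n.+1 = r n.+1 * delta n.
Proof.
elim: n => [|n IH].
  rewrite cf_remainderS cf_delta0 /delta cf_denominator1 expr1 mulrBl mulVf; last first.
    by rewrite gt_eqF//; case/andP: alpha_itv.
  ring.
rewrite cf_deltaSS (cf_remainderS n.+1) mulrBl {2}IH mulKf//.
by rewrite gt_eqF// cf_remainder_gt0.
Qed.

Lemma cf_delta_gt0 n : 0 < delta n.
Proof.
elim: n => [|n IH]; first by rewrite cf_delta0; case/andP: alpha_itv.
by rewrite cf_deltaS mulr_gt0// cf_remainder_gt0.
Qed.

Lemma cf_deltaS_le n : delta n.+1 <= delta n.
Proof.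
rewrite cf_deltaS -[leRHS]mul1r ler_pM2r ?cf_delta_gt0//.
exact/ltW/cf_remainder_lt1.
Qed.

Lemma cf_delta_det n : (q n.+1)%:R * delta n + (q n)%:R * delta n.+1 = 1.
Proof.
elim: n => [|n IH].
  by rewrite cf_delta0 /delta cf_denominator0 expr1 /=; ring.
by rewrite cf_deltaSS cf_denominatorSS natrD natrM -[RHS]IH; ring.
Qed.

Lemma cf_det n : p n.+1 * (q n)%:Z - p n * (q n.+1)%:Z = (-1) ^+ n.
Proof.
elim: n => [|n IH]; first by rewrite cf_denominator0 expr0 mul0r subr0.
rewrite cf_denominatorSS cf_numeratorSS PoszD PoszM exprS -IH; ring.
Qed.

Lemma cf_delta_le n : delta n <= (q n.+1)%:R^-1.
Proof.
have h := cf_delta_det n; have q0 := cf_denominatorR_gt0 n.+1.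
rewrite -[leRHS]mul1r ler_pdivlMr// mulrC -[leRHS]h lerDl mulr_ge0//.
by rewrite ltW// cf_delta_gt0.
Qed.

Lemma cf_delta_ge n : (q n.+1)%:R^-1 <= 2 * delta n.
Proof.
have h := cf_delta_det n; have q0 := cf_denominatorR_gt0 n.+1.
rewrite -[leLHS]mul1r ler_pdivrMr// -[leLHS]h.
have h1 : (q n)%:R * delta n.+1 <= (q n.+1)%:R * delta n.
  apply: ler_pM => //; [exact/ltW/cf_delta_gt0| |exact: cf_deltaS_le].
  by rewrite ler_nat leq_cf_denominatorS.
lra.
Qed.

(** Law of best approximation: decompose (k, l) on the basis formed by two
    consecutive convergents; the coordinates have opposite signs, so that the
    two contributions to k alpha - l have the same sign. *)
Lemma best_approximation n (k l : int) : k != 0 -> `|k| < (q n.+1)%:Z ->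
  delta n <= `|k%:~R * alpha - l%:~R|.
Proof.
move=> k0 kq.
pose e : int := (-1) ^+ n.
have ee : e * e = 1 by rewrite /e -expr2 sqrr_sign.
pose x := e * (k * p n.+1 - l * (q n.+1)%:Z).
pose y := e * (l * (q n)%:Z - k * p n).
have det := cf_det n; rewrite -/e in det.
have kE : k = x * (q n)%:Z + y * (q n.+1)%:Z.
  rewrite /x /y; transitivity (e * e * k); first by rewrite ee mul1r.
  by rewrite -{2}det; ring.
have lE : l = x * p n + y * p n.+1.
  rewrite /x /y; transitivity (e * e * l); first by rewrite ee mul1r.
  by rewrite -{2}det; ring.
clearbody x y.
have dE : k%:~R * alpha - l%:~R = (-1) ^+ n * (x%:~R * delta n - y%:~R * delta n.+1).
  rewrite {1}kE {1}lE /delta !intrD !intrM -!pmulrn exprS.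
  have es : (-1) ^+ n * (-1) ^+ n = 1 :> R by rewrite -expr2 sqrr_sign.
  set s := (-1) ^+ n in es *.
  transitivity (s * s * (x%:~R * ((q n)%:R * alpha - (p n)%:~R) +
                         y%:~R * ((q n.+1)%:R * alpha - (p n.+1)%:~R))).
    by rewrite es; ring.
  by ring.
rewrite dE normrM normr_sign mul1r.
have [d0 d1] : 0 < delta n /\ 0 < delta n.+1 by rewrite !cf_delta_gt0.
have qn := cf_denominator_gt0 n; have qn1 := cf_denominator_gt0 n.+1.
have [x0|x0] := eqVneq x 0.
  exfalso; move: kq; rewrite kE x0 mul0r add0r normrM.
  have y0 : y != 0 by apply: contraNneq k0 => y0; rewrite kE x0 y0 !mul0r.
  by nia.
have [xp|xn] : 1 <= x \/ x <= -1 by lia.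
  have yn : y <= 0 by rewrite leNgt; apply/negP => yp; move: kq; rewrite kE; nia.
  have xR : 1 <= x%:~R :> R by rewrite ler1z.
  have yR : y%:~R <= 0 :> R by rewrite lerz0.
  rewrite ger0_norm; nra.
have yn : 0 <= y by rewrite leNgt; apply/negP => yp; move: kq; rewrite kE; nia.
have xR : x%:~R <= -1 :> R by rewrite -[leRHS](intrN R 1) ler_int.
have yR : 0 <= y%:~R :> R by rewrite ler0z.
rewrite ler0_norm; nra.
Qed.

(** No shorter orbit segment returns closer than delta_n: this separates the points
    of an orbit of length q_(n+1). *)
Lemma dist_int_best_approximation n (k : int) : k != 0 -> `|k| < (q n.+1)%:Z ->
  delta n <= dist_int (k%:~R * alpha).
Proof. by move=> k0 kq; rewrite /dist_int best_approximation. Qed.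

Lemma cf_thetaE n :
  (q n)%:R * alpha = (p n)%:~R + (-1) ^+ n * delta n.
Proof.
rewrite /delta mulrA -expr2 sqrr_sign mul1r; ring.
Qed.

Lemma dist_int_cf_denominator n : dist_int ((q n)%:R * alpha) <= delta n.
Proof.
rewrite cf_thetaE addrC dist_intDz; apply: (le_trans (dist_int_normr _)).
by rewrite normrM normr_sign mul1r gtr0_norm// cf_delta_gt0.
Qed.

End continued_fraction.

(** * Integration over the circle *)
Section circle_integral.
Context {R : realType}.
Notation mu := (@lebesgue_measure R).
Implicit Types (f g : R -> R) (u x y : R).

Definition addr_by u : measurableTypeR R -> measurableTypeR R :=
  fun x => (x : R) + u.

Lemma measurable_addr_by u : measurable_fun setT (addr_by u).
Proof. exact: (@measurable_funD _ R R setT id (cst u)). Qed.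

Lemma lebesgue_measure_addr u (A : set R) : measurable A ->
  mu (addr_by u @^-1` A) = mu A.
Proof.
move=> mA.
pose mf := isMeasurableFun.Build _ _ _ _ _ (measurable_addr_by u).
pose ph : {mfun measurableTypeR R >-> measurableTypeR R} := HB.pack (addr_by u) mf.
symmetry; apply: (@lebesgue_measure_unique R (pushforward mu ph) _ A mA).
move=> _ [[a b] _ <-] /=; rewrite /pushforward.
have -> : (addr_by u) @^-1` `]a, b]%classic = `]a - u, b - u]%classic.
  apply/seteqP; split => x /=; rewrite !in_itv /= /addr_by; lra.
rewrite !lebesgue_measure_itv /= !lte_fin ltrD2r.
by case: ifP => // _; rewrite -!EFinD; congr (_%:E); ring.
Qed.

(** A class on which all the integrals below exist. *)
Definition circ f := [/\ measurable_fun [set: R] f, periodic f 1 &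
  exists M : R, forall x, `|f x| <= M].

Definition cint f : R := \int[mu]_(x in `[0, 1[) f x.

Lemma circ_meas f : circ f -> measurable_fun [set: R] f.
Proof. by case. Qed.

Lemma circ_per f : circ f -> periodic f 1.
Proof. by case. Qed.

Lemma circ_integrable f a b : circ f -> mu.-integrable `[a, b[ (EFin \o f).
Proof.
move=> [mf _ [M fM]]; apply: measurable_bounded_integrable => //.
- rewrite /= lebesgue_measure_itv /=; case: ifP => // _.
  by rewrite -EFinB ltry.
- exact: measurable_funTS.
- exists M; split; first exact: num_real.
  by move=> N MN x _; exact/(le_trans (fM x))/ltW.
Qed.

Lemma circ_int01 f : circ f -> mu.-integrable `[0, 1[ (EFin \o f).
Proof. exact: circ_integrable. Qed.

Lemma periodic_intr f : periodic f 1 -> forall x (k : int), f (x + k%:~R) = f x.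
Proof.
move=> pf; have pn x (n : nat) : f (x + n%:R) = f x.
  by elim: n x => [|n IH] x; rewrite ?addr0// -natr1 addrA pf IH.
move=> x [n|n]; first exact: pn.
by rewrite NegzE mulrNz -pmulrn -{2}(subrK n.+1%:R x) pn.
Qed.

Lemma circ_cst c : circ (fun=> c).
Proof. by split => //; exists `|c|. Qed.

Lemma circD f g : circ f -> circ g -> circ (fun x => f x + g x).
Proof.
move=> [mf pf [M fM]] [mg pg [N gN]]; split; first exact: measurable_funD.
  by move=> x; rewrite pf pg.
by exists (M + N) => x; exact/(le_trans (ler_normD _ _))/lerD.
Qed.

Lemma circM f g : circ f -> circ g -> circ (fun x => f x * g x).
Proof.
move=> [mf pf [M fM]] [mg pg [N gN]]; split; first exact: measurable_funM.
  by move=> x; rewrite pf pg.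
by exists (M * N) => x; rewrite normrM ler_pM.
Qed.

Lemma circZ c f : circ f -> circ (fun x => c * f x).
Proof. by move=> cf; apply: circM => //; exact: circ_cst. Qed.

Lemma circN f : circ f -> circ (fun x => - f x).
Proof.
by move=> [mf pf [M fM]]; split;
  [exact: measurable_funN|move=> x; rewrite pf|exists M => x; rewrite normrN].
Qed.

Lemma circB f g : circ f -> circ g -> circ (fun x => f x - g x).
Proof. by move=> cf cg; apply: circD => //; exact: circN. Qed.

Lemma circ_norm f : circ f -> circ (fun x => `|f x|).
Proof.
move=> [mf pf [M fM]]; split.
- exact: measurableT_comp.
- by move=> x; rewrite pf.
- by exists M => x; rewrite normr_id.
Qed.

Lemma circ_sum (I : Type) (s : seq I) (P : pred I) (F : I -> R -> R) :
  (forall i, P i -> circ (F i)) -> circ (fun x => \sum_(i <- s | P i) F i x).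
Proof.
move=> cF; elim: s => [|i s IH].
  by under eq_fun do rewrite big_nil; exact: circ_cst.
under eq_fun do rewrite big_cons.
case: (boolP (P i)) => Pi; last exact: IH.
by apply: circD => //; exact: cF.
Qed.

Lemma circ_affine f (n : nat) c : circ f -> circ (fun x => f (n%:R * x + c)).
Proof.
move=> [mf pf [M fM]]; split; last by exists M.
- apply: (measurableT_comp mf).
  by apply: measurable_funD => //; exact: measurable_funM.
- move=> x; rewrite mulrDr mulr1 addrAC -[RHS](periodic_intr pf _ n).
  by rewrite -pmulrn.
Qed.

Lemma circ_shift f u : circ f -> circ (fun x => f (x + u)).
Proof.
by move=> /(circ_affine 1 u); under eq_fun do rewrite mul1r.
Qed.

Lemma cintD f g : circ f -> circ g ->
  cint (fun x => f x + g x) = cint f + cint g.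
Proof. by move=> cf cg; apply: RintegralD => //; exact: circ_int01. Qed.

Lemma cintB f g : circ f -> circ g ->
  cint (fun x => f x - g x) = cint f - cint g.
Proof. by move=> cf cg; apply: RintegralB => //; exact: circ_int01. Qed.

Lemma cintZ c f : circ f -> cint (fun x => c * f x) = c * cint f.
Proof. by move=> cf; apply: RintegralZl => //; exact: circ_int01. Qed.

Lemma cintN f : circ f -> cint (fun x => - f x) = - cint f.
Proof.
by move=> cf; rewrite -mulN1r -cintZ//; congr cint; apply/funext => x; rewrite mulN1r.
Qed.

Lemma cint_cst c : cint (fun=> c) = c.
Proof.
rewrite /cint Rintegral_cst//= lebesgue_measure_itv /= lte01 /=.
by rewrite subr0 mulr1.
Qed.

Lemma le_cint f g : circ f -> circ g -> (forall x, f x <= g x) -> cint f <= cint g.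
Proof. by move=> cf cg fg; apply: le_Rintegral => //; exact: circ_int01. Qed.

Lemma cint_ge0 f : (forall x, 0 <= f x) -> 0 <= cint f.
Proof. by move=> f0; exact: Rintegral_ge0. Qed.

Lemma cint_norm f : circ f -> `|cint f| <= cint (fun x => `|f x|).
Proof. by move=> cf; apply: le_normr_Rintegral => //; exact: circ_int01. Qed.

Lemma le_cint_cst f c : circ f -> (forall x, f x <= c) -> cint f <= c.
Proof. by move=> cf fc; rewrite -[leRHS]cint_cst; apply: le_cint => //; exact: circ_cst. Qed.

Lemma cint_sum (I : Type) (s : seq I) (P : pred I) (F : I -> R -> R) :
  (forall i, P i -> circ (F i)) ->
  cint (fun x => \sum_(i <- s | P i) F i x) = \sum_(i <- s | P i) cint (F i).
Proof.
move=> cF; elim: s => [|i s IH].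
  rewrite big_nil -[RHS]cint_cst; congr cint; apply/funext => x.
  by rewrite big_nil.
rewrite big_cons; case: ifP => Pi.
  rewrite -IH -cintD; [|exact: cF|exact: circ_sum].
  by congr cint; apply/funext => x; rewrite big_cons Pi.
by rewrite -IH; congr cint; apply/funext => x; rewrite big_cons Pi.
Qed.

Lemma Rintegral_itv_shift f a b u : circ f ->
  \int[mu]_(x in `[a, b[) f (x + u) = \int[mu]_(x in `[a + u, b + u[) f x.
Proof.
move=> cf.
pose mf := isMeasurableFun.Build _ _ _ _ _ (measurable_addr_by u).
pose ph : {mfun measurableTypeR R >-> measurableTypeR R} := HB.pack (addr_by u) mf.
have pre : (addr_by u) @^-1` `[a + u, b + u[%classic = `[a, b[%classic.
  by apply/seteqP; split => x /=; rewrite !in_itv /= /addr_by; lra.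
rewrite /Rintegral; congr fine.
transitivity (\int[pushforward mu ph]_(y in `[(a + u)%R, (b + u)%R[) (f y)%:E)%E.
  rewrite (@integral_pushforward _ _ _ _ R ph (measurable_addr_by u) mu) //=.
  - by rewrite pre.
  - by apply/measurable_EFinP; exact: circ_meas.
  - rewrite pre; exact: (circ_integrable a b (circ_shift u cf)).
apply: eq_measure_integral => A mA _ /=.
by rewrite /pushforward lebesgue_measure_addr.
Qed.

Lemma Rintegral_itv_split f a b c : circ f -> a <= b -> b <= c ->
  \int[mu]_(x in `[a, c[) f x =
  \int[mu]_(x in `[a, b[) f x + \int[mu]_(x in `[b, c[) f x.
Proof.
move=> cf ab bc.
have -> : `[a, c[%classic = `[a, b[%classic `|` `[b, c[%classic :> set R.
  by rewrite -itv_bndbnd_setU// ?bnd_simp.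
rewrite Rintegral_setU//.
- rewrite -itv_bndbnd_setU ?bnd_simp//; exact: circ_integrable.
- apply/disj_setPS => x /= [] /=; rewrite !in_itv /=; lra.
Qed.

Lemma cint_shift f u : circ f -> cint (fun x => f (x + u)) = cint f.
Proof.
move=> cf; wlog u01 : u / 0 <= u < 1.
  move=> H; rewrite -(H (u - (Num.floor u)%:~R)); last first.
    by have := floor_itv u; rewrite intrD; lra.
  congr cint; apply/funext => x.
  by rewrite addrA -intrN periodic_intr//; exact: circ_per.
rewrite /cint Rintegral_itv_shift// add0r.
rewrite (@Rintegral_itv_split f u 1 (1 + u)) //; [|lra|lra].
have -> : `[1, 1 + u[ = `[0 + 1, u + 1[ :> interval R by rewrite add0r addrC.
rewrite -Rintegral_itv_shift//.
under [X in _ + X]eq_Rintegral do rewrite (circ_per cf).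
by rewrite addrC -Rintegral_itv_split//; lra.
Qed.

Lemma cint_ae_eq f g : circ f -> circ g ->
  {ae mu, forall x, f x = g x} -> cint f = cint g.
Proof.
move=> cf cg fg; rewrite /cint /Rintegral; congr fine.
apply: ae_eq_integral => //.
- by apply/measurable_EFinP/measurable_funTS; exact: circ_meas.
- by apply/measurable_EFinP/measurable_funTS; exact: circ_meas.
- by case: fg => N [mN N0 NP]; exists N; split => // x /= h; apply: NP => /= e;
    apply: h => _; rewrite e.
Qed.

Lemma ae_shift (P : R -> Prop) u : {ae mu, forall x, P x} ->
  {ae mu, forall x, P (x + u)}.
Proof.
move=> [N [mN N0 NP]]; exists (addr_by u @^-1` N); split.
- rewrite -[X in measurable X]setTI; exact: measurable_addr_by.
- by rewrite -N0 lebesgue_measure_addr.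
- by move=> x /= h; apply: NP.
Qed.

Lemma aeS (P Q : R -> Prop) : (forall x, P x -> Q x) ->
  {ae mu, forall x, P x} -> {ae mu, forall x, Q x}.
Proof.
move=> PQ [N [mN N0 NP]]; exists N; split => // x /= nQ; apply: NP => /= Px.
exact/nQ/PQ.
Qed.

Lemma ae_forall (P : nat -> R -> Prop) : (forall n, {ae mu, forall x, P n x}) ->
  {ae mu, forall x, forall n, P n x}.
Proof.
move=> aP; have : mu.-negligible (\bigcup_n [set x | ~ P n x]).
  by apply: negligible_bigcup => n; exact: aP.
by apply: negligibleS => x /= /existsNP[n nP]; exists n.
Qed.

Lemma aeI (P Q : R -> Prop) : {ae mu, forall x, P x} -> {ae mu, forall x, Q x} ->
  {ae mu, forall x, P x /\ Q x}.
Proof.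
move=> aP aQ; have : {ae mu, forall x, forall n : nat, if n is 0%N then P x else Q x}.
  by apply: ae_forall => -[|n].
by apply: aeS => x h; split; [exact: (h 0%N)|exact: (h 1%N)].
Qed.

(** A function with a nonzero integral cannot be negligible. *)
Lemma ae_exists f (P : R -> Prop) : circ f -> 0 < cint f ->
  {ae mu, forall x, P x} -> exists2 x, P x & 0 < f x.
Proof.
move=> cf f0 aP; apply: contrapT => H; move: f0; apply/negP; rewrite -leNgt.
have -> : cint f = cint (fun x => Num.min (f x) 0).
  apply: cint_ae_eq => //.
    case: cf => mf pf [M fM]; split.
    - exact: measurable_minr.
    - by move=> x; rewrite pf.
    - exists M => x; rewrite /Num.min; case: ifP => // _.
      by rewrite normr0 (le_trans _ (fM x)).
  apply: aeS aP => x Px; apply/esym/min_idPl.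
  by rewrite leNgt; apply/negP => fx; apply: H; exists x.
rewrite -[leRHS]cint_cst; apply: le_Rintegral => //; last by move=> x _; rewrite ge_min lexx orbT.
- apply: circ_int01; case: cf => mf pf [M fM]; split.
  + exact: measurable_minr.
  + by move=> x; rewrite pf.
  + exists M => x; rewrite /Num.min; case: ifP => // _.
    by rewrite normr0 (le_trans _ (fM x)).
- exact/circ_int01/circ_cst.
Qed.

End circle_integral.

(** * The sawtooth function *)
Section sawtooth.
Context {R : realType}.
Implicit Types (f g : R -> R) (u w x y c : R).

Definition frac y : R := y - (Num.floor y)%:~R.

Definition psi y : R := frac y - 2^-1.

(** For w between 0 and 1, this is the indicator function of the arc [1 - w, 1) of
    the circle. *)
Definition chi w y : R := psi y - psi (y + w) + w.

Lemma frac_itv y : 0 <= frac y < 1.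
Proof. by rewrite /frac; have := floor_itv y; rewrite intrD; lra. Qed.

Lemma fracDz y (k : int) : frac (y + k%:~R) = frac y.
Proof. by rewrite /frac floorDrz ?intr_int// intrKfloor intrD; ring. Qed.

Lemma fracE y (k : int) : 0 <= y - k%:~R < 1 -> frac y = y - k%:~R.
Proof.
move=> h; rewrite /frac; congr (_ - _%:~R); apply: floor_def.
by rewrite intrD; lra.
Qed.

Lemma psiDz y (k : int) : psi (y + k%:~R) = psi y.
Proof. by rewrite /psi fracDz. Qed.

Lemma psi_le_half y : `|psi y| <= 2^-1.
Proof. by rewrite /psi ler_norml; have := frac_itv y; lra. Qed.

Lemma chi_eq0 w y : 0 <= w -> frac y + w < 1 -> chi w y = 0.
Proof.
move=> w0 h; rewrite /chi /psi (_ : frac (y + w) = frac y + w); first ring.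
rewrite (@fracE _ (Num.floor y)) /frac; first ring.
by have := frac_itv y; rewrite /frac in h *; lra.
Qed.

Lemma chi_eq1 w y : w <= 1 -> 1 <= frac y + w -> chi w y = 1.
Proof.
move=> w1 h; rewrite /chi /psi (_ : frac (y + w) = frac y + w - 1); first ring.
rewrite (@fracE _ (Num.floor y + 1)) /frac; first by rewrite intrD; ring.
by have := frac_itv y; rewrite /frac intrD in h *; lra.
Qed.

Lemma chi_cases w y : 0 <= w <= 1 ->
  (chi w y = 0 /\ frac y + w < 1) \/ (chi w y = 1 /\ 1 <= frac y + w).
Proof.
move=> /andP[w0 w1]; have [h|h] := ltP (frac y + w) 1.
  by left; rewrite chi_eq0.
by right; rewrite chi_eq1.
Qed.

Lemma chi_itv w y : 0 <= w <= 1 -> 0 <= chi w y <= 1.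
Proof. by move=> /chi_cases -/(_ y) [] [-> _]; lra. Qed.

Lemma chi_dist w y : 0 <= w <= 1 -> chi w y != 0 -> dist_int y <= w.
Proof.
move=> w01 c1; have [[c0]|[_ h]] := chi_cases y w01; first by rewrite c0 eqxx in c1.
apply: (le_trans (dist_int_le _ (Num.floor y + 1))).
by rewrite ler_norml intrD; have := frac_itv y; move: h; rewrite /frac; lra.
Qed.

Lemma chi_separated w y y' : 0 <= w <= 1 -> chi w y != 0 -> chi w y' != 0 ->
  dist_int (y - y') < w.
Proof.
move=> w01 c1 c2.
have [[c0]|[_ h1]] := chi_cases y w01; first by rewrite c0 eqxx in c1.
have [[c0]|[_ h2]] := chi_cases y' w01; first by rewrite c0 eqxx in c2.
apply: (le_lt_trans (dist_int_le _ (Num.floor y - Num.floor y'))).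
rewrite intrB ltr_norml; have := frac_itv y; have := frac_itv y'.
by move: h1 h2; rewrite /frac; lra.
Qed.

Lemma circ_psi : circ psi.
Proof.
split.
- apply: measurable_funB => //; apply: measurable_funB => //.
  apply: nondecreasing_measurable => // x y xy; rewrite ler_int.
  exact: le_floor.
- by move=> x; rewrite -[1]/(1%:~R) psiDz.
- by exists 2^-1 => y; exact: psi_le_half.
Qed.

Lemma circ_psi_affine (q : nat) c : circ (fun x => psi (q%:R * x + c)).
Proof. exact: circ_affine circ_psi. Qed.

Lemma circ_chi w : circ (chi w).
Proof.
apply: circD; last exact: circ_cst.
by apply: circB; [exact: circ_psi|exact: circ_shift circ_psi].
Qed.

Lemma circ_chi_affine w (q : nat) c : circ (fun x => chi w (q%:R * x + c)).
Proof. exact: circ_affine (circ_chi w). Qed.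

(** Functions that are Lipschitz in the mean: the analogue of functions of
    bounded variation that is stable under almost everywhere equality. *)
Definition L1lip (V : R) g :=
  forall u, cint (fun x => `|g (x + u) - g x|) <= V * `|u|.

Lemma L1lip_cst (c : R) : L1lip 0 (fun=> c).
Proof.
move=> u; rewrite mul0r.
by rewrite (_ : (fun _ => _) = (fun=> 0)) ?cint_cst//; apply/funext => x;
  rewrite subrr normr0.
Qed.

(** A function that is Lipschitz in the mean is almost independent from a rapidly
    oscillating one. For the indicator function of an arc, which is the
    difference of two translates of the sawtooth, the translation can be
    moved to the other factor. *)
Lemma cint_chi_decorrelation g (V : R) (q : nat) w c :
  circ g -> L1lip V g -> (0 < q)%N -> 0 <= w ->
  `|cint (fun x => g x * (chi w (q%:R * x + c) - w))| <= V * w / q%:R.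
Proof.
move=> cg Vg q0 w0; have qR : 0 < q%:R :> R by rewrite ltr0n.
have cP := circ_psi_affine q c.
have cP' := circ_psi_affine q (c + w).
have cg' := circ_shift (- (w / q%:R)) cg.
have -> : cint (fun x => g x * (chi w (q%:R * x + c) - w)) =
    - cint (fun x => (g (x - w / q%:R) - g x) * psi (q%:R * x + c)).
  transitivity (cint (fun x => g x * psi (q%:R * x + c))
                - cint (fun x => g x * psi (q%:R * x + (c + w)))).
    rewrite -cintB; [|exact: circM|exact: circM].
    by congr cint; apply/funext => x; rewrite /chi addrA; ring.
  rewrite -(cint_shift (- (w / q%:R)) (circM cg cP')).
  rewrite (_ : (fun x => g (x - w / q%:R) * _) =
    (fun x => g (x - w / q%:R) * psi (q%:R * x + c))); last first.
    apply/funext => x; congr (_ * psi _).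
    by rewrite mulrBr [q%:R * (w / _)]mulrC divfK ?gt_eqF//; ring.
  rewrite -cintB; [|exact: circM|exact: circM].
  rewrite -cintN; last by apply: circM => //; exact: circB.
  by congr cint; apply/funext => x; ring.
have cd : circ (fun x => g (x - w / q%:R) - g x) by exact: (circB cg' cg).
rewrite normrN; apply: (le_trans (cint_norm (circM cd cP))).
apply: (@le_trans _ _ (cint (fun x => `|g (x - w / q%:R) - g x|))).
  apply: le_cint; [exact/circ_norm/circM|exact: circ_norm|].
  move=> x; rewrite normrM ler_piMr//; have := psi_le_half (q%:R * x + c); lra.
by apply: (le_trans (Vg _)); rewrite normrN ger0_norm ?mulrA // divr_ge0.
Qed.

Lemma cint_chi (q : nat) w c : (0 < q)%N -> 0 <= w ->
  cint (fun x => chi w (q%:R * x + c)) = w.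
Proof.
move=> q0 w0; have := cint_chi_decorrelation c (circ_cst 1) (L1lip_cst 1) q0 w0.
rewrite !mul0r normr_le0 => /eqP h.
apply/eqP; rewrite -subr_eq0 -{2}(cint_cst w) -cintB; first last.
- exact: circ_cst.
- exact: circ_chi_affine.
by rewrite -[X in _ == X]h; apply/eqP; congr cint; apply/funext => x; rewrite mul1r.
Qed.

(** The difference quotients of a periodic primitive converge to the sawtooth, and
    in each of them the translation can be moved to g. *)
Lemma cint_psi_decorrelation g (V : R) (q : nat) c :
  circ g -> L1lip V g -> (0 < q)%N ->
  `|cint (fun x => g x * psi (q%:R * x + c))| <= V / q%:R.
Proof.
move=> cg Vg q0; have qR : 0 < q%:R :> R by rewrite ltr0n.
have [M gM] : exists M, forall x, `|g x| <= M by case: cg.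
have M0 : 0 <= M by exact: le_trans (gM 0).
pose Q y : R := (frac y ^+ 2 - frac y) / 2.
have Qb y : `|Q y| <= 1 by rewrite /Q ler_norml; have := frac_itv y; nra.
have cQ d : circ (fun x => Q (q%:R * x + d)).
  apply: (@circ_affine _ Q); split.
  - rewrite (_ : Q = fun y => ((psi y + 2^-1) ^+ 2 - (psi y + 2^-1)) / 2); last first.
      by apply/funext => y; rewrite /Q /psi subrK.
    have mp : measurable_fun setT psi by exact: (circ_meas circ_psi).
    apply: measurable_funM => //; apply: measurable_funB; last exact: measurable_funD.
    by apply: measurable_funX; exact: measurable_funD.
  - by move=> x; rewrite /Q -[1]/(1%:~R) fracDz.
  - by exists 1.
have step h : 0 < h < 1 ->
    `|cint (fun x => g x * psi (q%:R * x + c))| <= V / q%:R + 2 * M * h.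
  move=> /andP[h0 h1].
  have h01 : 0 <= h <= 1 by rewrite !ltW.
  have key y : `|Q (y + h) - Q y - h * psi y| <= h * (h + chi h y).
    have [[c0 lt1]|[c1 ge1]] := chi_cases y h01.
      have fE : frac (y + h) = frac y + h by move: c0; rewrite /chi /psi; lra.
      by rewrite c0 /Q fE /psi ler_norml; nra.
    have fE : frac (y + h) = frac y + h - 1 by move: c1; rewrite /chi /psi; lra.
    rewrite c1 /Q fE /psi ler_norml; have := frac_itv y; nra.
  have cP := circ_psi_affine q c.
  have cC := circ_chi_affine h q c.
  have cg' := circ_shift (- (h / q%:R)) cg.
  have E1 : cint (fun x => g x * (Q (q%:R * x + (c + h)) - Q (q%:R * x + c))) =
      cint (fun x => (g (x - h / q%:R) - g x) * Q (q%:R * x + c)).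
    transitivity (cint (fun x => g x * Q (q%:R * x + (c + h)))
                  - cint (fun x => g x * Q (q%:R * x + c))).
      rewrite -cintB; [|exact: circM|exact: circM].
      by congr cint; apply/funext => x; ring.
    rewrite -(cint_shift (- (h / q%:R)) (circM cg (cQ (c + h)))).
    rewrite (_ : (fun x => g (x - h / q%:R) * _) =
      (fun x => g (x - h / q%:R) * Q (q%:R * x + c))); last first.
      apply/funext => x; congr (_ * Q _).
      by rewrite mulrBr [q%:R * (h / _)]mulrC divfK ?gt_eqF//; ring.
    rewrite -cintB; [|exact: circM|exact: circM].
    by congr cint; apply/funext => x; ring.
  have cd : circ (fun x => g (x - h / q%:R) - g x) by exact: (circB cg' cg).
  have B1 : `|cint (fun x => g x * (Q (q%:R * x + (c + h)) - Q (q%:R * x + c)))|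
      <= V * (h / q%:R).
    rewrite E1; apply: (le_trans (cint_norm (circM cd (cQ c)))).
    apply: (@le_trans _ _ (cint (fun x => `|g (x - h / q%:R) - g x|))).
      apply: le_cint; [exact/circ_norm/circM|exact: circ_norm|].
      by move=> x; rewrite normrM ler_piMr.
    by apply: (le_trans (Vg _)); rewrite normrN ger0_norm ?divr_ge0// ?ltW.
  have cD : circ (fun x => Q (q%:R * x + (c + h)) - Q (q%:R * x + c)) by exact: circB.
  have chP := circZ h cP.
  have B2 : `|cint (fun x => g x * (Q (q%:R * x + (c + h)) - Q (q%:R * x + c)))
      - cint (fun x => g x * (h * psi (q%:R * x + c)))| <= M * (h * (2 * h)).
    rewrite -cintB; [|exact: circM|exact: circM].
    apply: (le_trans (cint_norm (circB (circM cg cD) (circM cg chP)))).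
    have -> : M * (h * (2 * h)) = cint (fun x => M * h * (h + chi h (q%:R * x + c))).
      rewrite cintZ; last by apply: circD => //; exact: circ_cst.
      rewrite cintD//; last exact: circ_cst.
      by rewrite cint_cst cint_chi//; [ring|exact: ltW].
    apply: le_cint.
    - by apply/circ_norm/circB; exact: circM.
    - by apply: circZ; apply: circD => //; exact: circ_cst.
    - move=> x; rewrite -mulrBr normrM -mulrA; apply: ler_pM => //.
      by rewrite [_ + (c + h)]addrA; exact: key.
  have E3 : cint (fun x => g x * (h * psi (q%:R * x + c))) =
      h * cint (fun x => g x * psi (q%:R * x + c)).
    by rewrite -cintZ; [congr cint; apply/funext => x; ring|exact: circM].
  rewrite E3 in B2.
  set A := cint _ in B1 B2; set B := cint _ in B2 *.
  have : h * `|B| <= h * (V / q%:R + 2 * M * h).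
    rewrite -{1}(gtr0_norm h0) -normrM.
    have := ler_normB A (A - h * B); rewrite opprB addrCA subrr addr0 => hB.
    apply: (le_trans hB); apply: (le_trans (lerD B1 B2)).
    by rewrite le_eqVlt; apply/orP; left; apply/eqP; ring.
  by rewrite ler_pM2l.
apply/ler_addgt0Pr => e e0.
pose h := Num.min 2^-1 (e / (2 * M + 1)).
have h0 : 0 < h by rewrite lt_min invr_gt0 ltr0n /= divr_gt0//; lra.
have h1 : h < 1 by rewrite gt_min; apply/orP; left; lra.
apply: (le_trans (step h _)); first by rewrite h0.
rewrite lerD2l; have : h <= e / (2 * M + 1) by rewrite ge_min lexx orbT.
rewrite ler_pdivlMr; last lra.
by nra.
Qed.

Lemma cint_psi (q : nat) c : (0 < q)%N -> cint (fun x => psi (q%:R * x + c)) = 0.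
Proof.
move=> q0; have := cint_psi_decorrelation c (circ_cst 1) (L1lip_cst 1) q0.
rewrite mul0r normr_le0 => /eqP h; rewrite -[RHS]h.
by congr cint; apply/funext => x; rewrite mul1r.
Qed.

Lemma L1lip_psi (q : nat) c : (0 < q)%N ->
  L1lip (2 * q%:R) (fun x => psi (q%:R * x + c)).
Proof.
move=> q0; have qR : 0 < q%:R :> R by rewrite ltr0n.
have pos u d : 0 <= u ->
    cint (fun x => `|psi (q%:R * (x + u) + d) - psi (q%:R * x + d)|) <= 2 * q%:R * u.
  move=> u0; set w := q%:R * u; have w0 : 0 <= w by exact: mulr_ge0 (ltW qR) _.
  have cd : circ (fun x => `|psi (q%:R * (x + u) + d) - psi (q%:R * x + d)|).
    apply/circ_norm/circB; last exact: circ_psi_affine.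
    exact: (circ_shift u (circ_psi_affine q d)).
  have [w1|w1] := leP w 1; last first.
    apply: le_cint_cst => // x; have := psi_le_half (q%:R * (x + u) + d).
    have := psi_le_half (q%:R * x + d); rewrite -mulrA -/w.
    by have := ler_normB (psi (q%:R * (x + u) + d)) (psi (q%:R * x + d)); lra.
  apply: (@le_trans _ _ (cint (fun x => w + chi w (q%:R * x + d)))).
    apply: le_cint => //; first by apply: circD; [exact: circ_cst|exact: circ_chi_affine].
    move=> x; rewrite (_ : psi (q%:R * (x + u) + d) - psi (q%:R * x + d) =
      w - chi w (q%:R * x + d)); last first.
      rewrite (_ : q%:R * (x + u) + d = q%:R * x + d + w); last by rewrite /w; ring.
      by rewrite /chi; ring.
    apply: (le_trans (ler_normB _ _)).
    have /andP[? ?]: 0 <= chi w (q%:R * x + d) <= 1 by apply: chi_itv; rewrite w0.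
    by rewrite !ger0_norm.
  rewrite cintD; [|exact: circ_cst|exact: circ_chi_affine].
  by rewrite cint_cst cint_chi// -mulrA -/w; lra.
move=> u; have [u0|u0] := leP 0 u; first by rewrite ger0_norm//; exact: pos.
rewrite ltr0_norm//.
have := pos (- u) c; rewrite oppr_ge0 => /(_ (ltW u0)).
have cd : circ (fun x => `|psi (q%:R * (x - u) + c) - psi (q%:R * x + c)|).
  apply/circ_norm/circB; last exact: circ_psi_affine.
  exact: (circ_shift (- u) (circ_psi_affine q c)).
rewrite -(cint_shift u cd); apply: le_trans.
rewrite le_eqVlt; apply/orP; left; apply/eqP; congr cint; apply/funext => x.
by rewrite addrK distrC.
Qed.

Lemma L1lip_chi (q : nat) w c : (0 < q)%N ->
  L1lip (4 * q%:R) (fun x => chi w (q%:R * x + c)).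
Proof.
move=> q0 u; have H := L1lip_psi _ q0.
have cd d : circ (fun x => `|psi (q%:R * (x + u) + d) - psi (q%:R * x + d)|).
  apply/circ_norm/circB; last exact: circ_psi_affine.
  exact: (circ_shift u (circ_psi_affine q d)).
apply: (@le_trans _ _ (cint (fun x =>
    `|psi (q%:R * (x + u) + c) - psi (q%:R * x + c)| +
    `|psi (q%:R * (x + u) + (c + w)) - psi (q%:R * x + (c + w))|))).
  apply: le_cint.
  - apply/circ_norm/circB; last exact: circ_chi_affine.
    exact: (circ_shift u (circ_chi_affine w q c)).
  - exact: circD.
  - move=> x; rewrite /chi -[_ * (x + u) + c + w]addrA -[_ * x + c + w]addrA.
    apply: le_trans (ler_normB _ _).
    by rewrite le_eqVlt; apply/orP; left; apply/eqP; congr `|_|; ring.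
rewrite cintD//; have := H c u; have := H (c + w) u; lra.
Qed.

End sawtooth.

(** * Complex numbers of modulus one *)
Section unit_complex.
Context {R : realType}.
Implicit Types (x y : R) (z w : R[i]).

Local Notation cabs := Normc.normc.
Local Notation e := e2ipi.

Lemma cabs_ge0 z : 0 <= cabs z.
Proof. by case: z => a b; exact: sqrtr_ge0. Qed.

Lemma cabsD z w : cabs (z + w) <= cabs z + cabs w.
Proof. exact: (@le_normcD R z w). Qed.

Lemma cabsN z : cabs (- z) = cabs z.
Proof. exact: (@normcN R z). Qed.

Lemma cabsBC z w : cabs (z - w) = cabs (w - z).
Proof. by rewrite -cabsN opprB. Qed.

Lemma cabsB_triangle z w v : cabs (z - v) <= cabs (z - w) + cabs (w - v).
Proof. by have := cabsD (z - w) (w - v); rewrite addrA subrK. Qed.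

Lemma cabs0 : cabs (0 : R[i]) = 0.
Proof. exact: Normc.normc0. Qed.

Lemma cabs1 : cabs (1 : R[i]) = 1.
Proof. exact: Normc.normc1. Qed.

Lemma cabsE z : cabs z = Num.sqrt (complex.Re z ^+ 2 + complex.Im z ^+ 2).
Proof. by case: z. Qed.

Lemma cabs_sqr z : cabs z ^+ 2 = complex.Re z ^+ 2 + complex.Im z ^+ 2.
Proof. by rewrite cabsE sqr_sqrtr// addr_ge0 ?sqr_ge0. Qed.

Lemma cabs_le_ReIm z : cabs z <= `|complex.Re z| + `|complex.Im z|.
Proof.
rewrite -ler_sqr ?nnegrE ?cabs_ge0 ?addr_ge0// cabs_sqr sqrrD.
rewrite !real_normK ?num_real// -addrA lerD2l addrC lerDl.
by rewrite mulrn_wge0// mulr_ge0.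
Qed.

Lemma cabs_eq0 z : cabs z = 0 -> z = 0.
Proof. exact: Normc.eq0_normc. Qed.

Lemma norm_cabs z : (`|z| = 1) <-> (cabs z = 1).
Proof.
rewrite normc_def -cabsE; split => [[]//|->//].
Qed.

Lemma cabs_unit_neq0 z : cabs z = 1 -> z != 0.
Proof. by move=> z1; apply/eqP => z0; move: z1; rewrite z0 cabs0 => /esym/eqP; rewrite oner_eq0. Qed.

Lemma eD x y : e (x + y) = e x * e y.
Proof.
rewrite /e2ipi mulrDr cosD sinD; apply/eqP; rewrite eq_complex /=.
by rewrite eqxx /= addrC.
Qed.

Lemma e0 : e (0 : R) = 1.
Proof. by rewrite /e2ipi mulr0 cos0 sin0. Qed.

Lemma cabs_e x : cabs (e x) = 1.
Proof. by rewrite /= cos2Dsin2 sqrtr1. Qed.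

Lemma e_neq0 x : e x != 0.
Proof. exact/cabs_unit_neq0/cabs_e. Qed.

Lemma eN x : e (- x) = (e x)^-1.
Proof.
by apply: (mulfI (e_neq0 x)); rewrite -eD subrr e0 mulfV// e_neq0.
Qed.

Lemma eB x y : e (x - y) = e x / e y.
Proof. by rewrite eD eN. Qed.

Lemma e1 : e (1 : R) = 1.
Proof. by rewrite /e2ipi mulr1 mulr_natl cos2pi sin2pi. Qed.

Lemma e_nat x (n : nat) : e (x *+ n) = e x ^+ n.
Proof. by elim: n => [|n IH]; rewrite ?mulr0n ?expr0 ?e0// mulrS eD IH exprS. Qed.

Lemma e_int (k : int) : e (k%:~R : R) = 1.
Proof.
by case: k => n; rewrite ?NegzE ?mulrNz ?eN -?pmulrn e_nat e1 expr1n ?invr1.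
Qed.

Lemma eDz x (k : int) : e (x + k%:~R) = e x.
Proof. by rewrite eD e_int mulr1. Qed.

Lemma e_int_eq x y : x - y \is a Num.int -> e x = e y.
Proof. by move=> /intrP[k xy]; rewrite -(subrK y x) xy addrC eDz. Qed.

Lemma e_sum (I : Type) (s : seq I) (P : pred I) (F : I -> R) :
  e (\sum_(i <- s | P i) F i) = \prod_(i <- s | P i) e (F i).
Proof. by apply: (big_morph e) => [x y|]; [exact: eD|exact: e0]. Qed.

Lemma MVT_lipschitz (f df : R -> R) : (forall x, is_derive x 1 f (df x)) ->
  (forall x, `|df x| <= 1) -> forall x y, `|f x - f y| <= `|x - y|.
Proof.
move=> fd df1 x y; wlog xy : x y / y <= x.
  move=> H; have [yx|xy] := leP y x; first exact: H.
  by rewrite distrC (distrC x); apply: H; exact: ltW.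
have [//|c _ ->] := @MVT_segment R f df y x xy.
- apply: continuous_subspaceT => u; apply: differentiable_continuous.
  by apply/derivable1_diffP; have [] := fd u.
- by rewrite normrM ler_piMl.
Qed.

Lemma pi_le4 : pi <= 4 :> R.
Proof.
have [/andP[h0 h1] _] := pihalf_02_cos_pihalf R; lra.
Qed.

Lemma e_lipschitz x y : cabs (e x - e y) <= 16 * `|x - y|.
Proof.
apply: (le_trans (cabs_le_ReIm _)); rewrite /=.
have d2 : `|2 * pi * x - 2 * pi * y| <= 8 * `|x - y|.
  rewrite -mulrBr normrM ler_wpM2r// ger0_norm ?mulr_ge0 ?pi_ge0//.
  by have := pi_le4; lra.
have hc : `|cos (2 * pi * x) - cos (2 * pi * y)| <= `|2 * pi * x - 2 * pi * y|.
  apply: (@MVT_lipschitz cos (fun x => - sin x)) => u.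
  by rewrite normrN sin_max.
have hs : `|sin (2 * pi * x) - sin (2 * pi * y)| <= `|2 * pi * x - 2 * pi * y|.
  apply: (@MVT_lipschitz sin cos) => u.
  exact: cos_max.
lra.
Qed.

Lemma e_sub1_lipschitz x : cabs (e x - 1) <= 16 * `|x|.
Proof. by have := e_lipschitz x 0; rewrite e0 subr0. Qed.

Lemma cabs_sub_le2 z w : cabs z = 1 -> cabs w = 1 -> cabs (z - w) <= 2.
Proof. by move=> z1 w1; have := cabsD z (- w); rewrite cabsN z1 w1. Qed.

(** Doubling the angle at most doubles the chord; this reduces the estimate to
    angles that are at least a quarter of turn. *)
Lemma e_sub1_lower_small x : `|x| <= 2^-1 -> 2 * `|x| <= cabs (e x - 1).
Proof.
have base y : 4^-1 <= `|y| -> `|y| <= 2^-1 -> 1 <= cabs (e y - 1).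
  move=> y4 y2; rewrite -[leLHS]sqrtr1 cabsE ler_wsqrtr//=.
  have c0 : cos (2 * pi * y) <= 0.
    have -> : cos (2 * pi * y) = cos (2 * pi * `|y|).
      have [y0|y0] := leP 0 y; first by rewrite ger0_norm.
      by rewrite ltr0_norm// mulrN cosN.
    have p2 := pi_ge2 R.
    have -> : 2 * pi * `|y| = (2 * pi * `|y| - pi) + pi by rewrite subrK.
    rewrite cosDpi oppr_le0; apply: cos_ge0_pihalf; nra.
  have := cos2Dsin2 (2 * pi * y); rewrite subr0 => h; nra.
have [->|x0] := eqVneq x 0; first by rewrite normr0 mulr0 cabs_ge0.
have xp : 0 < `|x| by rewrite normr_gt0.
have [n xn] : exists n : nat, 4^-1 <= 2 ^+ n * `|x|.
  have [n hn] : exists n : nat, `|x|^-1 < n%:R.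
    by exists (Num.truncn `|x|^-1).+1; exact: truncnS_gt.
  exists n; have : `|x| * n%:R >= 1.
    by rewrite mulrC -ler_pdivrMr// mul1r ltW.
  have : (n%:R : R) <= 2 ^+ n by rewrite -natrX ler_nat ltnW// ltn_expl.
  nra.
elim: n x {x0} xp xn => [|n IH] x xp xn x2.
  by rewrite expr0 mul1r in xn; have := base x xn x2; lra.
have [x4|x4] := leP 4^-1 `|x|; first by have := base x x4 x2; lra.
have n2 : `|2 * x| = 2 * `|x| by rewrite normrM ger0_norm.
have := IH (2 * x); rewrite n2 => /(_ ltac:(lra)).
rewrite mulrA -exprSr => /(_ xn ltac:(lra)).
have -> : e (2 * x) - 1 = (e x - 1) * (e x + 1).
  by rewrite mulr_natl e_nat -subr_sqr_1.
rewrite Normc.normcM => h.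
have : cabs (e x + 1) <= 2 by have := cabsD (e x) 1; rewrite cabs_e cabs1; lra.
have := cabs_ge0 (e x - 1); nra.
Qed.

Lemma e_sub1_lower x : 2 * dist_int x <= cabs (e x - 1).
Proof.
rewrite -(eDz x (- nearest_int x)) intrN; apply: e_sub1_lower_small.
exact: dist_int_le_half.
Qed.

Lemma e_eq1 x : e x = 1 -> x \is a Num.int.
Proof.
move=> ex; have := e_sub1_lower x; rewrite ex subrr cabs0 => h.
rewrite -dist_int_eq0 eq_le dist_int_ge0 andbT; lra.
Qed.

Lemma e_surj z : cabs z = 1 -> exists x, z = e x.
Proof.
move=> z1; have := cabs_sqr z; rewrite z1 expr1n => ab.
case: z ab {z1} => a b /= ab.
have a1 : -1 <= a <= 1 by nra.
have p0 : 2 * pi != 0 :> R by rewrite mulf_neq0// gt_eqF// pi_gt0.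
have ca : cos (acos a) = a by rewrite acosK// in_itv.
have sa : sin (acos a) = `|b|.
  rewrite sin_acos// (_ : 1 - a ^+ 2 = b ^+ 2); last by rewrite ab; ring.
  by rewrite sqrtr_sqr.
have [b0|b0] := leP 0 b.
  exists (acos a / (2 * pi)).
  by rewrite /e2ipi [2 * pi * _]mulrC divfK// ca sa ger0_norm.
exists (- (acos a / (2 * pi))).
by rewrite /e2ipi mulrN [2 * pi * _]mulrC divfK// cosN sinN ca sa ltr0_norm// opprK.
Qed.

End unit_complex.

(** * Unimodular functions on the circle *)
Section unimodular.
Context {R : realType}.
Implicit Types (f g h : R -> R[i]) (u x y : R) (z w : R[i]).

Local Notation cabs := Normc.normc.
Local Notation e := e2ipi.
Notation mu := (@lebesgue_measure R).

Definition unim f := [/\ measurable_fun [set: R] (fun x => complex.Re (f x)),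
  measurable_fun [set: R] (fun x => complex.Im (f x)),
  periodic f 1 & forall x, cabs (f x) = 1].

(** The distance in the mean, invariant under multiplication by a unimodular
    function and under rotation. *)
Definition udist f g : R := cint (fun x => cabs (f x - g x)).

Lemma unim_cabs f x : unim f -> cabs (f x) = 1.
Proof. by case. Qed.

Lemma unim_neq0 f x : unim f -> f x != 0.
Proof. by move=> uf; apply: cabs_unit_neq0; exact: unim_cabs. Qed.

Lemma circ_cabs (f : R -> R[i]) (M : R) :
  measurable_fun [set: R] (fun x => complex.Re (f x)) ->
  measurable_fun [set: R] (fun x => complex.Im (f x)) ->
  periodic f 1 -> (forall x, cabs (f x) <= M) -> circ (fun x => cabs (f x)).
Proof.
move=> mr mi pf fM; split.
- rewrite (_ : (fun x => cabs (f x)) = Num.sqrt \o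
    (fun x => complex.Re (f x) ^+ 2 + complex.Im (f x) ^+ 2)); last first.
    by apply/funext => x; rewrite /= cabsE.
  apply: measurableT_comp; first by apply: continuous_measurable_fun; exact: sqrt_continuous.
  by apply: measurable_funD; exact: measurable_funX.
- by move=> x; rewrite pf.
- by exists M => x; rewrite ger0_norm ?cabs_ge0.
Qed.

Lemma circ_cabsB f g : unim f -> unim g -> circ (fun x => cabs (f x - g x)).
Proof.
move=> [fr fi pf f1] [gr gi pg g1]; apply: (@circ_cabs _ 2).
- rewrite (_ : (fun _ => _) = (fun x => complex.Re (f x) - complex.Re (g x))).
    exact: measurable_funB.
  by apply/funext => x; case: (f x) (g x) => a b [].
- rewrite (_ : (fun _ => _) = (fun x => complex.Im (f x) - complex.Im (g x))).
    exact: measurable_funB.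
  by apply/funext => x; case: (f x) (g x) => a b [].
- by move=> x; rewrite pf pg.
- by move=> x; exact: cabs_sub_le2.
Qed.

Lemma unim_cst z : cabs z = 1 -> unim (fun=> z).
Proof. by []. Qed.

Lemma unimM f g : unim f -> unim g -> unim (fun x => f x * g x).
Proof.
move=> [fr fi pf f1] [gr gi pg g1]; split.
- rewrite (_ : (fun _ => _) = (fun x => complex.Re (f x) * complex.Re (g x) -
      complex.Im (f x) * complex.Im (g x))).
    by apply: measurable_funB; exact: measurable_funM.
  by apply/funext => x; case: (f x) (g x) => a b [].
- rewrite (_ : (fun _ => _) = (fun x => complex.Re (f x) * complex.Im (g x) +
      complex.Im (f x) * complex.Re (g x))).
    by apply: measurable_funD; exact: measurable_funM.
  by apply/funext => x; case: (f x) (g x) => a b [].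
- by move=> x; rewrite pf pg.
- by move=> x; rewrite Normc.normcM f1 g1 mulr1.
Qed.

Lemma unimV f : unim f -> unim (fun x => (f x)^-1).
Proof.
move=> [fr fi pf f1].
have E x : (f x)^-1 = Complex (complex.Re (f x)) (- complex.Im (f x)).
  have fx0 : f x != 0 by apply: cabs_unit_neq0.
  apply: (mulfI fx0); rewrite mulfV//.
  have := cabs_sqr (f x); rewrite f1 expr1n; case: (f x) => a b /= ab.
  apply/eqP; rewrite eq_complex /=; apply/andP; split; apply/eqP.
    by rewrite ab; ring.
  by ring.
split.
- by under eq_fun do rewrite E /=.
- by under eq_fun do rewrite E /=; exact: measurable_funN.
- by move=> x; rewrite pf.
- by move=> x; rewrite Normc.normcV f1 invr1.
Qed.

Lemma unim_div f g : unim f -> unim g -> unim (fun x => f x / g x).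
Proof. by move=> uf ug; apply: unimM => //; exact: unimV. Qed.

Lemma unim_prod (I : Type) (s : seq I) (P : pred I) (F : I -> R -> R[i]) :
  (forall i, P i -> unim (F i)) -> unim (fun x => \prod_(i <- s | P i) F i x).
Proof.
move=> uF; elim: s => [|i s IH].
  by under eq_fun do rewrite big_nil; apply: unim_cst; exact: cabs1.
under eq_fun do rewrite big_cons.
case: (boolP (P i)) => Pi; last exact: IH.
by apply: unimM => //; exact: uF.
Qed.

Lemma unim_e (h : R -> R) : measurable_fun [set: R] h ->
  (forall x, h (x + 1) - h x \is a Num.int) -> unim (fun x => e (h x)).
Proof.
move=> mh ph; have m2 : measurable_fun setT (fun x => 2 * pi * h x) by exact: measurable_funM.
split.
- exact: measurableT_comp (continuous_measurable_fun (@continuous_cos R)) m2.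
- exact: measurableT_comp (continuous_measurable_fun (@continuous_sin R)) m2.
- by move=> x; exact: e_int_eq.
- by move=> x; exact: cabs_e.
Qed.

Lemma unim_e_circ (h : R -> R) : circ h -> unim (fun x => e (h x)).
Proof.
move=> [mh ph _]; apply: unim_e => // x; rewrite ph subrr; exact: int_num0.
Qed.

Lemma unim_character (k : int) : unim (fun x => e (k%:~R * x)).
Proof.
apply: unim_e; first exact: measurable_funM.
by move=> x; rewrite mulrDr mulr1 addrAC subrr add0r intr_int.
Qed.

Lemma unim_shift f u : unim f -> unim (fun x => f (x + u)).
Proof.
move=> [fr fi pf f1].
have mu' : measurable_fun [set: R] (fun x : R => x + u) by exact: measurable_funD.
split.
- exact: measurableT_comp fr mu'.
- exact: measurableT_comp fi mu'.
- by move=> x; rewrite addrAC pf.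
- by [].
Qed.

Lemma udist_ge0 f g : 0 <= udist f g.
Proof. by apply: cint_ge0 => x; exact: cabs_ge0. Qed.

Lemma udistC f g : udist f g = udist g f.
Proof. by congr cint; apply/funext => x; exact: cabsBC. Qed.

Lemma udist_le f g (h : R -> R) : unim f -> unim g -> circ h ->
  (forall x, cabs (f x - g x) <= h x) -> udist f g <= cint h.
Proof. by move=> uf ug ch fgh; apply: le_cint => //; exact: circ_cabsB. Qed.

Lemma udist_le2 f g : unim f -> unim g -> udist f g <= 2.
Proof.
move=> uf ug; apply: le_cint_cst; first exact: circ_cabsB.
by move=> x; apply: cabs_sub_le2; exact: unim_cabs.
Qed.

Lemma udist_triangle g f h : unim f -> unim g -> unim h ->
  udist f h <= udist f g + udist g h.
Proof.
move=> uf ug uh; rewrite -cintD; [|exact: circ_cabsB|exact: circ_cabsB].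
apply: udist_le => //; first by apply: circD; exact: circ_cabsB.
by move=> x; exact: cabsB_triangle.
Qed.

Lemma udist_shift f g u : unim f -> unim g ->
  udist (fun x => f (x + u)) (fun x => g (x + u)) = udist f g.
Proof.
move=> uf ug; exact: (cint_shift u (circ_cabsB uf ug)).
Qed.

Lemma udist_mull h f g : unim h ->
  udist (fun x => h x * f x) (fun x => h x * g x) = udist f g.
Proof.
move=> uh; congr cint; apply/funext => x.
by rewrite -mulrBr Normc.normcM unim_cabs// mul1r.
Qed.

Lemma udist_mulr h f g : unim h ->
  udist (fun x => f x * h x) (fun x => g x * h x) = udist f g.
Proof.
move=> uh; congr cint; apply/funext => x.
by rewrite -mulrBl Normc.normcM (unim_cabs x uh) mulr1.
Qed.

Lemma udistM f g f' g' : unim f -> unim g -> unim f' -> unim g' ->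
  udist (fun x => f x * f' x) (fun x => g x * g' x) <= udist f g + udist f' g'.
Proof.
move=> uf ug uf' ug'.
apply: (le_trans (udist_triangle (g := fun x => g x * f' x) _ _ _)); try exact: unimM.
by rewrite (udist_mulr f g uf') (udist_mull f' g' ug).
Qed.

Lemma udist_inv f g : unim f -> unim g ->
  udist (fun x => (f x)^-1) (fun x => (g x)^-1) = udist f g.
Proof.
move=> uf ug; congr cint; apply/funext => x.
have f0 := unim_neq0 x uf; have g0 := unim_neq0 x ug.
have -> : (f x)^-1 - (g x)^-1 = (g x - f x) * ((f x)^-1 * (g x)^-1).
  by field; rewrite f0 g0.
rewrite !Normc.normcM !Normc.normcV (unim_cabs x uf) (unim_cabs x ug).
by rewrite invr1 !mulr1 cabsBC.
Qed.

Lemma udist_div f g f' g' : unim f -> unim g -> unim f' -> unim g' ->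
  udist (fun x => f x / f' x) (fun x => g x / g' x) <= udist f g + udist f' g'.
Proof.
move=> uf ug uf' ug'; rewrite -(udist_inv uf' ug').
by apply: udistM => //; exact: unimV.
Qed.

Lemma udist_prod (I : Type) (s : seq I) (P : pred I) (F G : I -> R -> R[i]) :
  (forall i, P i -> unim (F i)) -> (forall i, P i -> unim (G i)) ->
  udist (fun x => \prod_(i <- s | P i) F i x) (fun x => \prod_(i <- s | P i) G i x)
  <= \sum_(i <- s | P i) udist (F i) (G i).
Proof.
move=> uF uG; elim: s => [|i s IH].
  rewrite big_nil /udist; apply: le_cint_cst => [|x].
    apply: circ_cabsB; under eq_fun do rewrite big_nil; apply: unim_cst; exact: cabs1.
  by rewrite !big_nil subrr cabs0.
rewrite big_cons /udist.
under [X in cint X]eq_fun do rewrite !big_cons.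
case: (boolP (P i)) => Pi; last exact: IH.
apply: (le_trans (udistM _ _ _ _)); rewrite ?lerD2l//;
  try exact: unim_prod; [exact: uF|exact: uG].
Qed.

Lemma udist_ae f g : unim f -> unim g -> {ae mu, forall x, f x = g x} -> udist f g = 0.
Proof.
move=> uf ug fg; rewrite -[RHS]cint_cst; apply: cint_ae_eq.
- exact: circ_cabsB.
- exact: circ_cst.
- by apply: aeS fg => x ->; rewrite subrr cabs0.
Qed.

Lemma udist_cst z w : udist (fun=> z) (fun=> w) = cabs (z - w).
Proof. exact: cint_cst. Qed.

Lemma udist_e (h k : R -> R) : circ h -> circ k ->
  udist (fun x => e (h x)) (fun x => e (k x)) <= 16 * cint (fun x => `|h x - k x|).
Proof.
move=> ch ck; rewrite -cintZ; last exact/circ_norm/circB.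
apply: udist_le; [exact: unim_e_circ|exact: unim_e_circ|exact/circZ/circ_norm/circB|].
by move=> x; exact: e_lipschitz.
Qed.

Lemma unim_ReIm_le1 g x : unim g -> `|complex.Re (g x)| <= 1 /\ `|complex.Im (g x)| <= 1.
Proof.
move=> ug; have := cabs_sqr (g x); rewrite (unim_cabs x ug) expr1n => E.
by rewrite !ler_norml; split; nra.
Qed.

Lemma circ_Re g : unim g -> circ (fun x => complex.Re (g x)).
Proof.
move=> ug; case: (ug) => mr _ pg _; split => //; first by move=> x; rewrite pg.
by exists 1 => x; case: (unim_ReIm_le1 x ug).
Qed.

Lemma circ_Im g : unim g -> circ (fun x => complex.Im (g x)).
Proof.
move=> ug; case: (ug) => _ mi pg _; split => //; first by move=> x; rewrite pg.
by exists 1 => x; case: (unim_ReIm_le1 x ug).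
Qed.

Lemma udistxx (g : R -> R[i]) : udist g g = 0.
Proof.
rewrite /udist; under eq_fun do rewrite subrr cabs0.
exact: cint_cst.
Qed.

Lemma unim_periodic_intr (g : R -> R[i]) x (l : int) : unim g -> g (x + l%:~R) = g x.
Proof.
case=> _ _ pg _; have P (n : nat) y : g (y + n%:R) = g y.
  by elim: n y => [|n IH] y; rewrite ?addr0// -natr1 addrA pg IH.
case: l => n; first by rewrite -pmulrn P.
by rewrite NegzE mulrNz -pmulrn -[in RHS](subrK n.+1%:R x) P.
Qed.

End unimodular.

(** * Sums of the sawtooth along an orbit *)
Section zsum.
Context {R : realType}.
Implicit Types (u v : int -> R) (k K : int).

(** Sum over the integers from 0 to K, counted negatively when K is negative. *)
Definition zsum u K : R :=
  match K with
  | Posz n => \sum_(0 <= i < n) u i%:Z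
  | Negz n => - \sum_(0 <= i < n.+1) u (- i%:Z - 1)
  end.

Lemma zsum0 u : zsum u 0 = 0.
Proof. by rewrite -[zsum u 0]/(\sum_(0 <= i < 0) u i%:Z) big_geq. Qed.

Lemma zsumS u K : zsum u (K + 1) = zsum u K + u K.
Proof.
case: K => n; first by rewrite -PoszD addn1 /= big_nat_recr.
rewrite (_ : Negz n + 1 = - n%:Z); last by rewrite NegzE; lia.
rewrite (_ : zsum u (- n%:Z) = - \sum_(0 <= i < n) u (- i%:Z - 1)); last first.
  by case: n => [|n]; [rewrite oppr0 zsum0 big_geq// oppr0|rewrite -NegzE].
by rewrite [zsum u (Negz n)]/= big_nat_recr//= NegzE
  (_ : - n.+1%:Z = - n%:Z - 1); [ring|lia].
Qed.

Lemma int_step_ind (P : int -> Prop) : P 0 -> (forall K, P K <-> P (K + 1)) ->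
  forall K, P K.
Proof.
move=> P0 PS; case=> n.
  by elim: n => [//|n IH]; rewrite -addn1 PoszD; exact: (PS n).1.
elim: n => [|n IH]; apply: (PS _).2; first by [].
by rewrite (_ : Negz n.+1 + 1 = Negz n)//; rewrite !NegzE; lia.
Qed.

Lemma zsum_unique u (G : int -> R) : G 0 = 0 -> (forall K, G (K + 1) = G K + u K) ->
  forall K, zsum u K = G K.
Proof.
move=> G0 GS; apply: int_step_ind; first by rewrite zsum0 G0.
move=> K; rewrite zsumS GS; split=> [->//|]; exact: addIr.
Qed.

Lemma zsumB u v K : zsum (fun i => u i - v i) K = zsum u K - zsum v K.
Proof.
apply: (@zsum_unique _ (fun K => zsum u K - zsum v K)) => {K} [|K].
  by rewrite !zsum0 subrr.
by rewrite !zsumS; ring.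
Qed.

Lemma zsum_cst (c : R) K : zsum (fun=> c) K = K%:~R * c.
Proof.
apply: (@zsum_unique _ (fun K => K%:~R * c)) => {K} [|K]; first by rewrite mul0r.
by rewrite intrD mulrDl mul1r.
Qed.

Lemma zsum_addn u k (n : nat) : zsum u (k + n%:Z) = zsum u k + \sum_(0 <= i < n) u (k + i%:Z).
Proof.
elim: n => [|n IH]; first by rewrite addr0 big_geq// addr0.
by rewrite -addn1 PoszD addrA zsumS IH addn1 big_nat_recr//= addrA.
Qed.

Lemma eq_zsum u v K : (forall i, `|i| <= `|K| -> u i = v i) -> zsum u K = zsum v K.
Proof.
case: K => n uv /=.
  by apply: eq_big_nat => i /andP[_ ni]; apply: uv; lia.
congr (- _); apply: eq_big_nat => i /andP[_ ni]; apply: uv; lia.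
Qed.

Lemma circ_zsum (F : int -> R -> R) K : (forall i, circ (F i)) ->
  circ (fun x => zsum (fun i => F i x) K).
Proof.
move=> cF; case: K => n /=; first by apply: circ_sum => i _; exact: cF.
by apply: circN; apply: circ_sum => i _; exact: cF.
Qed.

Lemma cint_zsum_norm (F : int -> R -> R) (c : R) K : (forall i, circ (F i)) ->
  (forall i, cint (fun x => `|F i x|) <= c) ->
  cint (fun x => `|zsum (fun i => F i x) K|) <= `|K%:~R| * c.
Proof.
move=> cF Fc; have H (n : nat) (G : nat -> R -> R) : (forall i, circ (G i)) ->
    (forall i, cint (fun x => `|G i x|) <= c) ->
    cint (fun x => `|\sum_(0 <= i < n) G i x|) <= n%:R * c.
  move=> cG Gc; apply: (@le_trans _ _ (cint (fun x => \sum_(0 <= i < n) `|G i x|))).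
    apply: le_cint; [exact/circ_norm/circ_sum|by apply: circ_sum => i _; exact: circ_norm|].
    by move=> x; exact: ler_norm_sum.
  rewrite cint_sum; last by move=> i _; exact: circ_norm.
  apply: (le_trans (ler_sum _ (fun i _ => Gc i))).
  by rewrite big_const_nat subn0 iter_addr addr0 mulr_natl.
case: K => n /=; first by rewrite -pmulrn normr_nat; exact: H.
under eq_fun do rewrite normrN.
by rewrite NegzE intrN normrN -pmulrn normr_nat; exact: H.
Qed.

Lemma zsum_single u (l K : int) : (forall i, `|i| <= `|K| -> i != l -> u i = 0) ->
  zsum u K = ((l < K)%R%:R - (l < 0)%R%:R) * u l.
Proof.
move=> ul; pose v i := (i == l)%:R * u l.
rewrite (@eq_zsum u v); last first.
  move=> i iK; rewrite /v; have [->|il] := eqVneq i l; first by rewrite mul1r.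
  by rewrite mul0r ul.
apply: (@zsum_unique _ (fun K => ((l < K)%R%:R - (l < 0)%R%:R) * u l)) => [|k].
  by rewrite subrr mul0r.
rewrite /v -mulrDl; congr (_ * _).
case: (ltgtP k l) => kl.
- by rewrite (_ : (l < k + 1) = false) ?addr0//; apply/negP; lia.
- by rewrite (_ : (l < k + 1) = true) ?addr0//; lia.
- rewrite -kl (_ : (k < k + 1) = true); last lia.
  by rewrite [false%:R]/(0) add0r addrC.
Qed.

End zsum.

Section transfer.
Context {R : realType} (alpha : R).
Hypothesis alpha_itv : 0 < alpha < 1.
Hypothesis alpha_irr : irrational alpha.
Implicit Types (x y : R) (k K b : int).

Local Notation q := (cf_denominator alpha).
Local Notation p := (cf_numerator alpha).
Local Notation delta := (cf_delta alpha).

(** Its coboundary is psi (y - K alpha) - psi y, so it moves a discontinuity by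
    K alpha. *)
Definition trans K y : R := zsum (fun i => psi (y - (i + 1)%:~R * alpha)) K.

Lemma trans_coboundary K y :
  trans K y - trans K (y + alpha) = psi (y - K%:~R * alpha) - psi y.
Proof.
rewrite /trans -zsumB.
apply: (@zsum_unique _ _ (fun K => psi (y - K%:~R * alpha) - psi y)) => {K} [|K].
  by rewrite mul0r subr0 subrr.
rewrite (_ : y + alpha - (K + 1)%:~R * alpha = y - K%:~R * alpha); first ring.
by rewrite intrD; ring.
Qed.

Lemma circ_trans K beta : circ (fun x => trans K (x - beta)).
Proof.
apply: circ_zsum => i; under eq_fun do rewrite -addrA; exact: circ_shift circ_psi.
Qed.

(** Since p_n is invertible modulo q_n, its multiples by q_n consecutive integers
    form a complete system of residues. *)
Lemma residues_perm n (k N : int) (h : 'I_(q n) -> 'I_(q n)) :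
  (forall i : 'I_(q n), ((h i)%:Z = (N - (k + i%:Z + 1) * p n) %% (q n)%:Z)%Z) ->
  injective h.
Proof.
move=> hE i j hij; have := hE i; rewrite hij hE => /eqP; rewrite eqz_mod_dvd => dv.
have det := cf_det alpha n.
set e : int := (-1) ^+ n in det.
have e2 : e * e = 1 by rewrite /e -expr2 sqrr_sign.
have : ((q n)%:Z %| (i%:Z - j%:Z))%Z.
  rewrite (_ : i%:Z - j%:Z = (i%:Z - j%:Z) * e * p n.+1 * (q n)%:Z
     - e * (q n.+1)%:Z * ((i%:Z - j%:Z) * p n)); last first.
    transitivity (e * e * (i%:Z - j%:Z)); first by rewrite e2 mul1r.
    by rewrite -{2}det; ring.
  apply: rpredB; [exact/dvdz_mull/dvdzz|apply: dvdz_mull].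
  rewrite (_ : _ * p n =
    N - (k + j%:Z + 1) * p n - (N - (k + i%:Z + 1) * p n)) //; ring.
move=> /dvdzP[t tE]; apply/val_inj => /=.
have [ti tj] := (ltn_ord i, ltn_ord j).
have [t0|[t1|t1]] : t = 0 \/ (1 <= t \/ t <= -1) by lia.
- by move: tE; rewrite t0 mul0r; lia.
- by nia.
- by nia.
Qed.

(** Off a small neighbourhood of the multiples of 1/q_n, the sum of the
    sawtooth over q_n consecutive points of the orbit is the sawtooth of q_n y up
    to a constant (Hermite's identity, perturbed). *)
Lemma sum_psi_block n (k : int) (eta : R) :
  (forall i : nat, (i < q n)%N -> `|(k + i%:Z + 1)%:~R| * delta n <= eta) ->
  exists C : R, forall y, eta <= frac ((q n)%:R * y) < 1 - eta ->
    \sum_(0 <= i < q n) psi (y - (k + i%:Z + 1)%:~R * alpha) = psi ((q n)%:R * y) + C.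
Proof.
move=> small; set Q := q n.
have Q0 : 0 < Q%:R :> R by exact: cf_denominatorR_gt0.
have Qz : (0 < Q%:Z)%R by rewrite ltz_nat cf_denominator_gt0.
pose rho : R := (-1) ^+ n * delta n / Q%:R.
have alphaE : alpha = (p n)%:~R / Q%:R + rho.
  apply: (mulfI (lt0r_neq0 Q0)); rewrite (cf_thetaE alpha n) /rho mulrDr.
  by rewrite ![Q%:R * (_ / _)]mulrC !divfK ?lt0r_neq0.
exists (\sum_(i < Q) (i%:R / Q%:R - (k + i%:Z + 1)%:~R * rho - 2^-1) + 2^-1) => y yE.
set f := frac (Q%:R * y) in yE *; set N := Num.floor (Q%:R * y).
have yN : Q%:R * y = N%:~R + f by rewrite /f /frac /N; ring.
pose r (i : nat) : int := ((N - (k + i%:Z + 1) * p n) %% Q%:Z)%Z.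
have rb (i : nat) : 0 <= r i < Q%:Z by rewrite modz_ge0 ?gt_eqF// ltz_pmod.
have rO (i : 'I_Q) : (`|r i| < Q)%N by have := rb i; lia.
pose h (i : 'I_Q) := Ordinal (rO i).
have hinj : injective h.
  apply: (@residues_perm n k N) => i /=; rewrite gez0_abs//.
  by have /andP[] := rb i.
have term (i : 'I_Q) : psi (y - (k + i%:Z + 1)%:~R * alpha) =
    (h i)%:R / Q%:R + f / Q%:R - (k + i%:Z + 1)%:~R * rho - 2^-1.
  rewrite /psi; congr (_ - _).
  pose t : int := ((N - (k + i%:Z + 1) * p n) %/ Q%:Z)%Z.
  have NE : N - (k + i%:Z + 1) * p n = t * Q%:Z + r i by exact: divz_eq.
  have riE : ((h i)%:R : R) = (r i)%:~R.
    by rewrite pmulrn /= gez0_abs//; have /andP[] := rb i.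
  have NR : N%:~R - (k + i%:Z + 1)%:~R * (p n)%:~R = t%:~R * Q%:R + (r i)%:~R :> R.
    by rewrite -intrM -intrB NE intrD intrM.
  have E : y - (k + i%:Z + 1)%:~R * alpha =
      (h i)%:R / Q%:R + f / Q%:R - (k + i%:Z + 1)%:~R * rho + t%:~R.
    apply: (mulfI (lt0r_neq0 Q0)); rewrite riE {1}alphaE mulrBr yN.
    have -> : N%:~R = (k + i%:Z + 1)%:~R * (p n)%:~R + (t%:~R * Q%:R + (r i)%:~R) :> R.
      by rewrite -NR; ring.
    by field; rewrite lt0r_neq0.
  rewrite E fracDz (@fracE _ _ 0) subr0//.
  have := small i (ltn_ord i); set K := (k + i%:Z + 1)%:~R => Kd.
  have qr : Q%:R * (K * rho) = (-1) ^+ n * (K * delta n).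
    by rewrite /rho; field; rewrite lt0r_neq0.
  have Kd2 : `|Q%:R * (K * rho)| <= eta.
    rewrite qr normrM normr_sign mul1r normrM (@gtr0_norm _ (delta n))//.
    exact: cf_delta_gt0.
  have -> : (h i)%:R / Q%:R + f / Q%:R - K * rho =
      ((h i)%:R + f - Q%:R * (K * rho)) / Q%:R by field; rewrite lt0r_neq0.
  have hi : (h i)%:R + 1 <= Q%:R :> R by rewrite natr1 ler_nat ltn_ord.
  have hi0 : 0 <= (h i)%:R :> R by rewrite ler0n.
  move: Kd2; rewrite ler_norml => /andP[k1 k2].
  apply/andP; split; first by apply: divr_ge0; [lra|exact: ltW].
  by rewrite ltr_pdivrMr// mul1r; lra.
rewrite big_mkord (eq_bigr _ (fun i _ => term i)).
rewrite /psi -/f.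
have -> : \sum_(i < Q) ((h i)%:R / Q%:R + f / Q%:R - (k + i%:Z + 1)%:~R * rho - 2^-1) =
    \sum_(i < Q) (h i)%:R / Q%:R + \sum_(i < Q) f / Q%:R +
    \sum_(i < Q) (- (k + i%:Z + 1)%:~R * rho - 2^-1).
  by rewrite -!big_split /=; apply: eq_bigr => i _; ring.
have -> : \sum_(i < Q) (h i)%:R / Q%:R = \sum_(i < Q) i%:R / Q%:R :> R.
  by rewrite [RHS](reindex_inj hinj).
have -> : \sum_(i < Q) f / Q%:R = f.
  by rewrite sumr_const card_ord -[(_ / _) *+ _]mulr_natr divfK ?lt0r_neq0.
have -> : \sum_(i < Q) (i%:R / Q%:R - (k + i%:Z + 1)%:~R * rho - 2^-1) =
    \sum_(i < Q) i%:R / Q%:R + \sum_(i < Q) (- (k + i%:Z + 1)%:~R * rho - 2^-1).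
  by rewrite -big_split /=; apply: eq_bigr => i _; ring.
ring.
Qed.

(** Adding b q_n to K adds |b| blocks of q_n consecutive points, and each block
    contributes a sawtooth at scale 1/q_n. *)
Lemma trans_increment n (k b : int) (eta : R) :
  `|k%:~R| * delta n <= eta -> `|(k + b * (q n)%:Z)%:~R| * delta n <= eta ->
  exists C : R, forall y, eta <= frac ((q n)%:R * y) < 1 - eta ->
    trans (k + b * (q n)%:Z) y - trans k y = b%:~R * psi ((q n)%:R * y) + C.
Proof.
have d0 := cf_delta_gt0 alpha_itv alpha_irr n.
have Qz : (0 < (q n)%:Z)%R by rewrite ltz_nat cf_denominator_gt0.
have pos (k' : int) (m : nat) : `|k'%:~R| * delta n <= eta ->
    `|(k' + m%:Z * (q n)%:Z)%:~R| * delta n <= eta ->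
    exists C : R, forall y, eta <= frac ((q n)%:R * y) < 1 - eta ->
      trans (k' + m%:Z * (q n)%:Z) y - trans k' y = m%:R * psi ((q n)%:R * y) + C.
  elim: m k' => [|m IH] k' h1 h2.
    by exists 0 => y _; rewrite mul0r addr0 subrr mul0r addr0.
  have mid (l : int) : k' <= l <= k' + m.+1%:Z * (q n)%:Z -> `|l%:~R| * delta n <= eta.
    move=> /andP[l1 l2].
    have [ll|ll] := leP (0 : int) l.
      apply: le_trans h2; rewrite ler_pM2r// -!intr_norm ler_int.
      by rewrite !ger0_norm //; exact: le_trans l2.
    apply: le_trans h1; rewrite ler_pM2r// -!intr_norm ler_int.
    by rewrite !ler0_norm ?lerN2 //; [exact: (le_trans l1 (ltW ll))|exact: ltW].
  have [C1 HC1] : exists C : R, forall y, eta <= frac ((q n)%:R * y) < 1 - eta ->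
    \sum_(0 <= i < q n) psi (y - (k' + i%:Z + 1)%:~R * alpha) = psi ((q n)%:R * y) + C.
    apply: sum_psi_block => i iq; apply: mid; apply/andP; split; first lia.
    by rewrite -addrA lerD2l; nia.
  have mS : m.+1%:Z * (q n)%:Z = (q n)%:Z + m%:Z * (q n)%:Z by rewrite -addn1 PoszD; ring.
  have mE : k' + m.+1%:Z * (q n)%:Z = k' + (q n)%:Z + m%:Z * (q n)%:Z by rewrite mS addrA.
  have h3 : `|(k' + (q n)%:Z)%:~R| * delta n <= eta by apply: mid; rewrite mS; nia.
  have h4 : `|(k' + (q n)%:Z + m%:Z * (q n)%:Z)%:~R| * delta n <= eta by rewrite -mE.
  have [C2 HC2] := IH _ h3 h4.
  exists (C1 + C2) => y yE.
  have := HC2 y yE; rewrite /trans -mE.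
  rewrite (zsum_addn _ k' (q n)) HC1// -natr1 => E.
  by rewrite -(subrK (zsum (fun i => psi (y - (i + 1)%:~R * alpha)) k' +
     (psi ((q n)%:R * y) + C1)) (zsum _ (_ + _ * _))) E; ring.
case: b => m h1 h2; first exact: pos.
have h3 : `|(k + Negz m * (q n)%:Z + m.+1%:Z * (q n)%:Z)%:~R| * delta n <= eta.
  by rewrite NegzE mulNr subrK.
have [C HC] := pos _ m.+1 h2 h3.
exists (- C) => y yE; have := HC y yE; rewrite NegzE mulNr subrK => E.
by rewrite -opprB E intrN -pmulrn; ring.
Qed.

End transfer.

(** * Summability *)
Section summability.
Context {R : realType}.
Implicit Types (u v : nat -> R).

Definition summ u := exists B : R, forall N, \sum_(0 <= n < N) u n <= B.

(** Convergence to 0, in a form convenient for explicit estimates. *)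
Definition tends0 u :=
  forall eps : R, 0 < eps -> exists N, forall n, (N <= n)%N -> `|u n| <= eps.

Lemma tends0P u : tends0 u <-> (u n @[n --> \oo] --> (0 : R)).
Proof.
split => [h|/cvgr0Pnorm_le h eps e0].
  apply/cvgr0Pnorm_le => eps e0; have [N hN] := h _ e0.
  by exists N => // n /= /hN.
by have [N _ hN] := h _ e0; exists N => n Nn; exact: hN.
Qed.

Lemma tends0_le u v : (forall n, `|u n| <= v n) -> tends0 v -> tends0 u.
Proof.
move=> uv v0 eps /v0[N hN]; exists N => n /hN h.
exact: (le_trans (uv n) (le_trans (ler_norm _) h)).
Qed.

Lemma tends0D u v : tends0 u -> tends0 v -> tends0 (fun n => u n + v n).
Proof.
move=> hu hv eps e0; have e2 : 0 < eps / 2 by lra.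
have [N hN] := hu _ e2; have [M hM] := hv _ e2.
exists (maxn N M) => n; rewrite geq_max => /andP[/hN h1 /hM h2].
by apply: (le_trans (ler_normD _ _)); lra.
Qed.

Lemma tends0_sum (I : Type) (s : seq I) (u : I -> nat -> R) :
  (forall i, tends0 (u i)) -> tends0 (fun n => \sum_(i <- s) u i n).
Proof.
move=> hu; elim: s => [|i s IH] eps e0.
  by exists 0%N => n _; rewrite big_nil normr0 ltW.
have [N hN] := tends0D (hu i) IH e0; exists N => n /hN.
by rewrite big_cons.
Qed.

Lemma tends0Z c u : tends0 u -> tends0 (fun n => c * u n).
Proof.
move=> hu eps e0; have c1 : 0 < `|c| + 1 by rewrite ltr_wpDl.
have [N hN] := hu _ (divr_gt0 e0 c1); exists N => n /hN; rewrite normrM.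
rewrite ler_pdivlMr// => h; have := normr_ge0 (u n); nra.
Qed.

Lemma tends0_shift k u : tends0 u -> tends0 (fun n => u (n + k)%N).
Proof. by move=> hu eps /hu[N hN]; exists N => n Nn; apply: hN; rewrite (leq_trans Nn)// leq_addr. Qed.

Lemma le_sum_nat_nonneg u (a b : nat) : (forall n, 0 <= u n) ->
  \sum_(a <= n < b) u n <= \sum_(0 <= n < b) u n.
Proof.
move=> u0; have [ab|ba] := leqP a b; last first.
  by rewrite big_geq ?(ltnW ba)// sumr_ge0.
by rewrite (big_cat_nat (leq0n a) ab) /= lerDr sumr_ge0.
Qed.

Lemma summ_tail u : (forall n, 0 <= u n) -> summ u ->
  forall eps, 0 < eps -> exists N, forall a b, (N <= a)%N -> \sum_(a <= n < b) u n <= eps.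
Proof.
move=> u0 [B uB] eps e0.
pose S := [set \sum_(0 <= n < N) u n | N in [set: nat]].
have hS : has_sup S.
  split; first by exists (\sum_(0 <= n < 0) u n); exists 0%N.
  by exists B => _ [N _ <-].
have [_ [N _ <-] hN] := sup_adherent e0 hS.
exists N => a b Na; have [ab|ba] := leqP a b; last by rewrite big_geq ?(ltnW ba)// ltW.
have ub : \sum_(0 <= n < b) u n <= sup S by apply: ub_le_sup => //; [case: hS|exists b].
have := big_cat_nat (leq0n N) (leq_trans Na ab) (F := u) (op := +%R) (P := xpredT).
have : \sum_(a <= n < b) u n <= \sum_(N <= n < b) u n.
  by rewrite (big_cat_nat Na ab) /= lerDr sumr_ge0.
move=> h /= E; rewrite E in ub; lra.
Qed.

Lemma summ_tends0 u : (forall n, 0 <= u n) -> summ u -> tends0 u.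
Proof.
move=> u0 su eps e0; have [N hN] := summ_tail u0 su e0.
by exists N => n Nn; rewrite ger0_norm//; have := hN n n.+1 Nn; rewrite big_nat1.
Qed.

Lemma summ_le u v : (forall n, u n <= v n) -> summ v -> summ u.
Proof. by move=> uv [B vB]; exists B => N; exact: (le_trans (ler_sum _ (fun n _ => uv n))). Qed.

Lemma summ_sum (I : Type) (s : seq I) (P : pred I) (u : I -> nat -> R) :
  (forall i, P i -> summ (u i)) -> summ (fun n => \sum_(i <- s | P i) u i n).
Proof.
move=> hu; elim: s => [|i s [B IH]].
  by exists 0 => N; rewrite big1// => n _; rewrite big_nil.
have [Pi|nPi] := boolP (P i); last first.
  by exists B => N; under eq_bigr do rewrite big_cons (negbTE nPi).
have [C hC] := hu i Pi; exists (C + B) => N.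
under eq_bigr do rewrite big_cons Pi.
by rewrite big_split /= lerD.
Qed.

Lemma summP u : (forall n, 0 <= u n) ->
  (\sum_(0 <= n <oo) (u n)%:E < +oo)%E <-> summ u.
Proof.
move=> u0; have uE n : (0 <= (u n)%:E)%E by rewrite lee_fin.
split=> [h|[B uB]].
  exists (fine (\sum_(0 <= n <oo) (u n)%:E)%E) => N.
  rewrite -lee_fin fineK; last first.
    by rewrite ge0_fin_numE// nneseries_ge0.
  by rewrite -sumEFin; exact: nneseries_lim_ge.
apply: (@le_lt_trans _ _ B%:E); last exact: ltry.
apply: lime_le; first exact: is_cvg_nneseries.
by apply: nearW => N; rewrite sumEFin lee_fin.
Qed.

Lemma sum_triangle (F : nat -> nat -> R) (a N : nat) :
  \sum_(a <= n < N) \sum_(a <= l < n.+1) F l n =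
  \sum_(a <= l < N) \sum_(l <= n < N) F l n.
Proof.
elim: N => [|N IH]; first by rewrite !big_geq.
have [aN|Na] := leqP a N; last by rewrite !big_geq.
rewrite big_nat_recr//= IH [RHS]big_nat_recr//= big_nat1.
rewrite [X in _ + X]big_nat_recr//= addrA; congr (_ + _).
rewrite -big_split /=; apply: eq_big_nat => l /andP[al lN].
by rewrite [RHS]big_nat_recr ?(ltnW lN).
Qed.

Lemma sum_triangle_lt (F : nat -> nat -> R) (a N : nat) :
  \sum_(a <= n < N) \sum_(a <= l < n) F l n =
  \sum_(a <= l < N) \sum_(l.+1 <= n < N) F l n.
Proof.
have := sum_triangle F a N; have D : \sum_(a <= n < N) \sum_(a <= l < n.+1) F l n =
    \sum_(a <= n < N) \sum_(a <= l < n) F l n + \sum_(a <= n < N) F n n.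
  rewrite -big_split /=; apply: eq_big_nat => n /andP[an _].
  by rewrite big_nat_recr.
have E : \sum_(a <= l < N) \sum_(l <= n < N) F l n =
    \sum_(a <= l < N) \sum_(l.+1 <= n < N) F l n + \sum_(a <= n < N) F n n.
  rewrite -big_split /=; apply: eq_big_nat => n /andP[_ nN].
  by rewrite big_ltn// addrC.
by rewrite D E => /addIr.
Qed.

(** A sequence that cannot jump over the interval between eta/2 and eta stays
    below it. *)
Lemma bootstrap u (eta : R) (a N : nat) :
  (forall n, (a <= n)%N -> u n <= eta / 2) -> 0 <= eta ->
  (forall M, (M <= N)%N -> \sum_(a <= n < M) u n <= eta ->
     \sum_(a <= n < M) u n <= eta / 2) ->
  \sum_(a <= n < N) u n <= eta / 2.
Proof.
move=> un e0 H.
suff K M : (M <= N)%N -> \sum_(a <= n < M) u n <= eta / 2 by exact: K.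
elim: M => [_|M IH MN]; first by rewrite big_geq//; lra.
apply: H => //; have [aM|Ma] := leqP a M; last by rewrite big_geq.
by rewrite big_nat_recr//=; have := IH (ltnW MN); have := un M aM; lra.
Qed.

End summability.

(** * Limits of unimodular functions *)
Section unimodular_limit.
Context {R : realType}.
Implicit Types (f g h : R -> R[i]) (u x y : R) (z w : R[i]).

Local Notation cabs := Normc.normc.
Notation mu := (@lebesgue_measure R).

Lemma ae_periodic (P : R -> Prop) :
  (forall x (k : int), P (x + k%:~R) -> P x) ->
  {ae mu, forall x, x \in `[0, 1[ -> P x} -> {ae mu, forall x, P x}.
Proof.
move=> pP aP.
have a1 : {ae mu, forall x, forall n : nat, x + n%:R \in `[0, 1[ -> P (x + n%:R)}.
  by apply: ae_forall => n; exact: (ae_shift n%:R aP).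
have a2 : {ae mu, forall x, forall n : nat, x + - n%:R \in `[0, 1[ -> P (x - n%:R)}.
  by apply: ae_forall => n; exact: (ae_shift (- n%:R) aP).
apply: aeS (aeI a1 a2) => x [h1 h2].
have : x - (Num.floor x)%:~R \in `[0, 1[.
  by rewrite in_itv /=; have := floor_itv x; rewrite intrD; lra.
case: (Num.floor x) => n.
  by move=> /h2 h; apply: (pP _ (- n%:Z)); rewrite intrN; exact: h.
rewrite NegzE intrN opprK => /h1 h; apply: (pP _ n.+1); exact: h.
Qed.

Lemma EFin_cint (f : R -> R) : circ f ->
  (\int[mu]_(x in `[0%R, 1%R[) (f x)%:E)%E = (cint f)%:E.
Proof.
move=> cf; rewrite /cint /Rintegral fineK//.
by apply: integrable_fin_num => //; exact: circ_int01.
Qed.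

Lemma cint_eq0_ae (f : R -> R) : circ f -> (forall x, 0 <= f x) -> cint f = 0 ->
  {ae mu, forall x, f x = 0}.
Proof.
move=> cf f0 If; apply: ae_periodic => [x k|].
  by rewrite periodic_intr//; exact: circ_per.
have mf : measurable_fun (`[0, 1[%classic : set R) (EFin \o f).
  by apply/measurable_EFinP/measurable_funTS; exact: circ_meas.
have := (ae_eq_integral_abs mu (measurable_itv `[0, 1[) mf).1 _.
have If0 : (\int[mu]_(x in `[0%R, 1%R[) `|(EFin \o f) x| = 0)%E.
  under eq_integral do rewrite gee0_abs ?lee_fin//.
  by rewrite EFin_cint// If.
move=> /(_ If0) [N [mN N0 NP]]; exists N; split => // x /= h; apply: NP => /= e.
by apply: h => xI; have [] := e xI.
Qed.

Lemma udist0_ae f g : unim f -> unim g -> udist f g = 0 ->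
  {ae mu, forall x, f x = g x}.
Proof.
move=> uf ug /(cint_eq0_ae (circ_cabsB uf ug) (fun x => cabs_ge0 _)).
by apply: aeS => x /cabs_eq0/eqP; rewrite subr_eq0 => /eqP.
Qed.

Lemma cvg_of_summ_increments (r g : nat -> R) : (forall n, 0 <= g n) ->
  (forall n, `|r n.+1 - r n| <= g n) -> summ g -> cvgn r.
Proof.
move=> g0 rg sg; apply/cauchy_cvgP/cauchy_exP => e e0.
have [N hN] := summ_tail g0 sg (divr_gt0 e0 (@ltr0n R 2)).
have H n k : (N <= n)%N -> `|r n - r (n + k)%N| <= e / 2.
  move=> Nn; apply: le_trans (hN n (n + k)%N Nn).
  elim: k => [|k IH]; first by rewrite addn0 subrr normr0 big_geq.
  rewrite addnS big_nat_recr ?leq_addr//=.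
  apply: le_trans (lerD IH (rg _)); rewrite (distrC (r _.+1)).
  exact: ler_distD.
exists (r N); exists N => // n /= Nn; rewrite /ball /= -(subnKC Nn).
by apply: le_lt_trans (H _ _ (leqnn N)) _; lra.
Qed.

(** Almost everywhere, the increments are summable, hence the sequence converges;
    the upper limits of the real and imaginary parts give a measurable limit,
    which is replaced by 1 where its modulus is not 1. *)
Lemma unim_limit (H : nat -> R -> R[i]) : (forall n, unim (H n)) ->
  summ (fun n => udist (H n.+1) (H n)) ->
  exists2 G, unim G & tends0 (fun n => udist (H n) G).
Proof.
move=> uH [B hB].
pose g n x := cabs (H n.+1 x - H n x).
have cg n : circ (g n) by exact: circ_cabsB.
have g0 n x : 0 <= g n x by exact: cabs_ge0.
have aeg : {ae mu, forall x, x \in `[0, 1[ -> summ (g^~ x)}.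
  pose S x : \bar R := (\sum_(0 <= n <oo) (g n x)%:E)%E.
  have mg n : measurable_fun (`[0, 1[%classic : set R) (EFin \o g n).
    by apply/measurable_EFinP/measurable_funTS; exact: circ_meas.
  have S0 x : (0 <= S x)%E by apply: nneseries_ge0 => n _ _; rewrite lee_fin.
  have mS : measurable_fun (`[0, 1[%classic : set R) S.
    apply: (@ge0_emeasurable_sum _ _ _ _ (fun n => EFin \o g n) xpredT) => [k x _ _|k _]; last exact: mg.
    by rewrite lee_fin.
  have IS : mu.-integrable `[0, 1[ S.
    apply/integrableP; split => //.
    under eq_integral do rewrite gee0_abs//.
    rewrite /S integral_nneseries//; last by move=> n x _; rewrite lee_fin.
    apply: (@le_lt_trans _ _ B%:E); last exact: ltry.
    apply: lime_le.
      by apply: is_cvg_nneseries => n _ _; apply: integral_ge0 => x _; rewrite lee_fin.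
    apply: nearW => N.
    rewrite (eq_bigr (fun n => (udist (H n.+1) (H n))%:E)); last first.
      by move=> n _; rewrite EFin_cint.
    by rewrite sumEFin lee_fin.
  have : {ae mu, forall x, (`[0, 1[%classic : set R) x -> S x \is a fin_num}.
    exact: integrable_ae.
  move=> [N [mN N0 NP]].
  exists N; split => // x /= h; apply: NP => /= e; apply: h => xI.
  apply/(summP (g0^~ x)); have /fin_numPlt := e xI.
  by case/andP.
pose fr x := limn_sup (fun n => complex.Re (H n x)).
pose fi x := limn_sup (fun n => complex.Im (H n x)).
have bnd n x := unim_ReIm_le1 x (uH n).
have mfr : measurable_fun [set: R] fr.
  apply: measurable_fun_limn_sup => [x _|x _|n]; last by case: (uH n).
    by exists 1 => _ [n _ <-]; have [/ler_normlP[]] := bnd n x.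
  by exists (-1) => _ [n _ <-]; have [/ler_normlP[]] := bnd n x; lra.
have mfi : measurable_fun [set: R] fi.
  apply: measurable_fun_limn_sup => [x _|x _|n]; last by case: (uH n).
    by exists 1 => _ [n _ <-]; have [_ /ler_normlP[]] := bnd n x.
  by exists (-1) => _ [n _ <-]; have [_ /ler_normlP[]] := bnd n x; lra.
pose ok x := fr x ^+ 2 + fi x ^+ 2 == 1.
have mok : measurable_fun [set: R] ok.
  apply: measurable_fun_eqr => //.
  by apply: measurable_funD; exact: measurable_funX.
pose G x : R[i] := if ok x then Complex (fr x) (fi x) else 1.
have uG : unim G.
  split.
  - rewrite (_ : (fun x => _) = (fun x => if ok x then fr x else 1)).
      exact: measurable_fun_ifT.
    by apply/funext => x; rewrite /G; case: ifP.
  - rewrite (_ : (fun x => _) = (fun x => if ok x then fi x else 0)).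
      exact: measurable_fun_ifT.
    by apply/funext => x; rewrite /G; case: ifP.
  - move=> x; have hx n : H n (x + 1) = H n x by case: (uH n).
    have frx : fr (x + 1) = fr x by congr limn_sup; apply/funext => n; rewrite hx.
    have fix' : fi (x + 1) = fi x by congr limn_sup; apply/funext => n; rewrite hx.
    by rewrite /G /ok frx fix'.
  - move=> x; rewrite /G; case: ifP => [/eqP h|_]; last exact: cabs1.
    by rewrite /= h sqrtr1.
exists G => //.
have aeG : {ae mu, forall x, x \in `[0, 1[ -> tends0 (fun n => cabs (H n x - G x))}.
  apply: aeS aeg => x h /h{h} sg.
  have cr : cvgn (fun n => complex.Re (H n x)).
    apply: (@cvg_of_summ_increments _ (g^~ x)) => // n.
    apply: le_trans (_ : _ <= Num.sqrt ((complex.Re (H n.+1 x - H n x)) ^+ 2)) _.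
      by rewrite sqrtr_sqr; case: (H n.+1 x) (H n x) => ? ? [].
    by rewrite /g cabsE ler_wsqrtr// lerDl sqr_ge0.
  have ci : cvgn (fun n => complex.Im (H n x)).
    apply: (@cvg_of_summ_increments _ (g^~ x)) => // n.
    apply: le_trans (_ : _ <= Num.sqrt ((complex.Im (H n.+1 x - H n x)) ^+ 2)) _.
      by rewrite sqrtr_sqr; case: (H n.+1 x) (H n x) => ? ? [].
    by rewrite /g cabsE ler_wsqrtr// lerDr sqr_ge0.
  have cfr : (fun n => complex.Re (H n x)) @ \oo --> fr x.
    by have /cvg_lim E := cvg_sups cr; rewrite /fr /limn_sup E.
  have cfi : (fun n => complex.Im (H n x)) @ \oo --> fi x.
    by have /cvg_lim E := cvg_sups ci; rewrite /fi /limn_sup E.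
  have okx : ok x.
    apply/eqP; have c2 : (fun n => complex.Re (H n x) ^+ 2 + complex.Im (H n x) ^+ 2)
        @ \oo --> fr x ^+ 2 + fi x ^+ 2.
      by apply: cvgD; rewrite !expr2; exact: cvgM.
    have c1 : (fun n => complex.Re (H n x) ^+ 2 + complex.Im (H n x) ^+ 2) = fun=> 1.
      by apply/funext => n; rewrite -cabs_sqr (unim_cabs x (uH n)) expr1n.
    rewrite c1 in c2; rewrite -(cvg_lim (@Rhausdorff R) c2).
    exact: (cvg_lim (@Rhausdorff R) (cvg_cst _)).
  have -> : G x = Complex (fr x) (fi x) by rewrite /G okx.
  apply: (@tends0_le _ _ (fun n =>
      `|complex.Re (H n x) - fr x| + `|complex.Im (H n x) - fi x|)) => [n|].
    rewrite ger0_norm ?cabs_ge0//; apply: (le_trans (cabs_le_ReIm _)).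
    by case: (H n x) => a b /=.
  have z (r : nat -> R) l : r n @[n --> \oo] --> l -> tends0 (fun n => `|r n - l|).
    move=> /cvgrPdist_le rl eps e0; have [N _ hN] := rl _ e0.
    by exists N => n Nn; rewrite normr_id distrC; exact: hN.
  by apply: tends0D; exact: z.
pose F n x := (cabs (H n x - G x))%:E.
have cF n : circ (fun x => cabs (H n x - G x)) by exact: circ_cabsB.
have [] := @dominated_convergence _ _ R mu `[0, 1[ (measurable_itv _) F (cst 0%E) (cst 2%:E).
- by move=> n; apply/measurable_EFinP/measurable_funTS; exact: circ_meas.
- by [].
- have [N [mN N0 NP]] := aeG; exists N; split => // x /= h; apply: NP => /= e.
  apply: h => xI; apply: cvg_EFin; first exact: nearW.
  by apply/tends0P; exact: e.
- by have := circ_int01 (@circ_cst R 2).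
- exists set0; split => //; rewrite ?measure0// => x /= h; exfalso; apply: h => n xI.
  rewrite /F /= lee_fin ger0_norm ?cabs_ge0//.
  by apply: cabs_sub_le2; exact: unim_cabs.
move=> _ _; rewrite integral0 => /fine_cvgP[_] c0.
apply/tends0P; apply: cvg_trans c0; apply: near_eq_cvg; apply: nearW => n.
by [].
Qed.

(** A subsequence with summable increments converges, and the whole sequence
    follows because it is Cauchy. *)
Lemma unim_complete (F : nat -> R -> R[i]) : (forall n, unim (F n)) ->
  (forall eps : R, 0 < eps -> exists N, forall m n, (N <= m <= n)%N ->
     udist (F m) (F n) <= eps) ->
  exists2 G, unim G & tends0 (fun n => udist (F n) G).
Proof.
move=> uF cauchy.
have pow0 k : 0 < (2 ^-1) ^+ k :> R by rewrite exprn_gt0// invr_gt0.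
pose t k := projT1 (cid (cauchy _ (pow0 k))).
have tP k m n : (t k <= m <= n)%N -> udist (F m) (F n) <= (2^-1) ^+ k.
  by move: m n; exact: (projT2 (cid (cauchy _ (pow0 k)))).
pose sg k := (k + \sum_(0 <= i < k.+1) t i)%N.
have tsg k : (t k <= sg k)%N by rewrite /sg big_nat_recr//= addnA leq_addl.
have sgS k : (sg k <= sg k.+1)%N.
  by rewrite /sg [X in (_ <= _ + X)%N]big_nat_recr//= leq_add// leq_addr.
have sgd k : udist (F (sg k.+1)) (F (sg k)) <= (2^-1) ^+ k.
  by rewrite udistC; apply: tP; rewrite tsg sgS.
have [G uG HG] : exists2 G, unim G & tends0 (fun n => udist (F (sg n)) G).
  apply: (@unim_limit (fun k => F (sg k))) => //; exists 2 => N.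
  apply: (le_trans (ler_sum _ (fun k _ => sgd k))).
  suff -> : \sum_(0 <= i < N) (2^-1) ^+ i = 2 - 2 * (2^-1) ^+ N :> R.
    by have := pow0 N; lra.
  elim: N => [|N IH]; first by rewrite big_geq// expr0; ring.
  by rewrite big_nat_recr//= IH exprS; field.
exists G => // eps e0; have e2 : 0 < eps / 2 by lra.
have [K hK] := HG _ e2; have [N hN] := cauchy _ e2.
exists N => n Nn; rewrite ger0_norm ?udist_ge0//.
pose k := maxn K N.
have sk : (N <= sg k)%N by rewrite (leq_trans (leq_maxr K N))// leq_addr.
have h1 : udist (F n) (F (sg k)) <= eps / 2.
  have [nk|/ltnW kn] := leqP n (sg k); first by apply: hN; rewrite Nn.
  by rewrite udistC; apply: hN; rewrite sk.
have := hK k (leq_maxl K N); rewrite ger0_norm ?udist_ge0// => h2.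
by apply: (le_trans (udist_triangle (uF n) (uF (sg k)) uG)); lra.
Qed.

End unimodular_limit.

(** * Step functions with given jumps *)
Section one_sided_constants.
Context {R : realType}.
Implicit Types (x y : R).

(** One-sided limits are stated in this stronger form because it is stable under
    all the operations that occur and determines the jump. *)
Definition rconst (T : Type) (f : R -> T) x (c : T) :=
  exists2 eps : R, 0 < eps & forall y, x < y < x + eps -> f y = c.
Definition lconst (T : Type) (f : R -> T) x (c : T) :=
  exists2 eps : R, 0 < eps & forall y, x - eps < y < x -> f y = c.

Lemma rconst_lim (f : R -> R) x c : rconst f x c -> lim (f y @[y --> x^'+]) = c.
Proof.
move=> [eps e0 h]; apply/cvg_lim => //; apply: cvg_near_cst.
near=> y; apply: h; apply/andP; split; near: y; first exact: nbhs_right_gt.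
by apply: nbhs_right_lt; lra.
Unshelve. all: by end_near.
Qed.

Lemma lconst_lim (f : R -> R) x c : lconst f x c -> lim (f y @[y --> x^'-]) = c.
Proof.
move=> [eps e0 h]; apply/cvg_lim => //; apply: cvg_near_cst.
near=> y; apply: h; apply/andP; split; near: y; last exact: nbhs_left_lt.
by apply: nbhs_left_gt; lra.
Unshelve. all: by end_near.
Qed.

Lemma continuous_rconst (f : R -> R) x c : {for x, continuous f} -> rconst f x c -> f x = c.
Proof.
move=> cf rc; rewrite -(rconst_lim rc); apply/esym/cvg_lim => //.
exact: cvg_at_right_filter cf.
Qed.

Lemma continuous_lconst (f : R -> R) x c : {for x, continuous f} -> lconst f x c -> f x = c.
Proof.
move=> cf rc; rewrite -(lconst_lim rc); apply/esym/cvg_lim => //.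
exact: cvg_at_left_filter cf.
Qed.

Lemma rconst2 (T U V : Type) (h : T -> U -> V) (f : R -> T) (g : R -> U) x c d :
  rconst f x c -> rconst g x d -> rconst (fun y => h (f y) (g y)) x (h c d).
Proof.
move=> [e e0 he] [k k0 hk]; exists (Num.min e k); first by rewrite lt_min e0.
move=> y /andP[xy yx]; have : y - x < Num.min e k by lra.
by rewrite lt_min => /andP[? ?]; rewrite he ?hk//; lra.
Qed.

Lemma lconst2 (T U V : Type) (h : T -> U -> V) (f : R -> T) (g : R -> U) x c d :
  lconst f x c -> lconst g x d -> lconst (fun y => h (f y) (g y)) x (h c d).
Proof.
move=> [e e0 he] [k k0 hk]; exists (Num.min e k); first by rewrite lt_min e0.
move=> y /andP[xy yx]; have : x - y < Num.min e k by lra.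
by rewrite lt_min => /andP[? ?]; rewrite he ?hk//; lra.
Qed.

Lemma rconst_cst (T : Type) (c : T) x : rconst (fun=> c) x c.
Proof. by exists 1. Qed.

Lemma lconst_cst (T : Type) (c : T) x : lconst (fun=> c) x c.
Proof. by exists 1. Qed.

Lemma rconst_sum (I : Type) (s : seq I) (F : I -> R -> R) (c : I -> R) x :
  (forall i, rconst (F i) x (c i)) ->
  rconst (fun y => \sum_(i <- s) F i y) x (\sum_(i <- s) c i).
Proof.
move=> H; elim: s => [|i s IH].
  by rewrite big_nil; under eq_fun do rewrite big_nil; exact: rconst_cst.
by rewrite big_cons; under eq_fun do rewrite big_cons; exact: (rconst2 +%R).
Qed.

Lemma lconst_sum (I : Type) (s : seq I) (F : I -> R -> R) (c : I -> R) x :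
  (forall i, lconst (F i) x (c i)) ->
  lconst (fun y => \sum_(i <- s) F i y) x (\sum_(i <- s) c i).
Proof.
move=> H; elim: s => [|i s IH].
  by rewrite big_nil; under eq_fun do rewrite big_nil; exact: lconst_cst.
by rewrite big_cons; under eq_fun do rewrite big_cons; exact: (lconst2 +%R).
Qed.

Lemma rconst_shift (T : Type) (f : R -> T) x u c :
  rconst f (x + u) c -> rconst (fun y => f (y + u)) x c.
Proof. by move=> [e e0 h]; exists e => // y yx; apply: h; lra. Qed.

Lemma lconst_shift (T : Type) (f : R -> T) x u c :
  lconst f (x + u) c -> lconst (fun y => f (y + u)) x c.
Proof. by move=> [e e0 h]; exists e => // y yx; apply: h; lra. Qed.

Lemma rconst_lt x c : rconst (fun y => y < c) x (x < c).
Proof.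
have [xc|cx] := ltP x c; [exists (c - x); first lra|exists 1 => //] => y yx.
  by lra.
by apply/negbTE; rewrite -leNgt; lra.
Qed.

Lemma lconst_lt x c : lconst (fun y => y < c) x (x <= c).
Proof.
have [xc|cx] := leP x c; [exists 1 => //|exists (x - c); first lra] => y yx.
  by lra.
by apply/negbTE; rewrite -leNgt; lra.
Qed.

Lemma rconst_le x c : rconst (fun y => y <= c) x (x < c).
Proof.
have [xc|cx] := ltP x c; [exists (c - x); first lra|exists 1 => //] => y yx.
  by lra.
by apply/negbTE; rewrite -ltNge; lra.
Qed.

Lemma lconst_le x c : lconst (fun y => y <= c) x (x <= c).
Proof.
have [xc|cx] := leP x c; [exists 1 => //|exists (x - c); first lra] => y yx.
  by lra.
by apply/negbTE; rewrite -ltNge; lra.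
Qed.

Lemma const_bound_le (b : itv_bound R) x :
  (exists c, rconst (fun y => b <= BLeft y)%O x c) /\
  (exists c, lconst (fun y => b <= BLeft y)%O x c).
Proof.
case: b => [[] c|[]].
- split; eexists.
    under eq_fun do rewrite bnd_simp leNgt; exact: (rconst2 (fun b _ => ~~ b) (rconst_lt x c) (rconst_lt x c)).
  under eq_fun do rewrite bnd_simp leNgt; exact: (lconst2 (fun b _ => ~~ b) (lconst_lt x c) (lconst_lt x c)).
- split; eexists.
    under eq_fun do rewrite bnd_simp ltNge; exact: (rconst2 (fun b _ => ~~ b) (rconst_le x c) (rconst_le x c)).
  under eq_fun do rewrite bnd_simp ltNge; exact: (lconst2 (fun b _ => ~~ b) (lconst_le x c) (lconst_le x c)).
- by split; exists true; exists 1.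
- by split; exists false; exists 1.
Qed.

Lemma const_bound_ge (b : itv_bound R) x :
  (exists c, rconst (fun y => BRight y <= b)%O x c) /\
  (exists c, lconst (fun y => BRight y <= b)%O x c).
Proof.
case: b => [[] c|[]].
- split; eexists.
    by under eq_fun do rewrite bnd_simp; exact: rconst_lt.
  by under eq_fun do rewrite bnd_simp; exact: lconst_lt.
- split; eexists.
    by under eq_fun do rewrite bnd_simp; exact: rconst_le.
  by under eq_fun do rewrite bnd_simp; exact: lconst_le.
- by split; exists false; exists 1.
- by split; exists true; exists 1.
Qed.

Lemma const_indic (I : interval R) x :
  (exists c, rconst (\1_[set` I] : R -> R) x c) /\
  (exists c, lconst (\1_[set` I] : R -> R) x c).
Proof.
case: I => a b; have [[c1 h1] [c2 h2]] := const_bound_le a x.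
have [[d1 k1] [d2 k2]] := const_bound_ge b x.
have -> : (\1_[set` Interval a b] : R -> R) =
    fun y => ((a <= BLeft y)%O && (BRight y <= b)%O)%:R.
  by apply/funext => y; rewrite indicE mem_setE itv_boundlr.
split; eexists.
  exact: (rconst2 (fun u v : bool => (u && v)%:R) h1 k1).
exact: (lconst2 (fun u v : bool => (u && v)%:R) h2 k2).
Qed.

Lemma step_function_const (phi : R -> R) x : step_function phi ->
  (exists c, rconst phi x c) /\ (exists c, lconst phi x c).
Proof.
move=> [per [n [c [I phiE]]]].
pose g y := \sum_(i < n) c i * \1_[set` I i] y.
have [G1 G2] : (forall z, exists d, rconst g z d) /\ (forall z, exists d, lconst g z d).
  split=> z.
    exists (\sum_(i < n) c i * projT1 (cid (const_indic (I i) z).1)).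
    apply: rconst_sum => i; case: cid => d hd /=.
    exact: (rconst2 *%R (rconst_cst (c i) z) hd).
  exists (\sum_(i < n) c i * projT1 (cid (const_indic (I i) z).2)).
  apply: lconst_sum => i; case: cid => d hd /=.
  exact: (lconst2 *%R (lconst_cst (c i) z) hd).
have shift (k : int) y : 0 <= y - k%:~R < 1 -> phi y = g (y + (- k)%:~R).
  by move=> yk; rewrite -(periodic_intr per y (- k)) phiE// intrN.
split.
  pose k := Num.floor x; have [d hd] := G1 (x + (- k)%:~R).
  have [e e0 he] := rconst_shift hd.
  have kx := floor_itv x; rewrite intrD -/k in kx.
  exists d; exists (Num.min e (k%:~R + 1 - x)); first by rewrite lt_min e0; lra.
  move=> y /andP[xy yx]; have : y - x < Num.min e (k%:~R + 1 - x) by lra.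
  rewrite lt_min => /andP[? ?]; rewrite (shift k) ?he//; lra.
pose k := Num.ceil x - 1; have [d hd] := G2 (x + (- k)%:~R).
have [e e0 he] := lconst_shift hd.
have kx := ceil_itv x; rewrite -/k in kx.
have kx2 : (Num.ceil x)%:~R = k%:~R + 1 :> R by rewrite /k intrB subrK.
exists d; exists (Num.min e (x - k%:~R)); first by rewrite lt_min e0; lra.
move=> y /andP[xy yx]; have : x - y < Num.min e (x - k%:~R) by lra.
rewrite lt_min => /andP[? ?]; rewrite (shift k) ?he//; lra.
Qed.

Lemma rconst_floor x c : rconst (fun y => (Num.floor (y - c))%:~R : R) x (Num.floor (x - c))%:~R.
Proof.
have := floor_itv (x - c); set k := Num.floor (x - c) => kx; rewrite intrD in kx.
exists (k%:~R + 1 - (x - c)); first lra.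
by move=> y yx; congr (_%:~R); apply: floor_def; rewrite intrD; lra.
Qed.

Lemma lconst_floor x c : lconst (fun y => (Num.floor (y - c))%:~R : R) x
  ((Num.floor (x - c))%:~R - (x - c \is a Num.int)%:R).
Proof.
have := ceil_itv (x - c); rewrite ceil_floor => kx.
have E : (Num.floor (x - c))%:~R - (x - c \is a Num.int)%:R =
    (Num.floor (x - c) + (x - c \isn't a Num.int) - 1)%:~R :> R.
  by rewrite intrB intrD; case: (_ \is a _) => /=; rewrite ?intr0; ring.
rewrite E; set k := Num.floor _ + _ - 1 in kx *.
have kE : (Num.floor (x - c) + (x - c \isn't a Num.int))%:~R = k%:~R + 1 :> R.
  by rewrite /k intrB subrK.
exists (x - c - k%:~R); first lra.
by move=> y yx; congr (_%:~R); apply: floor_def; rewrite intrD; lra.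
Qed.

(** The derivative is zero everywhere. *)
Lemma locally_constant (gh : R -> R) :
  (forall x, exists2 eps : R, 0 < eps & forall y, `|y - x| < eps -> gh y = gh x) ->
  forall x y, gh x = gh y.
Proof.
move=> lc.
have d0 (z : R) : is_derive z 1 gh 0.
  have [e e0 he] := lc z; apply: (@near_eq_is_derive _ _ _ (fun=> gh z)).
    by exists e => //= y; rewrite /ball /= distrC => /he.

have H x y : x <= y -> gh x = gh y.
  move=> xy; have [//|c _] := @MVT_segment R gh (fun=> 0) x y xy.
    apply: continuous_subspaceT => u; apply: differentiable_continuous.
    by apply/derivable1_diffP; have [] := d0 u.
  by rewrite mul0r => /eqP; rewrite subr_eq0 => /eqP.
by move=> x y; have [/H//|/ltW/H] := leP x y.
Qed.

End one_sided_constants.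

Section step_function_jumps.
Context {R : realType} (m : nat) (beta s : 'I_m.+1 -> R) (phi : R -> R).
Notation mu := (@lebesgue_measure R).
Hypothesis phi_step : step_function phi.
Hypothesis phi_int0 : (\int[mu]_(x in `[0%R, 1%R]) (phi x)%:E = 0)%E.
Hypothesis beta_distinct : forall i j, eqmod1 (beta i) (beta j) -> i = j.
Hypothesis beta_disc : forall x : R,
  ~ {for x, continuous phi} <-> exists j, eqmod1 x (beta j).
Hypothesis phi_jump : forall j, jump phi (beta j) = - s j.

(* Adding the integer parts removes the jumps, since the floor of x - beta_j jumps
   by 1 at beta_j; the values at the discontinuities are then corrected in gh. *)
Let g x := phi x + \sum_(j < m.+1) s j * (Num.floor (x - beta j))%:~R.

Let g_local x : exists c, [/\ rconst g x c, lconst g x c &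
  (forall j, ~ eqmod1 x (beta j)) -> g x = c].
Proof.
have [[cr hr] [cl hl]] := step_function_const x phi_step.
have fr : rconst (fun y => \sum_(j < m.+1) s j * (Num.floor (y - beta j))%:~R) x
    (\sum_(j < m.+1) s j * (Num.floor (x - beta j))%:~R).
  apply: rconst_sum => j; apply: (rconst2 *%R (rconst_cst (s j) x)).
  exact: rconst_floor.
have fl : lconst (fun y => \sum_(j < m.+1) s j * (Num.floor (y - beta j))%:~R) x
    (\sum_(j < m.+1) s j * ((Num.floor (x - beta j))%:~R - (x - beta j \is a Num.int)%:R)).
  apply: lconst_sum => j; apply: (lconst2 *%R (lconst_cst (s j) x)).
  exact: lconst_floor.
have gr := rconst2 +%R hr fr; have gl := lconst2 +%R hl fl.
have jumpE : cr - cl = - \sum_(j < m.+1) s j * (x - beta j \is a Num.int)%:R.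
  have [[j xj]|nj] := pselect (exists j, eqmod1 x (beta j)); last first.
    have cx : {for x, continuous phi} by apply: contrapT => /beta_disc.
    rewrite -(continuous_rconst cx hr) -(continuous_lconst cx hl) subrr.
    rewrite big1 ?oppr0// => j _; rewrite (_ : _ \is a _ = false) ?mulr0//.
    by apply/negP => xj; apply: nj; exists j.
  rewrite (bigD1 j)//= xj mulr1 big1 ?addr0; last first.
    move=> i ij; rewrite (_ : _ \is a _ = false) ?mulr0//; apply/negP => xi.
    case/eqP: ij; apply: beta_distinct; rewrite /eqmod1.
    have -> : beta i - beta j = (x - beta j) - (x - beta i) by ring.
    exact: rpredB.
  rewrite -phi_jump /jump; have /intrP[k xk] := xj.
  have xE : x = beta j + k%:~R by rewrite -xk addrC subrK.
  have per := phi_step.1.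
  have phik : phi = fun y => phi (y + k%:~R) by apply/funext => y; rewrite periodic_intr.
  have hr' : rconst phi (beta j) cr by rewrite phik; apply: rconst_shift; rewrite -xE.
  have hl' : lconst phi (beta j) cl by rewrite phik; apply: lconst_shift; rewrite -xE.
  by rewrite (rconst_lim hr') (lconst_lim hl').
exists (cr + \sum_(j < m.+1) s j * (Num.floor (x - beta j))%:~R); split => //.
- rewrite (_ : cr + _ = cl + \sum_(j < m.+1)
    s j * ((Num.floor (x - beta j))%:~R - (x - beta j \is a Num.int)%:R)) //.
  under [in RHS]eq_bigr do rewrite mulrBr.
  by rewrite sumrB addrA -addrA -jumpE; ring.
- move=> nj; have cx : {for x, continuous phi}.
    by apply: contrapT => /beta_disc [j]; exact: nj.
  by rewrite /g (continuous_rconst cx hr).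
Qed.

Let gh x := projT1 (cid (g_local x)).

Let gh_const x y : gh x = gh y.
Proof.
apply: locally_constant => {}x; rewrite /gh; case: cid => c [[e e0 he] [k k0 hk] _] /=.
exists (Num.min e k); first by rewrite lt_min e0.
move=> z; rewrite lt_min !ltr_norml => /andP[/andP[h1 h2] /andP[h3 h4]].
case: cid => d /= [[e' e'0 he'] [k' k'0 hk'] _].
have [zx|xz|zx] := ltgtP z x.
- have w1 : 0 < Num.min e' (x - z) by rewrite lt_min e'0; lra.
  have w2 : Num.min e' (x - z) <= e' by rewrite ge_min lexx.
  have w3 : Num.min e' (x - z) <= x - z by rewrite ge_min lexx orbT.
  by rewrite -(he' (z + Num.min e' (x - z) / 2)) ?hk//; lra.
- have w1 : 0 < Num.min e' (x + e - z) by rewrite lt_min e'0; lra.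
  have w2 : Num.min e' (x + e - z) <= e' by rewrite ge_min lexx.
  have w3 : Num.min e' (x + e - z) <= x + e - z by rewrite ge_min lexx orbT.
  by rewrite -(he' (z + Num.min e' (x + e - z) / 2)) ?he//; lra.
- have w1 : 0 < Num.min e' e by rewrite lt_min e'0; lra.
  have w2 : Num.min e' e <= e' by rewrite ge_min lexx.
  have w3 : Num.min e' e <= e by rewrite ge_min lexx orbT.
  by rewrite -(he' (z + Num.min e' e / 2)) ?he//; lra.
Qed.

(** The corrected function without jumps is constant, and adding 1 to x changes it
    by the sum of the jumps. *)
Lemma sum_jumps_eq0 : \sum_(j < m.+1) s j = 0.
Proof.
have := gh_const 0 (0 + 1); rewrite /gh.
case: cid => c [[e e0 he] _ _] /=; case: cid => d [[k k0 hk] _ _] /= cd.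
have w1 : 0 < Num.min e k by rewrite lt_min e0.
have w2 : Num.min e k <= e by rewrite ge_min lexx.
have w3 : Num.min e k <= k by rewrite ge_min lexx orbT.
have h1 := he (Num.min e k / 2) ltac:(lra).
have h2 := hk (Num.min e k / 2 + 1) ltac:(lra).
have : g (Num.min e k / 2 + 1) = g (Num.min e k / 2) + \sum_(j < m.+1) s j.
  rewrite /g phi_step.1 -addrA -big_split /=; congr (_ + _); apply: eq_bigr => j _.
  rewrite (_ : _ + 1 - beta j = Num.min e k / 2 - beta j + 1); last ring.
  by rewrite floorDrz ?int_num1// floor1 intrD; ring.
by rewrite h1 h2 cd => /eqP; rewrite -subr_eq0 opprD addrA subrr sub0r oppr_eq0 => /eqP.
Qed.

Lemma ae_not_beta : {ae mu, forall x, forall j, ~ eqmod1 x (beta j)}.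
Proof.
have pt (c : R) : {ae mu, forall x, x <> c}.
  by exists [set c]; split => //; [exact: lebesgue_measure_set1|move=> x /= /contrapT].
have H (n k : nat) : {ae mu, forall x, x <> beta (inord n) + k%:R /\ x <> beta (inord n) - k%:R}.
  exact: aeI.
have := ae_forall (fun n => ae_forall (H n)).
apply: aeS => x h j /intrP[[k|k] xk].
  have [h1 _] := h j k; apply: h1; rewrite inord_val.
  by rewrite pmulrn -xk addrC subrK.
have [_ h1] := h j k.+1; apply: h1; rewrite inord_val.
by rewrite pmulrn -intrN -NegzE -xk addrC subrK.
Qed.

Let phi_off x : (forall j, ~ eqmod1 x (beta j)) ->
  phi x = (gh 0 + \sum_(j < m.+1) s j * (beta j + 2^-1)) + \sum_(j < m.+1) s j * psi (x - beta j).
Proof.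
move=> nj; rewrite (gh_const 0 x) /gh; case: cid => c [_ _ /(_ nj)] /= <-.
have : x * \sum_(j < m.+1) s j = 0 by rewrite sum_jumps_eq0 mulr0.
rewrite mulr_sumr => sx; rewrite /g -[LHS]addr0 -[X in _ + X = _]sx -!addrA; congr (_ + _).
rewrite -!big_split /=; apply: eq_bigr => j _.
by rewrite /psi /frac; ring.
Qed.

(** The difference with the combination of sawtooth functions that has the same
    jumps is constant, and both have mean 0. *)
Lemma step_function_sawtooth :
  {ae mu, forall x, phi x = \sum_(j < m.+1) s j * psi (x - beta j)}.
Proof.
set C := gh 0 + \sum_(j < m.+1) s j * (beta j + 2^-1).
pose phi0 x := \sum_(j < m.+1) s j * psi (x - beta j).
have aeC : {ae mu, forall x, phi x = C + phi0 x} by apply: aeS ae_not_beta => x; exact: phi_off.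
have c0 j : circ (fun x => psi (x - beta j)) by exact: circ_shift circ_psi.
have cphi0 : circ phi0 by apply: circ_sum => j _; exact: circZ.
suff C0 : C = 0 by apply: aeS aeC => x ->; rewrite C0 add0r.
have mphi : measurable_fun (`[0, 1[%classic : set R) phi.
  case: phi_step => _ [n [c [I phiE]]].
  apply: (eq_measurable_fun (fun x => \sum_(i < n) c i * \1_[set` I i] x)).
    by move=> x; rewrite inE /= in_itv /= => /phiE.
  apply: measurable_sum => i; apply: measurable_funM => //.
have cC : circ (fun x => C + phi0 x) by apply: circD => //; exact: circ_cst.
have I0 : cint phi0 = 0.
  rewrite cint_sum; last by move=> j _; exact: circZ.
  rewrite big1// => j _; rewrite cintZ//; have := @cint_psi R 1 (- beta j) isT.
  by under eq_fun do rewrite mul1r; move=> ->; rewrite mulr0.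
have : (\int[mu]_(x in `[0%R, 1%R[) (phi x)%:E)%E = (\int[mu]_(x in `[0%R, 1%R[) (C + phi0 x)%:E)%E.
  apply: ae_eq_integral => //.
  - exact/measurable_EFinP.
  - by apply/measurable_EFinP/measurable_funTS; exact: (circ_meas cC).
  - by case: aeC => N [mN N0 NP]; exists N; split => // x /= h; apply: NP => /= e;
      apply: h => _; rewrite e.
rewrite integral_itv_bndo_bndc; last exact/measurable_EFinP.
rewrite phi_int0 EFin_cint//.
rewrite cintD//; last exact: circ_cst.
by rewrite cint_cst I0 addr0 => -[].
Qed.

End step_function_jumps.

(** * Convergence of the transfer functions *)
Section lacunary.
Context {R : realType} (alpha : R).
Hypothesis alpha_itv : 0 < alpha < 1.
Hypothesis alpha_irr : irrational alpha.
Implicit Types (f g : R -> R) (x y : R).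

Local Notation q := (cf_denominator alpha).
Local Notation a := (partial_quotient alpha).
Local Notation delta := (cf_delta alpha).
Local Notation e := e2ipi.
Local Notation cabs := Normc.normc.
Let q0 n : (0 < q n)%N := cf_denominator_gt0 alpha_itv alpha_irr n.
Let qR n : 0 < (q n)%:R :> R := cf_denominatorR_gt0 alpha_itv alpha_irr n.

Lemma L1lipZ (V c : R) f : circ f -> L1lip V f -> L1lip (`|c| * V) (fun x => c * f x).
Proof.
move=> cf Vf u; have cd : circ (fun x => f (x + u) - f x).
  by apply: circB => //; exact: circ_shift.
rewrite (_ : (fun x => _) = fun x => `|c| * `|f (x + u) - f x|); last first.
  by apply/funext => x; rewrite -mulrBr normrM.
by rewrite cintZ ?ler_wpM2l -?mulrA ?ler_wpM2l//; exact: circ_norm.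
Qed.

Lemma L1lipD (V W : R) f g : circ f -> circ g -> L1lip V f -> L1lip W g ->
  L1lip (V + W) (fun x => f x + g x).
Proof.
move=> cf cg Vf Wg u; rewrite mulrDl; apply: le_trans (lerD (Vf u) (Wg u)).
have cF (h : R -> R) : circ h -> circ (fun x => h (x + u) - h x).
  by move=> ch; apply: circB => //; exact: circ_shift.
have cf' := circ_norm (cF _ cf); have cg' := circ_norm (cF _ cg).
rewrite -cintD//; apply: le_cint; last first.
- by move=> x; rewrite opprD addrACA ler_normD.
- exact: circD.
- by apply/circ_norm/(cF (fun x => f x + g x)); exact: circD.
Qed.

(** Schur test: the kernel q_(l+1)/q_n has bounded row and column sums for l < n,
    because the denominators grow geometrically. *)
Lemma lacunary_schur (x : nat -> R) (A B : nat) : (forall n, 0 <= x n) ->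
  \sum_(A <= n < B) \sum_(A <= l < n) x n * x l * ((q l.+1)%:R / (q n)%:R) <=
  4 * \sum_(A <= n < B) x n ^+ 2.
Proof.
move=> x0; pose r l n : R := (q l.+1)%:R / (q n)%:R.
have r0 l n : 0 <= r l n by rewrite divr_ge0.
apply: (@le_trans _ _ (\sum_(A <= n < B) \sum_(A <= l < n) x n ^+ 2 / 2 * r l n +
    \sum_(A <= n < B) \sum_(A <= l < n) x l ^+ 2 / 2 * r l n)).
  rewrite -big_split /=; apply: ler_sum => n _; rewrite -big_split /=.
  apply: ler_sum => l _; rewrite -mulrDl; apply: ler_wpM2r; first exact: r0.
  by have := sqr_ge0 (x n - x l); nra.
have row n : \sum_(A <= l < n) r l n <= 4.
  rewrite /r -mulr_suml ler_pdivrMr//; case: n => [|n].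
    by rewrite big_geq// mulr_ge0.
  have -> : \sum_(A <= l < n.+1) (q l.+1)%:R = \sum_(A.+1 <= l < n.+2) (q l)%:R :> R.
    by rewrite big_add1.
  apply: (@le_trans _ _ (\sum_(0 <= l < n.+2) (q l)%:R)).
    exact: le_sum_nat_nonneg.
  rewrite -natr_sum -natrM ler_nat.
  by apply: (leq_trans (sum_cf_denominator alpha_itv alpha_irr n.+1)); rewrite leq_mul2r orbT.
have col l : \sum_(l.+1 <= n < B) r l n <= 4.
  rewrite /r -mulr_sumr mulrC -ler_pdivlMr//.
  exact: sum_cf_denominatorV.
have rowS : \sum_(A <= n < B) \sum_(A <= l < n) x n ^+ 2 / 2 * r l n <=
    2 * \sum_(A <= n < B) x n ^+ 2.
  rewrite mulr_sumr; apply: ler_sum => n _; rewrite -mulr_sumr.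
  by have := row n; have := sqr_ge0 (x n); nra.
have colS : \sum_(A <= n < B) \sum_(A <= l < n) x l ^+ 2 / 2 * r l n <=
    2 * \sum_(A <= n < B) x n ^+ 2.
  rewrite (sum_triangle_lt (fun l n => x l ^+ 2 / 2 * r l n)).
  rewrite mulr_sumr; apply: ler_sum => n _; rewrite -mulr_sumr.
  by have := col n; have := sqr_ge0 (x n); nra.
lra.
Qed.

(** The cross terms are bounded by the decorrelation of oscillations at different
    scales, and summed by the Schur test. *)
Lemma lacunary_L2 (c eps : nat -> R) (A B : nat) :
  cint (fun x => (\sum_(A <= n < B) eps n * psi ((q n)%:R * x + c n)) ^+ 2) <=
  17 * \sum_(A <= n < B) eps n ^+ 2.
Proof.
pose Y B x := \sum_(A <= n < B) eps n * psi ((q n)%:R * x + c n).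
have cP n := circ_psi_affine (q n) (c n).
have cY C : circ (Y C) by apply: circ_sum => n _; exact: circZ.
have lipY C : L1lip (\sum_(A <= n < C) `|eps n| * (2 * (q n)%:R)) (Y C).
  elim: C => [|C IH].
    rewrite big_geq// => u; rewrite (_ : (fun _ => _) = fun=> 0) ?cint_cst ?mul0r//.
    by apply/funext => x; rewrite /Y !big_geq// subrr normr0.
  have [AC|CA] := leqP A C; last first.
    rewrite big_geq// => u; rewrite (_ : (fun _ => _) = fun=> 0) ?cint_cst ?mul0r//.
    by apply/funext => x; rewrite /Y !big_geq// subrr normr0.
  rewrite big_nat_recr//= (_ : Y C.+1 = fun x => Y C x + eps C * psi ((q C)%:R * x + c C)).
    apply: L1lipD => //; first exact: circZ.
    by apply: L1lipZ => //; exact: L1lip_psi.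
  by apply/funext => x; rewrite /Y big_nat_recr.
have step C : cint (fun x => Y C x ^+ 2) <=
    \sum_(A <= n < C) (eps n ^+ 2 +
      4 * \sum_(A <= l < n) `|eps n| * `|eps l| * ((q l.+1)%:R / (q n)%:R)).
  elim: C => [|C IH].
    rewrite big_geq//; apply: le_cint_cst => [|x]; last by rewrite /Y big_geq// expr0n.
    by apply: circM.
  have [AC|CA] := leqP A C; last first.
    rewrite big_geq//; apply: le_cint_cst => [|x]; last by rewrite /Y big_geq// expr0n.
    by apply: circM.
  rewrite big_nat_recr//=.
  have -> : (fun x => Y C.+1 x ^+ 2) = (fun x => Y C x ^+ 2 +
      (2 * eps C * (Y C x * psi ((q C)%:R * x + c C)) +
       eps C ^+ 2 * (psi ((q C)%:R * x + c C)) ^+ 2)).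
    by apply/funext => x; rewrite /Y big_nat_recr//=; ring.
  have c1 : circ (fun x => Y C x * psi ((q C)%:R * x + c C)) by exact: circM.
  have c2 : circ (fun x => psi ((q C)%:R * x + c C) ^+ 2) by exact: circM.
  have c3 : circ (fun x => Y C x ^+ 2) by exact: circM.
  rewrite cintD//; last by apply: circD; exact: circZ.
  apply: lerD => //; rewrite cintD; [|exact: circZ|exact: circZ].
  rewrite !cintZ// addrC; apply: lerD.
    rewrite ler_piMr ?sqr_ge0//; apply: le_cint_cst => // x.
    have := psi_le_half ((q C)%:R * x + c C); rewrite ler_norml; nra.
  apply: (le_trans (ler_norm _)); rewrite normrM normrM ger0_norm//.
  apply: (@le_trans _ _ (2 * `|eps C| *
      ((\sum_(A <= n < C) `|eps n| * (2 * (q n)%:R)) / (q C)%:R))).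
    rewrite ler_wpM2l ?mulr_ge0//.
    exact: cint_psi_decorrelation.
  rewrite mulr_suml !mulr_sumr; apply: ler_sum => l _.
  have -> : 2 * `|eps C| * (`|eps l| * (2 * (q l)%:R) / (q C)%:R) =
      4 * (`|eps C| * `|eps l| * ((q l)%:R / (q C)%:R)) by ring.
  rewrite !ler_wpM2l ?mulr_ge0// ler_pM2r ?invr_gt0// ler_nat.
  exact: leq_cf_denominatorS.
apply: (le_trans (step B)); rewrite big_split /= -mulr_sumr.
have := @lacunary_schur (fun n => `|eps n|) A B (fun n => normr_ge0 _).
under [X in _ <= 4 * X -> _]eq_bigr do rewrite real_normK ?num_real//.
lra.
Qed.

Lemma lacunary_L1 (c eps : nat -> R) (A B : nat) (lam : R) : 0 < lam ->
  \sum_(A <= n < B) eps n ^+ 2 <= lam ^+ 2 ->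
  cint (fun x => `|\sum_(A <= n < B) eps n * psi ((q n)%:R * x + c n)|) <= 9 * lam.
Proof.
move=> l0 hl; pose Y x := \sum_(A <= n < B) eps n * psi ((q n)%:R * x + c n).
have cY : circ Y by apply: circ_sum => n _; exact/circZ/circ_psi_affine.
have cY2 : circ (fun x => (2 * lam)^-1 * Y x ^+ 2) by apply: circZ; exact: circM.
apply: (@le_trans _ _ (cint (fun x => lam / 2 + (2 * lam)^-1 * Y x ^+ 2))).
  apply: le_cint; [exact: circ_norm|by apply: circD => //; exact: circ_cst|].
  move=> x; rewrite -/(Y x); set y := `|Y x|.
  have -> : Y x ^+ 2 = y ^+ 2 by rewrite /y real_normK ?num_real.
  have l2 : 2 * lam * ((2 * lam)^-1 * y ^+ 2) = y ^+ 2.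
    by rewrite mulVKf// mulf_neq0 ?gt_eqF.
  have := sqr_ge0 (y - lam); nra.
rewrite cintD//; last exact: circ_cst.
rewrite cint_cst cintZ; last exact: circM.
have := lacunary_L2 c eps A B; rewrite -/Y => h.
have h2 : (2 * lam)^-1 * cint (fun x => Y x ^+ 2) <= (2 * lam)^-1 * (17 * lam ^+ 2).
  by rewrite ler_pM2l ?invr_gt0 ?mulr_gt0//; lra.
have : (2 * lam)^-1 * (17 * lam ^+ 2) = 17 / 2 * lam by field; rewrite gt_eqF.
lra.
Qed.

(** The exceptional set has measure at most 2 eta, and two unimodular functions
    differ there by at most 2. *)
Lemma udist_agree (f g : R -> R[i]) (k : nat) (c eta : R) : unim f -> unim g ->
  (0 < k)%N -> 0 <= eta ->
  (forall x, eta <= frac (k%:R * x + c) < 1 - eta -> f x = g x) ->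
  udist f g <= 4 * eta.
Proof.
move=> uf ug k0 e0 fg; have [e1|e1] := leP (2 * eta) 1; last first.
  by apply: (le_trans (udist_le2 uf ug)); lra.
have w01 : 0 <= 2 * eta <= 1 by rewrite mulr_ge0.
apply: (@le_trans _ _ (cint (fun x => 2 * chi (2 * eta) (k%:R * x + (c - eta))))).
  apply: udist_le => //; first exact/circZ/circ_chi_affine.
  move=> x; have [[-> h]|[-> _]] := chi_cases (k%:R * x + (c - eta)) w01; last first.
    by rewrite mulr1; apply: cabs_sub_le2; exact: unim_cabs.
  rewrite fg ?subrr ?cabs0 ?mulr0//.
  have := frac_itv (k%:R * x + (c - eta)).
  set F := frac (k%:R * x + (c - eta)) in h * => F01.
  rewrite (@fracE _ _ (Num.floor (k%:R * x + (c - eta)))) //.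
    by move: h F01; rewrite /F /frac; lra.
  by move: h F01; rewrite /F /frac; lra.
rewrite cintZ; last exact: circ_chi_affine.
by rewrite cint_chi ?mulr_ge0//; lra.
Qed.

End lacunary.

Section block.
Context {R : realType} (alpha : R).
Hypothesis alpha_itv : 0 < alpha < 1.
Hypothesis alpha_irr : irrational alpha.
Implicit Types (x y : R).

Local Notation q := (cf_denominator alpha).
Local Notation a := (partial_quotient alpha).
Local Notation delta := (cf_delta alpha).
Local Notation e := e2ipi.
Local Notation cabs := Normc.normc.
Let q0 n : (0 < q n)%N := cf_denominator_gt0 alpha_itv alpha_irr n.
Let qR n : 0 < (q n)%:R :> R := cf_denominatorR_gt0 alpha_itv alpha_irr n.

Definition ksum (b : nat -> int) (N : nat) : int := \sum_(0 <= n < N) b n * (q n)%:Z.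

Definition ksum_norm (b : nat -> int) (N : nat) : R :=
  \sum_(0 <= n < N) `|(b n)%:~R| * (q n)%:R.

Lemma ksumS b N : ksum b N.+1 = ksum b N + b N * (q N)%:Z.
Proof. by rewrite /ksum big_nat_recr. Qed.

Lemma ksum_normS b N : ksum_norm b N.+1 = ksum_norm b N + `|(b N)%:~R| * (q N)%:R.
Proof. by rewrite /ksum_norm big_nat_recr. Qed.

Lemma ksum_norm_ge0 b N : 0 <= ksum_norm b N.
Proof. by apply: sumr_ge0 => n _; rewrite mulr_ge0. Qed.

Lemma ksum_le b N : `|(ksum b N)%:~R| <= ksum_norm b N.
Proof.
elim: N => [|N IH]; first by rewrite /ksum /ksum_norm !big_geq// normr0.
rewrite ksumS ksum_normS intrD; apply: (le_trans (ler_normD _ _)).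
by rewrite lerD// intrM normrM -pmulrn normr_nat.
Qed.

Lemma ksum_series b N :
  series (fun n => (b n)%:~R * (q n)%:R * alpha) N = (ksum b N)%:~R * alpha.
Proof.
elim: N => [|N IH]; first by rewrite /ksum /series /= !big_geq// mul0r.
by rewrite seriesSr IH ksumS intrD intrM -pmulrn; ring.
Qed.

Lemma delta_le_a n : (q n)%:R * delta n <= (a n.+1)%:R^-1.
Proof.
have aR : 0 < (a n.+1)%:R :> R by rewrite ltr0n partial_quotient_gt0.
rewrite -[leRHS]mul1r ler_pdivlMr//.
have := cf_delta_det alpha n; have := leq_partial_quotientM alpha n.
rewrite -(ler_nat R) natrM => h1 h2.
have d0 := cf_delta_gt0 alpha_itv alpha_irr n; have d1 := cf_delta_gt0 alpha_itv alpha_irr n.+1.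
have := qR n; nra.
Qed.

Lemma summ_ksum_delta (b : nat -> int) :
  summ (fun n => `|(b n)%:~R| / (a n.+1)%:R : R) ->
  summ (fun n => ksum_norm b n.+1 * delta n).
Proof.
move=> [B hB]; exists (4 * B) => N.
rewrite /ksum_norm; under eq_bigr do rewrite mulr_suml.
rewrite (sum_triangle (fun l n => `|(b l)%:~R| * (q l)%:R * delta n)).
apply: (@le_trans _ _ (4 * \sum_(0 <= n < N) `|(b n)%:~R| / (a n.+1)%:R)); last first.
  by rewrite ler_pM2l.
rewrite mulr_sumr; apply: ler_sum => l _; rewrite -mulr_sumr.
apply: (@le_trans _ _ (`|(b l)%:~R| * (q l)%:R * (4 / (q l.+1)%:R))).
  rewrite ler_wpM2l ?mulr_ge0//.
  apply: le_trans (sum_cf_denominatorV alpha_itv alpha_irr l.+1 N.+1).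
  rewrite big_add1; apply: ler_sum => n _; exact: cf_delta_le.
have aR : 0 < (a l.+1)%:R :> R by rewrite ltr0n partial_quotient_gt0.
have -> : `|(b l)%:~R| * (q l)%:R * (4 / (q l.+1)%:R) =
    4 * (`|(b l)%:~R| * ((q l)%:R / (q l.+1)%:R)) :> R by ring.
rewrite !ler_wpM2l// ler_pdivrMr// mulrC ler_pdivlMr// -natrM ler_nat mulnC.
exact: leq_partial_quotientM.
Qed.

Variables (I : finType) (P : pred I) (s : I -> R) (b : I -> nat -> int) (beta : R).

Definition block_sum n : R := \sum_(j | P j) (b j n)%:~R * s j.
Definition block_int n : int := nearest_int (block_sum n).
Definition block_eps n : R := block_sum n - (block_int n)%:~R.
Definition block_trans N x : R := \sum_(j | P j) s j * trans alpha (ksum (b j) N) (x - beta).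
(** Bounds the size of the neighbourhoods of the multiples of 1/q_n outside of which
    the n-th increments are explicit. *)
Definition block_eta n : R := \sum_(j | P j) ksum_norm (b j) n.+1 * delta n.

Lemma block_eps_dist n : `|block_eps n| = dist_int (block_sum n).
Proof. by []. Qed.

Lemma block_eta_ge0 n : 0 <= block_eta n.
Proof.
apply: sumr_ge0 => j _; rewrite mulr_ge0 ?ksum_norm_ge0// ltW//.
exact: cf_delta_gt0.
Qed.

Lemma circ_block_trans N : circ (block_trans N).
Proof. by apply: circ_sum => j _; apply: circZ; exact: circ_trans. Qed.

Lemma block_increment n : exists C : R, forall x,
  block_eta n <= frac ((q n)%:R * x + - (q n)%:R * beta) < 1 - block_eta n ->
  block_trans n.+1 x - block_trans n x =
  block_sum n * psi ((q n)%:R * x + - (q n)%:R * beta) + C.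
Proof.
have d0 := cf_delta_gt0 alpha_itv alpha_irr n.
have H j : exists C : R, P j -> forall y, block_eta n <= frac ((q n)%:R * y) < 1 - block_eta n ->
    trans alpha (ksum (b j) n.+1) y - trans alpha (ksum (b j) n) y =
    (b j n)%:~R * psi ((q n)%:R * y) + C.
  have [Pj|nPj] := boolP (P j); last by exists 0.
  have le1 : ksum_norm (b j) n.+1 * delta n <= block_eta n.
    rewrite /block_eta (bigD1 j)//= lerDl sumr_ge0// => i _.
    by rewrite mulr_ge0 ?ksum_norm_ge0// ltW.
  have h1 : `|(ksum (b j) n)%:~R| * delta n <= block_eta n.
    apply: le_trans le1; rewrite ler_pM2r// ksum_normS (le_trans (ksum_le _ _))//.
    by rewrite lerDl mulr_ge0.
  have h2 : `|(ksum (b j) n + b j n * (q n)%:Z)%:~R| * delta n <= block_eta n.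
    by apply: le_trans le1; rewrite ler_pM2r// -ksumS ksum_le.
  have [C HC] := trans_increment alpha_itv alpha_irr h1 h2.
  by exists C => _ y /HC; rewrite ksumS.
have [C HC] := choice H; exists (\sum_(j | P j) s j * C j) => x.
have -> : (q n)%:R * x + - (q n)%:R * beta = (q n)%:R * (x - beta) by ring.
move=> xE; rewrite /block_trans -sumrB /block_sum mulr_suml -big_split /=.
by apply: eq_bigr => j Pj; rewrite -mulrBr (HC j Pj _ xE); ring.
Qed.

(** One step of the transfer function is, up to characters, constants and a small
    set, a single oscillating factor. *)
Definition block_factor (z : R[i]) n x : R[i] :=
  e (block_trans n.+1 x) / e (block_trans n x) *
  (e ((- block_int n * (q n)%:Z)%:~R * x) * z).

Definition block_osc n x : R[i] :=
  e (block_eps n * psi ((q n)%:R * x + - (q n)%:R * beta)).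

Lemma unim_block_osc n : unim (block_osc n).
Proof. by apply: unim_e_circ; apply: circZ; exact: circ_psi_affine. Qed.

Lemma unim_block_factor z n : cabs z = 1 -> unim (block_factor z n).
Proof.
move=> z1; apply: unimM; first by apply: unim_div; apply: unim_e_circ; exact: circ_block_trans.
by apply: unimM; [exact: unim_character|exact: unim_cst].
Qed.

Lemma block_factor_osc n : exists2 z, cabs z = 1 & forall x,
  block_eta n <= frac ((q n)%:R * x + - (q n)%:R * beta) < 1 - block_eta n ->
  block_factor z n x = block_osc n x.
Proof.
have [C HC] := block_increment n; set p := block_int n.
exists (e (- C + p%:~R * (q n)%:R * beta + p%:~R / 2)); first exact: cabs_e.
move=> x /HC E; rewrite /block_factor /block_osc -eB E -/p.
set y := (q n)%:R * x + - (q n)%:R * beta.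
rewrite (_ : block_sum n * psi y = block_eps n * psi y + p%:~R * psi y); last first.
  by rewrite /block_eps -/p; ring.
rewrite -!eD; apply: e_int_eq.
rewrite (_ : _ - _ = - (p * Num.floor y)%:~R) ?rpredN ?intr_int//.
by rewrite /psi /frac /y !intrM intrN -pmulrn; field.
Qed.

Lemma block_step n : exists2 z, cabs z = 1 &
  udist (block_factor z n) (block_osc n) <= 4 * block_eta n.
Proof.
have [z z1 hz] := block_factor_osc n; exists z => //.
apply: (udist_agree (unim_block_factor n z1) (unim_block_osc n) (q0 n)) hz.
exact: block_eta_ge0.
Qed.

Hypothesis b_summ : forall j, P j -> summ (fun n => `|(b j n)%:~R| / (a n.+1)%:R : R).
Hypothesis eps_summ : summ (fun n => dist_int (block_sum n) ^+ 2).

Lemma summ_block_eta : summ block_eta.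
Proof. by apply: summ_sum => j Pj; exact/summ_ksum_delta/b_summ. Qed.

(** The normalized transfer functions converge in the mean: the exceptional sets
    are summable and the oscillating factors are almost orthogonal. *)
Lemma block_converge : exists Z : nat -> R[i], (forall n, cabs (Z n) = 1) /\
  forall eps : R, 0 < eps -> exists N, forall m n, (N <= m <= n)%N ->
  udist (fun x => Z m * e ((- ksum block_int m)%:~R * x) * e (block_trans m x))
        (fun x => Z n * e ((- ksum block_int n)%:~R * x) * e (block_trans n x)) <= eps.
Proof.
have hz' n : exists z, cabs z = 1 /\
    udist (block_factor z n) (block_osc n) <= 4 * block_eta n.
  by have [z z1 zd] := block_step n; exists z.
have [z hz] := choice hz'.
have z1 n : cabs (z n) = 1 by have [] := hz n.
have zd n : udist (block_factor (z n) n) (block_osc n) <= 4 * block_eta n by have [] := hz n.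
pose Z n := \prod_(0 <= i < n) z i.
have Z1 n : cabs (Z n) = 1.
  elim: n => [|n IH]; first by rewrite /Z big_geq// cabs1.
  by rewrite /Z big_nat_recr//= Normc.normcM IH z1 mulr1.
exists Z; split => // eps eps0.
pose Hn n x := Z n * e ((- ksum block_int n)%:~R * x) * e (block_trans n x).
have uH n : unim (Hn n).
  apply: unimM; last by apply: unim_e_circ; exact: circ_block_trans.
  by apply: unimM; [exact: unim_cst|exact: unim_character].
have HS n x : Hn n.+1 x = Hn n x * block_factor (z n) n x.
  rewrite /Hn /block_factor /Z big_nat_recr//= ksumS opprD intrD mulrDl eD mulNr.
  by field; exact: e_neq0.
pose lam := eps / (2 * 144).
have lam0 : 0 < lam by rewrite divr_gt0//; lra.
have [N1 h1] := summ_tail block_eta_ge0 summ_block_eta (divr_gt0 eps0 (ltr0n R 8)).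
have [N2 h2] := summ_tail (fun n => sqr_ge0 (dist_int (block_sum n))) eps_summ (exprn_gt0 2 lam0).
exists (maxn N1 N2) => m n; rewrite geq_max => /andP[/andP[Nm1 Nm2] mn].
have E x : Hn n x = Hn m x * \prod_(m <= i < n) block_factor (z i) i x.
  rewrite -(subnKC mn); elim: (n - m)%N => [|k IH]; first by rewrite addn0 big_geq ?mulr1.
  rewrite addnS HS IH [in RHS]big_nat_recr ?leq_addr// -mulrA; congr (_ * _).
have uF i := unim_block_factor i (z1 i).
have uFp : unim (fun x => \prod_(m <= i < n) block_factor (z i) i x) by exact: unim_prod.
have uOp : unim (fun x => \prod_(m <= i < n) block_osc i x).
  by apply: unim_prod => i _; exact: unim_block_osc.
have -> : udist (Hn m) (Hn n) = udist (fun=> 1) (fun x => \prod_(m <= i < n) block_factor (z i) i x).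
  rewrite -(udist_mull (fun=> 1) _ (uH m)).
  have -> : (fun x => Hn m x * 1) = Hn m by apply/funext => x; rewrite mulr1.
  by have -> : Hn n = (fun x => Hn m x * \prod_(m <= i < n) block_factor (z i) i x) by apply/funext.
have u1 : unim (fun=> 1 : R[i]) by apply: unim_cst; exact: cabs1.
apply: (le_trans (udist_triangle u1 uOp uFp)).
have d1 : udist (fun x => \prod_(m <= i < n) block_osc i x)
    (fun x => \prod_(m <= i < n) block_factor (z i) i x) <= eps / 2.
  have := @udist_prod R _ (index_iota m n) xpredT _ _ (fun i _ => unim_block_osc i)
    (fun i _ => uF i).
  move/le_trans; apply.
  apply: (@le_trans _ _ (\sum_(m <= i < n) 4 * block_eta i)).
    by apply: ler_sum => i _; rewrite udistC; exact: zd.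
  by rewrite -mulr_sumr; have := h1 m n Nm1; lra.
have d2 : udist (fun=> 1) (fun x => \prod_(m <= i < n) block_osc i x) <= eps / 2.
  pose Y x := \sum_(m <= i < n) block_eps i * psi ((q i)%:R * x + - (q i)%:R * beta).
  have cY : circ Y by apply: circ_sum => i _; exact/circZ/circ_psi_affine.
  have -> : (fun x => \prod_(m <= i < n) block_osc i x) = fun x => e (Y x).
    by apply/funext => x; rewrite /Y e_sum.
  have -> : (fun=> 1 : R[i]) = (fun x : R => e (0 : R)) by apply/funext => x; rewrite e0.
  apply: (le_trans (udist_e (circ_cst 0) cY)).
  under eq_fun do rewrite sub0r normrN.
  have := lacunary_L1 alpha_itv alpha_irr (fun i => - (q i)%:R * beta) (A := m) (B := n) (eps := block_eps) lam0.
  have -> : \sum_(m <= i < n) block_eps i ^+ 2 = \sum_(m <= i < n) dist_int (block_sum i) ^+ 2.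
    by apply: eq_bigr => i _; rewrite -block_eps_dist real_normK ?num_real.
  move=> /(_ (h2 m n Nm2)); rewrite -/Y => h3.
  have : 16 * (9 * lam) = eps / 2 by rewrite /lam; field.
  by lra.
lra.
Qed.

End block.

(** * Sufficiency *)
Section coboundary_limit.
Context {R : realType} (alpha : R).
Hypothesis alpha_itv : 0 < alpha < 1.
Hypothesis alpha_irr : irrational alpha.
Implicit Types (x y : R).

Local Notation q := (cf_denominator alpha).
Local Notation a := (partial_quotient alpha).
Local Notation e := e2ipi.
Local Notation cabs := Normc.normc.
Notation mu := (@lebesgue_measure R).
Local Notation ksum := (ksum alpha).

Lemma cint_psi_translate (u v : R) :
  cint (fun x => `|psi (x - u) - psi (x - v)|) <= 2 * dist_int (u - v).
Proof.
have := @L1lip_psi R 1 (- v) isT (- (u - v - (nearest_int (u - v))%:~R)).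
rewrite normrN -/(dist_int (u - v)) mulr1; apply: le_trans.
rewrite le_eqVlt; apply/orP; left; apply/eqP; congr cint; apply/funext => x.
rewrite !mul1r (_ : x - (u - v - (nearest_int (u - v))%:~R) - v =
  x - u + (nearest_int (u - v))%:~R); first by rewrite psiDz.
ring.
Qed.

Section sawtooth_sum.
Variables (I : finType) (s beta gam : I -> R) (b : I -> nat -> int).

(** The step function with jumps -s_j at beta_j, and its approximations whose
    discontinuities lie on the orbits of the points gam_j. *)
Definition saw x : R := \sum_j s j * psi (x - beta j).
Definition saw_approx N x : R :=
  \sum_j s j * psi (x - gam j - (ksum (b j) N)%:~R * alpha).

Lemma circ_saw : circ saw.
Proof. by apply: circ_sum => j _; apply: circZ; exact: circ_shift circ_psi. Qed.

Lemma circ_saw_approx N : circ (saw_approx N).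
Proof.
apply: circ_sum => j _; apply: circZ; under eq_fun do rewrite -addrA.
exact: circ_shift circ_psi.
Qed.

Lemma saw_approx_dist N : udist (fun x => e (saw x)) (fun x => e (saw_approx N x)) <=
  16 * \sum_j `|s j| * (2 * dist_int ((ksum (b j) N)%:~R * alpha - (beta j - gam j))).
Proof.
apply: (le_trans (udist_e circ_saw (circ_saw_approx N))).
rewrite ler_pM2l//.
have cd j : circ (fun x => psi (x - beta j) - psi (x - (gam j + (ksum (b j) N)%:~R * alpha))).
  by apply: circB; exact: circ_shift circ_psi.
apply: (@le_trans _ _ (cint (fun x => \sum_j `|s j| *
    `|psi (x - beta j) - psi (x - (gam j + (ksum (b j) N)%:~R * alpha))|))).
  apply: le_cint.
  - apply/circ_norm/circB; [exact: circ_saw|exact: circ_saw_approx].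
  - by apply: circ_sum => j _; apply: circZ; exact: circ_norm.
  - move=> x; rewrite /saw /saw_approx -sumrB; apply: (le_trans (ler_norm_sum _ _ _)).
    by apply: ler_sum => j _; rewrite -mulrBr normrM (_ : x - (gam j + _) = x - gam j - (ksum (b j) N)%:~R * alpha) //; ring.
rewrite cint_sum; last by move=> j _; apply: circZ; exact: circ_norm.
apply: ler_sum => j _; rewrite cintZ; last exact: circ_norm.
rewrite ler_wpM2l//; apply: (le_trans (cint_psi_translate _ _)).
by rewrite ler_pM2l// -dist_intN; have -> : - (beta j - (gam j + (ksum (b j) N)%:~R * alpha)) =
  (ksum (b j) N)%:~R * alpha - (beta j - gam j) by ring.
Qed.

Lemma saw_approx_tends0 :
  (forall j, tends0 (fun N => dist_int ((ksum (b j) N)%:~R * alpha - (beta j - gam j)))) ->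
  tends0 (fun N => udist (fun x => e (saw x)) (fun x => e (saw_approx N x))).
Proof.
move=> H; apply: tends0_le (tends0Z 16 (tends0_sum _ (fun j => tends0Z `|s j| (tends0Z 2 (H j))))).
by move=> N; rewrite ger0_norm ?udist_ge0//; exact: saw_approx_dist.
Qed.

End sawtooth_sum.

(** The equation passes to the limit in the mean, all its terms being unimodular. *)
Lemma coboundary_limit (phi : R -> R) (phiN : nat -> R -> R) (F : nat -> R -> R[i])
    (G : R -> R[i]) (w : nat -> R[i]) (w0 : R[i]) :
  circ phi -> (forall N, circ (phiN N)) -> (forall N, unim (F N)) -> unim G ->
  (forall N, cabs (w N) = 1) -> cabs w0 = 1 ->
  (forall N x, e (phiN N x) = w N * (F N x / F N (x + alpha))) ->
  tends0 (fun N => udist (fun x => e (phi x)) (fun x => e (phiN N x))) ->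
  tends0 (fun N => udist (F N) G) ->
  tends0 (fun N => cabs (w N - w0)) ->
  {ae mu, forall x, e (phi x) = w0 * (G x / G (x + alpha))}.
Proof.
move=> cp cpN uF uG w1 w01 rel t1 t2 t3.
have uGs := unim_shift alpha uG; have uFs N := unim_shift alpha (uF N).
have uq : unim (fun x => w0 * (G x / G (x + alpha))).
  by apply: unimM; [exact: unim_cst|exact: unim_div].
have up : unim (fun x => e (phi x)) by exact: unim_e_circ.
apply: udist0_ae => //; apply/eqP; rewrite eq_le udist_ge0 andbT.
apply/ler_addgt0Pr => eps e0; rewrite add0r.
have [N hN] := tends0D (tends0D t1 t3) (tends0Z 2 t2) e0.
have := hN N (leqnn N); rewrite ger0_norm; last first.
  by rewrite !addr_ge0 ?mulr_ge0 ?udist_ge0 ?cabs_ge0.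
apply: le_trans.
have upN : unim (fun x => e (phiN N x)) by exact: unim_e_circ.
apply: (le_trans (udist_triangle up upN uq)); rewrite -addrA lerD2l.
have -> : (fun x => e (phiN N x)) = (fun x => w N * (F N x / F N (x + alpha))).
  by apply/funext => x; exact: rel.
have uFq : unim (fun x => F N x / F N (x + alpha)) by exact: unim_div.
have uGq : unim (fun x => G x / G (x + alpha)) by exact: unim_div.
apply: (le_trans (udistM (unim_cst (w1 N)) (unim_cst w01) uFq uGq)).
rewrite udist_cst lerD2l; apply: (le_trans (udist_div _ _ _ _)) => //.
by rewrite udist_shift//; lra.
Qed.

Lemma block_trans_coboundary (I : finType) (P : pred I) (s : I -> R)
    (b : I -> nat -> int) (bt : R) N x :
  block_trans alpha P s b bt N x - block_trans alpha P s b bt N (x + alpha) =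
  \sum_(j | P j) s j * (psi (x - bt - (ksum (b j) N)%:~R * alpha) - psi (x - bt)).
Proof.
rewrite /block_trans -sumrB; apply: eq_bigr => j _.
by rewrite -mulrBr addrAC trans_coboundary.
Qed.

(** When the coefficients are integers of sum 0, the variable part of each
    sawtooth is an integer or cancels, so that only a constant remains. *)
Lemma e_zero_sum_psi (I : finType) (P : pred I) (S B : I -> R) x :
  (forall J, P J -> S J \is a Num.int) -> \sum_(J | P J) S J = 0 ->
  e (\sum_(J | P J) S J * psi (x - B J)) = e (- \sum_(J | P J) B J * S J).
Proof.
move=> Sint S0; apply: e_int_eq; rewrite opprK -big_split /=.
have E : \sum_(J | P J) (S J * psi (x - B J) + B J * S J) =
    (x - 2^-1) * \sum_(J | P J) S J - \sum_(J | P J) S J * (Num.floor (x - B J))%:~R.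
  rewrite mulr_sumr -sumrB; apply: eq_bigr => J _; rewrite /psi /frac; ring.
rewrite E S0 mulr0 sub0r rpredN; apply: rpred_sum => J PJ.
by rewrite rpredM ?intr_int// Sint.
Qed.

Lemma tends0_e (u : nat -> R) : tends0 (fun n => dist_int (u n)) ->
  tends0 (fun n => cabs (e (u n) - 1)).
Proof.
move=> h; apply: tends0_le (tends0Z 16 h) => n; rewrite ger0_norm ?cabs_ge0//.
have -> : e (u n) = e (u n - (nearest_int (u n))%:~R).
  by rewrite -intrN eDz.
exact: e_sub1_lipschitz.
Qed.

(** For each block J the normalized transfer functions converge; their product over
    the blocks solves the equation for the approximations, up to a constant that
    converges modulo 1 by the third condition. A character absorbs k' alpha. *)
Lemma condition_C_sufficient (m : nat) (beta s : 'I_m.+1 -> R) (t : R) :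
  \sum_j s j = 0 -> condition_C alpha beta s t ->
  exists2 f, unim f & {ae mu, forall x, e (saw s beta x) = e t * (f x / f (x + alpha))}.
Proof.
move=> s0 [P partP].
pose c (J : {set 'I_m.+1}) : 'I_m.+1 := odflt ord0 [pick j in J].
move=> /(_ c) []; rewrite -/c.
  move=> J JP; rewrite /c; case: pickP => [j //|J0].
  have JE : J = finset.set0 by apply/finset.setP => j; rewrite J0 finset.in_set0.
  by case/and3P: partP => _ _; rewrite -JE JP.
move=> Sint [b [hb [k' [tau [htau ht]]]]].
pose gam j := beta (c (finset.pblock P j)).
have trivP : finset.trivIset P by case/and3P: partP.
have pbl J j : J \in P -> j \in J -> finset.pblock P j = J by exact: finset.def_pblock.
have inP j : finset.pblock P j \in P.
  by apply: finset.pblock_mem; case/and3P: partP => /eqP -> _ _; rewrite inE.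
have inJ j : j \in finset.pblock P j.
  by rewrite finset.mem_pblock; case/and3P: partP => /eqP -> _ _; rewrite inE.
have splitP (F : 'I_m.+1 -> R) : \sum_j F j = \sum_(J in P) \sum_(j in J) F j.
  rewrite -(finset.set_partition_big _ partP).
  by apply: eq_bigl => j; rewrite inE.
pose bl (J : {set 'I_m.+1}) := block_trans alpha (fun j => j \in J) s b (beta (c J)).
pose pp (J : {set 'I_m.+1}) := block_int (fun j => j \in J) s b.
have bs (J : {set 'I_m.+1}) : J \in P -> forall j, j \in J -> summ (fun n => `|(b j n)%:~R| / (a n.+1)%:R : R).
  move=> JP j jJ; apply/summP; first by move=> n; rewrite divr_ge0.
  by have [h _] := hb J JP; have [] := h j jJ.
have es (J : {set 'I_m.+1}) : J \in P -> summ (fun n => dist_int (block_sum (fun j => j \in J) s b n) ^+ 2).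
  move=> JP; apply/summP; first by move=> n; exact: sqr_ge0.
  by have [_] := hb J JP.
have conv (J : {set 'I_m.+1}) : exists Z : nat -> R[i], J \in P -> (forall n, cabs (Z n) = 1) /\
    forall eps : R, 0 < eps -> exists N, forall m n, (N <= m <= n)%N ->
    udist (fun x => Z m * e ((- ksum (pp J) m)%:~R * x) * e (bl J m x))
          (fun x => Z n * e ((- ksum (pp J) n)%:~R * x) * e (bl J n x)) <= eps.
  have [JP|nJP] := boolP (J \in P); last by exists (fun=> 1).
  have [Z hZ] := block_converge alpha_itv alpha_irr (beta (c J)) (bs J JP) (es J JP).
  by exists Z.
have [Z hZ] := choice conv.
pose H (J : {set 'I_m.+1}) N x := Z J N * e ((- ksum (pp J) N)%:~R * x) * e (bl J N x).
pose F N x := \prod_(J in P) H J N x.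
have uH (J : {set 'I_m.+1}) N : J \in P -> unim (H J N).
  move=> JP; apply: unimM; last by apply: unim_e_circ; exact: circ_block_trans.
  apply: unimM; last exact: unim_character.
  by apply: unim_cst; case: (hZ J JP).
have uF N : unim (F N) by apply: unim_prod => J JP; exact: uH.
have [G uG FG] : exists2 G, unim G & tends0 (fun N => udist (F N) G).
  apply: unim_complete => // eps eps0.
  have eps1 : 0 < eps / (#|P|%:R + 1) by rewrite divr_gt0// ltr_wpDl.
  have hN (J : {set 'I_m.+1}) : exists N, J \in P -> forall m n, (N <= m <= n)%N -> udist (H J m) (H J n) <= eps / (#|P|%:R + 1).
    have [JP|nJP] := boolP (J \in P); last by exists 0%N.
    by have [_ /(_ _ eps1)[N h]] := hZ J JP; exists N.
  have [NJ hNJ] := choice hN.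
  exists (\max_(J in P) NJ J)%N => i n /andP[Ni ii].
  have := @udist_prod R _ (index_enum _) (fun J => J \in P) (fun J => H J i) (fun J => H J n)
    (fun J JP => uH J i JP) (fun J JP => uH J n JP).
  move/le_trans; apply.
  apply: (@le_trans _ _ (\sum_(J in P) eps / (#|P|%:R + 1))).
    apply: ler_sum => J JP; apply: hNJ => //; rewrite ii andbT.
    exact: leq_trans (leq_bigmax_cond _ JP) Ni.
  have c1 : 0 < #|P|%:R + 1 :> R by rewrite ltr_wpDl.
  rewrite sumr_const -[leLHS]mulr_natr -mulrA ler_piMr ?(ltW eps0)//.
  by rewrite mulrC ler_pdivrMr ?mul1r ?lerDl.
pose w N := e (- \sum_(J in P) ((ksum (pp J) N)%:~R * alpha + beta (c J) * \sum_(j in J) s j)).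
have rel N x : e (saw_approx s gam b N x) = w N * (F N x / F N (x + alpha)).
  have E (J : {set 'I_m.+1}) : J \in P -> H J N x / H J N (x + alpha) =
      e ((ksum (pp J) N)%:~R * alpha + \sum_(j in J) s j * (psi (x - beta (c J) - (ksum (b j) N)%:~R * alpha) - psi (x - beta (c J)))).
    move=> JP; rewrite -block_trans_coboundary -/(bl J) /H.
    have Z0 : Z J N != 0 by apply: cabs_unit_neq0; case: (hZ J JP).
    rewrite eD eB mulrDr eD intrN !mulNr !eN.
    by field; rewrite Z0 !e_neq0.
  rewrite /F -prodf_div (eq_bigr _ E).
  rewrite -e_sum /w -eD.
  have SI : \sum_(J in P) (\sum_(j in J) s j) = 0 by rewrite -splitP.
  have := e_zero_sum_psi (fun J => beta (c J)) x Sint SI.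
  set A := \sum_(J in P) _ * psi _; set B := \sum_(J in P) beta _ * _ => EA.
  have -> : e (saw_approx s gam b N x) = e (saw_approx s gam b N x - A) * e (- B).
    by rewrite eB EA; field; rewrite e_neq0.
  rewrite -eD; congr e; rewrite /saw_approx splitP /A /B.
  rewrite !big_split /= opprD.
  have -> : \sum_(J in P) \sum_(j in J) s j * psi (x - gam j - (ksum (b j) N)%:~R * alpha) -
     \sum_(J in P) (\sum_(j in J) s j) * psi (x - beta (c J)) =
     \sum_(J in P) \sum_(j in J) s j * (psi (x - beta (c J) - (ksum (b j) N)%:~R * alpha) - psi (x - beta (c J))).
    rewrite -sumrB; apply: eq_bigr => J JP; rewrite mulr_suml -sumrB.
    apply: eq_bigr => j jJ; rewrite /gam (pbl J j JP jJ); ring.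
  ring.
have wt : tends0 (fun N => cabs (w N - e (- \sum_(J in P) tau J))).
  have h : tends0 (fun N => dist_int (\sum_(J in P) (tau J - beta (c J) * (\sum_(j in J) s j) - (ksum (pp J) N)%:~R * alpha))).
    apply: (@tends0_le _ _ (fun N => \sum_(J <- enum P) dist_int ((ksum (pp J) N)%:~R * alpha - (tau J - beta (c J) * \sum_(j in J) s j)))).
      move=> N; rewrite ger0_norm ?dist_int_ge0// -big_enum /=.
      elim: (enum P) => [|J l IH]; first by rewrite !big_nil (dist_int_int 0).
      rewrite !big_cons; apply: (le_trans (dist_intD _ _)); apply: lerD => //.
      by rewrite -dist_intN opprB.
    have hh (J : {set 'I_m.+1}) : exists u : nat -> R, tends0 u /\ (J \in P -> u = (fun N => dist_int ((ksum (pp J) N)%:~R * alpha - (tau J - beta (c J) * \sum_(j in J) s j)))).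
      have [JP|nJP] := boolP (J \in P); last first.
        by exists (fun=> 0); split => // eps eps0; exists 0%N => n _; rewrite normr0 ltW.
      eexists; split; last by [].
      have /tends0P := htau J JP; apply: tends0_le => N.
      by rewrite ger0_norm ?dist_int_ge0// -ksum_series.
    have [u hu] := choice hh.
    apply: (@tends0_le _ _ (fun N => \sum_(J <- enum P) u J N)); last first.
      by apply: tends0_sum => J; case: (hu J).
    move=> N; rewrite ger0_norm; last by apply: sumr_ge0 => J _; exact: dist_int_ge0.
    rewrite [leLHS]big_seq [leRHS]big_seq; apply: ler_sum => J.
    by rewrite mem_enum => JP; have [_ /(_ JP) ->] := hu J.
  apply: tends0_le (tends0_e h) => N; rewrite ger0_norm ?cabs_ge0//.
  rewrite -[leLHS]mul1r -[X in X * _ <= _](cabs_e (\sum_(J in P) tau J)) -Normc.normcM mulrBr /w -!eD subrr e0.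
  rewrite le_eqVlt; apply/orP; left; apply/eqP; congr (cabs (e _ - 1)).
  by rewrite -sumrB; apply: eq_bigr => J _; ring.
have t1 : tends0 (fun N => udist (fun x => e (saw s beta x)) (fun x => e (saw_approx s gam b N x))).
  apply: saw_approx_tends0 => j.
  have [h _] := hb _ (inP j); have [/tends0P h2 _] := h j (inJ j).
  apply: tends0_le h2 => N; rewrite ger0_norm ?dist_int_ge0//.
  by rewrite -ksum_series.
have main := coboundary_limit (circ_saw s beta) (circ_saw_approx s gam b) uF uG
  (fun N => cabs_e _) (cabs_e _) rel t1 FG wt.
exists (fun x => G x * e (k'%:~R * x)).
  by apply: unimM => //; exact: unim_character.
apply: aeS main => x ->.
have -> : e t = e (k'%:~R * alpha) * e (- \sum_(J in P) tau J).
  by rewrite -eD; exact: e_int_eq.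
rewrite mulrDr eD; field.
by rewrite !e_neq0 (unim_neq0 _ uG).
Qed.

End coboundary_limit.

(** * Expansions along the denominators of the convergents *)
Section expansion.
Context {R : realType} (alpha : R).
Hypothesis alpha_itv : 0 < alpha < 1.
Hypothesis alpha_irr : irrational alpha.

Local Notation q := (cf_denominator alpha).
Local Notation p := (cf_numerator alpha).
Local Notation a := (partial_quotient alpha).
Local Notation delta := (cf_delta alpha).
Local Notation ksum := (ksum alpha).
Let q0 n : (0 < q n)%N := cf_denominator_gt0 alpha_itv alpha_irr n.
Let qR n : 0 < (q n)%:R :> R := cf_denominatorR_gt0 alpha_itv alpha_irr n.

(** The nearest integers P_n to q_n beta satisfy the recurrence of the convergents
    up to an error D_n; solving it by variation of the constants, on the basis of
    the numerators and the denominators, gives the coefficients. *)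
Lemma expansion (beta : R) : exists b : nat -> int,
  [/\ forall n, `|(ksum b n.+1)%:~R| <=
        (dist_int ((q n.+1)%:R * beta) + dist_int ((q n)%:R * beta)) * (q n.+1)%:R,
      forall n, dist_int ((ksum b n)%:~R * alpha - beta) <=
        (dist_int ((q n)%:R * beta) + `|(ksum b n)%:~R| / (q n)%:R) &
      forall n, `|(b n.+1)%:~R| <= dist_int ((q n.+2)%:R * beta) +
        (a n.+2)%:R * dist_int ((q n.+1)%:R * beta) + dist_int ((q n)%:R * beta)].
Proof.
pose P n : int := nearest_int ((q n)%:R * beta).
pose er n : R := (q n)%:R * beta - (P n)%:~R.
have erE n : `|er n| = dist_int ((q n)%:R * beta) by [].
pose prev (T : Type) (z : T) (u : nat -> T) n := if n is n'.+1 then u n' else z.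
pose D n : int := P n.+1 - (a n.+1)%:Z * P n - prev _ 0 P n.
pose b n : int := (-1) ^+ n * D n.
pose L n : int := P 0%N - \sum_(0 <= i < n) b i * p i.
have pS n : p n.+1 = (a n.+1)%:Z * p n + prev _ 1 p n.
  by case: n => [|n] //=; rewrite mulr0 add0r.
have qS n : (q n.+1)%:Z = (a n.+1)%:Z * (q n)%:Z + prev _ 0 (fun n => (q n)%:Z) n.
  case: n => [|n]; first by rewrite /= cf_denominator1 cf_denominator0 mulr1 addr0.
  by rewrite cf_denominatorSS PoszD PoszM.
have LS n : L n.+1 = L n - b n * p n by rewrite /L big_nat_recr//= opprD addrA.
have sol n : P n = ksum b n * p n + L n * (q n)%:Z /\
    prev _ 0 P n = ksum b n * prev _ 1 p n + L n * prev _ 0 (fun n => (q n)%:Z) n.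
  elim: n => [|n [h1 h2]].
    rewrite /ksum /L !big_geq//= cf_denominator0; split; ring.
  split; last first.
    by rewrite /= ksumS LS {1}h1; ring.
  have -> : P n.+1 = (a n.+1)%:Z * P n + prev _ 0 P n + D n by rewrite /D; ring.
  rewrite h2 {1}h1 ksumS LS /b.
  have det := cf_det alpha n; set e : int := (-1) ^+ n in det *.
  have ee : e * e = 1 by rewrite /e -expr2 sqrr_sign.
  transitivity (ksum b n * p n.+1 + L n * (q n.+1)%:Z + e * e * D n).
    by rewrite ee pS qS; ring.
  by rewrite -{2}det; ring.
exists b; split=> n.
- have det := cf_det alpha n; have [h1 _] := sol n.+1; have [_ /= h2] := sol n.+1.
  have E : ksum b n.+1 * (-1) ^+ n = P n.+1 * (q n)%:Z - P n * (q n.+1)%:Z.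
    by rewrite -det h1 h2; ring.
  have ER : (ksum b n.+1)%:~R * (-1) ^+ n = er n * (q n.+1)%:R - er n.+1 * (q n)%:R :> R.
    have := congr1 (fun z : int => z%:~R : R) E.
    rewrite /= intrM rmorphXn /= intrN => ->.
    by rewrite intrB !intrM -!pmulrn /er; ring.
  have -> : `|(ksum b n.+1)%:~R| = `|er n * (q n.+1)%:R - er n.+1 * (q n)%:R| :> R.
    by rewrite -ER normrM normr_sign mulr1.
  apply: (le_trans (ler_normB _ _)); rewrite !normrM !erE !normr_nat.
  have := dist_int_ge0 ((q n.+1)%:R * beta).
  have : (q n)%:R <= (q n.+1)%:R :> R by rewrite ler_nat leq_cf_denominatorS.
  nra.
- have [h1 _] := sol n; apply: (le_trans (dist_int_le _ (- L n))).
  have d0 := cf_delta_gt0 alpha_itv alpha_irr n.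
  have E : (q n)%:R * ((ksum b n)%:~R * alpha - beta - (- L n)%:~R) =
      (ksum b n)%:~R * ((-1) ^+ n * delta n) - er n.
    have hR : (P n)%:~R = (ksum b n)%:~R * (p n)%:~R + (L n)%:~R * (q n)%:R :> R.
      by rewrite {1}h1 intrD 2!intrM -pmulrn.
    have qa := cf_thetaE alpha n; rewrite /er hR intrN.
    transitivity ((ksum b n)%:~R * ((q n)%:R * alpha) - (q n)%:R * beta + (q n)%:R * (L n)%:~R).
      by ring.
    by rewrite qa; ring.
  rewrite -(ler_pM2l (qR n)) -{1}(gtr0_norm (qR n)) -normrM E.
  apply: (le_trans (ler_normB _ _)); rewrite erE normrM normrM normr_sign mul1r.
  rewrite (gtr0_norm d0) mulrDr addrC [(q n)%:R * (_ / _)]mulrC divfK ?gt_eqF//.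
  have d1 : delta n <= 1.
    apply: (le_trans (cf_delta_le alpha_itv alpha_irr n)).
    by rewrite invf_le1// cf_denominatorR_ge1.
  have := cf_denominatorR_ge1 alpha_itv alpha_irr n.
  have := dist_int_ge0 ((q n)%:R * beta); have := normr_ge0 ((ksum b n)%:~R : R).
  nra.
- have -> : `|(b n.+1)%:~R| = `|(D n.+1)%:~R| :> R.
    by rewrite /b intrM rmorphXn /= intrN normrM normr_sign mul1r.
  have -> : (D n.+1)%:~R = er n + (a n.+2)%:R * er n.+1 - er n.+2 :> R.
    by rewrite /D /er /= cf_denominatorSS !intrB intrM -pmulrn natrD natrM; ring.
  have := ler_normB (er n + (a n.+2)%:R * er n.+1) (er n.+2).
  have := ler_normD (er n) ((a n.+2)%:R * er n.+1).
  by rewrite normrM normr_nat !erE; lra.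
Qed.

(** The difference between beta and its n-th approximation is of the order of the
    first neglected term. *)
Lemma ksum_tail (b : nat -> int) (beta rho : R) N :
  tends0 (fun n => dist_int ((ksum b n)%:~R * alpha - beta)) ->
  (forall n, (N <= n)%N -> `|(b n)%:~R| / (a n.+1)%:R <= rho) ->
  dist_int ((ksum b N)%:~R * alpha - beta) <= rho * (4 / (q N)%:R).
Proof.
move=> h hrho; apply/ler_addgt0Pr => eps e0; have [M hM] := h _ e0.
have := hM (maxn M N) (leq_maxl _ _); rewrite ger0_norm ?dist_int_ge0//.
have NM := leq_maxr M N; set M' := maxn M N in NM *.
have step : dist_int ((ksum b M')%:~R * alpha - (ksum b N)%:~R * alpha) <=
    \sum_(N <= n < M') `|(b n)%:~R| * delta n.
  rewrite -(subnKC NM); elim: (M' - N)%N => [|k IH].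
    by rewrite addn0 subrr big_geq// (dist_int_int 0).
  rewrite addnS big_nat_recr ?leq_addr//= ksumS.
  have -> : (ksum b (N + k) + b (N + k)%N * (q (N + k))%:Z)%:~R * alpha - (ksum b N)%:~R * alpha =
    ((ksum b (N + k))%:~R * alpha - (ksum b N)%:~R * alpha) +
    (b (N + k)%N)%:~R * ((q (N + k))%:R * alpha) by rewrite intrD intrM -pmulrn; ring.
  apply: (le_trans (dist_intD _ _)); apply: lerD => //.
  apply: (le_trans (dist_intMz _ _)); rewrite ler_wpM2l//.
  exact: dist_int_cf_denominator.
have sumb : \sum_(N <= n < M') `|(b n)%:~R| * delta n <= rho * (4 / (q N)%:R).
  have rho0 : 0 <= rho by apply: le_trans (hrho N (leqnn N)); rewrite divr_ge0.
  apply: (@le_trans _ _ (rho * \sum_(N <= n < M') (q n)%:R^-1)); last first.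
    by rewrite ler_wpM2l// sum_cf_denominatorV.
  rewrite mulr_sumr big_nat [leRHS]big_nat; apply: ler_sum => n /andP[Nn _].
  have aR : 0 < (a n.+1)%:R :> R by rewrite ltr0n partial_quotient_gt0.
  have := hrho n Nn; rewrite ler_pdivrMr// => h1.
  have := delta_le_a alpha_itv alpha_irr n.
  have d0 := cf_delta_gt0 alpha_itv alpha_irr n.
  rewrite -ler_pdivlMl// => h2; apply: (@le_trans _ _ (rho * (a n.+1)%:R * ((q n)%:R^-1 * (a n.+1)%:R^-1))).
    by apply: ler_pM => //; exact: ltW.
  rewrite le_eqVlt; apply/orP; left; apply/eqP; field.
  by rewrite !gt_eqF.
move=> h1; have -> : (ksum b N)%:~R * alpha - beta = ((ksum b M')%:~R * alpha - beta) +
  - ((ksum b M')%:~R * alpha - (ksum b N)%:~R * alpha) by ring.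
by apply: (le_trans (dist_intD _ _)); rewrite dist_intN; lra.
Qed.

(** The last terms dominate, since the denominators grow geometrically. *)
Lemma ksum_norm_little (b : nat -> int) :
  tends0 (fun n => `|(b n)%:~R| / (a n.+1)%:R : R) ->
  tends0 (fun N => ksum_norm alpha b N / (q N)%:R : R).
Proof.
move=> h eps e0; have e6 : 0 < eps / 6 by lra.
have [N0 hN0] := h _ e6.
pose C := ksum_norm alpha b N0 : R; have C0 : 0 <= C by exact: ksum_norm_ge0.
pose N1 := (Num.truncn (2 * C / eps)).+1.
exists (maxn N0 N1) => N; rewrite geq_max => /andP[N0N N1N].
rewrite ger0_norm ?divr_ge0 ?ksum_norm_ge0//.
rewrite ler_pdivrMr// /ksum_norm (big_cat_nat (leq0n N0) N0N) /= -/(ksum_norm _ _ _).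
have h1 : \sum_(N0 <= n < N) `|(b n)%:~R| * (q n)%:R <= eps / 6 * (3 * (q N)%:R) :> R.
  apply: (@le_trans _ _ (eps / 6 * \sum_(N0 <= n < N) (q n.+1)%:R)).
    rewrite mulr_sumr big_nat [leRHS]big_nat; apply: ler_sum => n /andP[Nn _].
    have aR : 0 < (a n.+1)%:R :> R by rewrite ltr0n partial_quotient_gt0.
    have := hN0 n Nn; rewrite ger0_norm ?divr_ge0// ler_pdivrMr// => h1.
    apply: (@le_trans _ _ (eps / 6 * (a n.+1)%:R * (q n)%:R)); first by rewrite ler_pM2r.
    rewrite -mulrA ler_pM2l// -natrM ler_nat; exact: leq_partial_quotientM.
  rewrite ler_pM2l//; case: N {N0N N1N} => [|N]; first by rewrite big_geq// mulr_ge0.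
  apply: (@le_trans _ _ (\sum_(0 <= n < N.+2) (q n)%:R)).
    by rewrite [leRHS]big_nat_recl//= (le_trans (le_sum_nat_nonneg _ _ _))// lerDr.
  by rewrite -natr_sum -natrM ler_nat; exact: sum_cf_denominator.
have h2 : C <= eps / 2 * (q N)%:R.
  have : 2 * C / eps < (q N)%:R.
    apply: (lt_le_trans (truncnS_gt _)); rewrite ler_nat.
    exact: leq_trans N1N (cf_denominator_ge_id alpha_itv alpha_irr N).
  by rewrite ltr_pdivrMr//; lra.
rewrite -/(ksum_norm alpha b N0) -/C; lra.
Qed.

(** The coefficients of the expansion of theta are integers that become smaller
    than 1, so the expansion is finite. *)
Lemma eigenvalue_expansion (theta : R) (n0 : nat) :
  (forall n, (n0 <= n)%N -> (a n.+1)%:R * dist_int ((q n)%:R * theta) <= 8^-1) ->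
  tends0 (fun n => dist_int ((q n)%:R * theta)) ->
  exists k : int, eqmod1 theta (k%:~R * alpha).
Proof.
move=> h t0; have [b [hk hd hb]] := expansion theta.
have small n : (n0 <= n)%N -> dist_int ((q n)%:R * theta) <= 8^-1.
  move=> nn; apply: le_trans (h n nn).
  by rewrite ler_peMl ?dist_int_ge0// ler1n partial_quotient_gt0.
have b0 n : (n0 <= n)%N -> b n.+1 = 0.
  move=> nn; apply/eqP; rewrite -normr_le0.
  have : `|(b n.+1)%:~R| < 1 :> R.
    apply: (le_lt_trans (hb n)); have := h n.+1 (leqW nn).
    have := small n nn; have := small n.+2 (leqW (leqW nn)); lra.
  by rewrite -intr_norm (ltr_int R _ 1); lia.
have kE n : (n0 < n)%N -> ksum b n = ksum b n0.+1.
  move=> nn; rewrite -(subnKC nn); elim: (n - n0.+1)%N => [|k IH]; first by rewrite addn0.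
  by rewrite addnS ksumS IH addSn b0 ?leq_addr// mul0r addr0.
exists (ksum b n0.+1); rewrite /eqmod1 -dist_int_eq0 -dist_intN opprB eq_le dist_int_ge0 andbT.
apply/ler_addgt0Pr => eps e0; rewrite add0r.
have e3 : 0 < eps / 3 by lra.
have [N hN] := t0 _ e3.
pose n := maxn N n0.+1; have Nn : (N <= n)%N by exact: leq_maxl.
have nn : (n0 < n.+1)%N by rewrite ltnS (leq_trans (leqnSn n0)) ?leq_maxr.
rewrite -(kE n.+1 nn); apply: (le_trans (hd n.+1)).
have h1 := hN n Nn; have h2 := hN n.+1 (leqW Nn).
rewrite ger0_norm ?dist_int_ge0// in h1; rewrite ger0_norm ?dist_int_ge0// in h2.
have := hk n; rewrite -ler_pdivrMr// => h3; lra.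
Qed.

End expansion.

(** * Continuity of translations in the mean *)
Section translation_continuity.
Context {R : realType}.
Notation mu := (@lebesgue_measure R).
Local Notation cabs := Normc.normc.

Lemma uniform_continuity01 (g : R -> R) (eps : R) : continuous g -> 0 < eps ->
  exists2 r : R, 0 < r & forall u x, `|u| <= r -> 0 <= x <= 1 -> `|g (x + u) - g x| <= eps.
Proof.
move=> cg e0; have /compact_near_coveringP nc := @segment_compact R 0 1.
have e2 : 0 < eps / 2 by lra.
have H : \forall u \near (0 : R), `[0, 1] `<=` [set x | `|g (x + u) - g x| <= eps].
  apply: (nc R (nbhs (0 : R)) (fun u x => `|g (x + u) - g x| <= eps)) => x _.
  have /cvgrPdist_le /(_ _ e2) [r /= r0 hr] := cg x.
  have r2 : 0 < r / 2 by lra.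
  exists (ball x (r / 2), ball (0 : R) (r / 2)) => /=.
    by split; exact: nbhsx_ballx.
  move=> [x' u] /= []; rewrite /ball /= sub0r normrN => h1 h2.
  have k1 : `|g x - g x'| <= eps / 2 by apply: hr; rewrite /ball_ /=; lra.
  have k2 : `|g x - g (x' + u)| <= eps / 2.
    apply: hr; rewrite /ball_ /= opprD addrA.
    by apply: (le_lt_trans (ler_normB _ _)); lra.
  by have := ler_distD (g x) (g (x' + u)) (g x'); rewrite (distrC _ (g x)); lra.
have [r /= r0 hr] := H; exists (r / 2); first by lra.
move=> u x ur x01; apply: hr => /=; last by rewrite in_itv.
by rewrite sub0r normrN; lra.
Qed.

Lemma ge0_integral_itv_shift (f : R -> \bar R) (a b u : R) :
  measurable_fun [set: R] f -> (forall x, (0 <= f x)%E) ->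
  (\int[mu]_(x in `[a, b[) f (x + u)%R = \int[mu]_(x in `[(a + u)%R, (b + u)%R[) f x)%E.
Proof.
move=> mf f0.
pose mfx := isMeasurableFun.Build _ _ _ _ _ (measurable_addr_by u).
pose ph : {mfun measurableTypeR R >-> measurableTypeR R} := HB.pack (addr_by u) mfx.
have pre : (addr_by u) @^-1` `[a + u, b + u[%classic = `[a, b[%classic.
  by apply/seteqP; split => x /=; rewrite !in_itv /= /addr_by; lra.
transitivity (\int[pushforward mu ph]_(y in `[(a + u)%R, (b + u)%R[) f y)%E.
  rewrite (@ge0_integral_pushforward _ _ _ _ R ph (measurable_addr_by u) mu) //=.
  - by rewrite pre.
  - exact: measurable_funTS.
apply: eq_measure_integral => A mA _ /=.
by rewrite /pushforward lebesgue_measure_addr.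
Qed.

(** Continuous functions are uniformly continuous, and dense in the mean. *)
Lemma cint_translation_continuous (h : R -> R) (eps : R) : circ h -> 0 < eps ->
  exists2 r : R, 0 < r &
    forall u, `|u| <= r -> cint (fun x => `|h (x + u) - h x|) <= eps.
Proof.
move=> ch e0; have e3 : 0 < eps / 3 by lra.
have ih : mu.-integrable `[(-1)%R, 2%R] (EFin \o h).
  case: (ch) => mh _ [M hM]; apply: measurable_bounded_integrable => //.
  - by rewrite /= lebesgue_measure_itv /=; case: ifP => // _; rewrite -EFinB ltry.
  - exact: measurable_funTS.
  - exists M; split; first exact: num_real.
    by move=> N MN x _; exact/(le_trans (hM x))/ltW.
have fin : (mu `[(-1)%R, 2%R] < +oo)%E.
  by rewrite /= lebesgue_measure_itv /=; case: ifP => // _; rewrite -EFinB ltry.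
have [g_ [cg_ ig_]] := approximation_continuous_integrable (measurable_itv _) fin ih.
move=> /fine_cvgP[finn /cvgrPdist_lt /(_ _ e3) close].
have [N _ hN] := (filterI finn close).
have [fN cN] := hN N (leqnn N).
set g := g_ N in fN cN; have cg : continuous g := cg_ N.
have [r0 r00 hr0] := uniform_continuity01 cg e3.
exists (Num.min r0 1); first by rewrite lt_min r00 ltr01.
move=> u; rewrite le_min => /andP[ur u1].
have mg : measurable_fun [set: R] g by exact: continuous_measurable_fun.
have mh : measurable_fun [set: R] h by exact: circ_meas.
pose D (x : R) : \bar R := `|(h x - g x)%:E|%E.
have mD : measurable_fun [set: R] D.
  by apply: measurableT_comp => //; apply/measurable_EFinP; exact: measurable_funB.
have D0 x : (0 <= D x)%E by exact: abse_ge0.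
have bigD : (\int[mu]_(x in `[(-1)%R, 2%R]) D x <= (eps / 3)%:E)%E.
  rewrite -(fineK fN) lee_fin; move: cN; rewrite sub0r normrN => cN.
  by rewrite (le_trans (ler_norm _)) ?ltW.
have subD (a b : R) : -1 <= a -> b <= 2 -> (\int[mu]_(x in `[a, b[) D x <= (eps / 3)%:E)%E.
  move=> a1 b2; apply: le_trans bigD; apply: ge0_subset_integral => //.
    exact: measurable_funTS.
  by move=> x /=; rewrite !in_itv /=; lra.
have [uL uU] : -1 <= u /\ u <= 1 by move: u1; rewrite ler_norml => /andP[].
have cd : circ (fun x => `|h (x + u) - h x|).
  by apply/circ_norm/circB => //; exact: circ_shift.
have mDu : measurable_fun (`[0, 1[%classic : set R) (fun x : R => D (x + u)).
  exact: (measurable_funTS (measurableT_comp mD (measurable_addr_by u))).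
have mD01 : measurable_fun (`[0, 1[%classic : set R) D := measurable_funTS mD.
have mcD : measurable_fun (`[0, 1[%classic : set R) (fun x => (eps / 3)%:E + D x)%E.
  exact: (emeasurable_funD (measurable_cst _) mD01).
have mDcD : measurable_fun (`[0, 1[%classic : set R) (fun x => D (x + u)%R + ((eps / 3)%:E + D x))%E.
  exact: (emeasurable_funD mDu mcD).
rewrite -lee_fin -EFin_cint//.
apply: (@le_trans _ _ (\int[mu]_(x in `[0%R, 1%R[) (D (x + u)%R + ((eps / 3)%:E + D x)))%E).
  apply: ge0_le_integral => //.
  - apply/measurable_EFinP/measurable_funTS; exact: circ_meas.
  - move=> x /=; rewrite in_itv /= => /andP[x0 x1].
    rewrite /D -!EFinD lee_fin.
    have := hr0 u x ur; rewrite x0 (ltW x1) => /(_ isT) hg.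
    have -> : h (x + u) - h x = (h (x + u) - g (x + u)) + ((g (x + u) - g x) - (h x - g x)) by ring.
    apply: (le_trans (ler_normD _ _)); rewrite lerD2l.
    by apply: (le_trans (ler_normB _ _)); rewrite lerD2r.
rewrite ge0_integralD//; last by move=> x _; rewrite adde_ge0// lee_fin ltW.
rewrite ge0_integralD//; last by move=> x _; rewrite lee_fin ltW.
rewrite integral_cst//= lebesgue_measure_itv /= lte01 sube0 mule1.
rewrite ge0_integral_itv_shift// add0r.
have -> : eps%:E = ((eps / 3)%:E + ((eps / 3)%:E + (eps / 3)%:E))%E :> \bar R.
  by rewrite -!EFinD; congr EFin; field.
by apply: leeD; [apply: subD; lra|rewrite leeD2l// subD//; lra].
Qed.

Lemma udist_translation_continuous (f : R -> R[i]) (eps : R) : unim f -> 0 < eps ->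
  exists2 r : R, 0 < r & forall u, `|u| <= r -> udist (fun x => f (x + u)) f <= eps.
Proof.
move=> uf e0; have e2 : 0 < eps / 2 by lra.
have cr := circ_Re uf; have ci := circ_Im uf.
have [r r0 hr] := cint_translation_continuous cr e2.
have [r' r'0 hr'] := cint_translation_continuous ci e2.
exists (Num.min r r'); first by rewrite lt_min r0.
move=> u; rewrite le_min => /andP[/hr h1 /hr' h2].
have c1 : circ (fun x => `|complex.Re (f (x + u)) - complex.Re (f x)|).
  by apply/circ_norm/circB => //; exact: (circ_shift u cr).
have c2 : circ (fun x => `|complex.Im (f (x + u)) - complex.Im (f x)|).
  by apply/circ_norm/circB => //; exact: (circ_shift u ci).
apply: (@le_trans _ _ (cint (fun x => `|complex.Re (f (x + u)) - complex.Re (f x)| +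
   `|complex.Im (f (x + u)) - complex.Im (f x)|))).
  apply: udist_le => //; [exact: unim_shift|exact: circD|].
  by move=> x; apply: (le_trans (cabs_le_ReIm _)); case: (f (x + u)) (f x) => ? ? [].
by rewrite cintD//; lra.
Qed.

End translation_continuity.

(** * The discontinuities are asymptotically aligned *)
Section separated_arcs.
Context {R : realType}.

(** Points that are pairwise separated meet an arc at most once. *)
Lemma sum_chi_separated (w : R) (pos : nat -> R) (A B : nat) : 0 <= w <= 1 ->
  (forall i j, (A <= i < B)%N -> (A <= j < B)%N -> i != j -> w <= dist_int (pos i - pos j)) ->
  (\sum_(A <= i < B) chi w (pos i) = 0 /\ forall i, (A <= i < B)%N -> chi w (pos i) = 0) \/
  (\sum_(A <= i < B) chi w (pos i) = 1 /\ exists2 i, (A <= i < B)%N & chi w (pos i) = 1).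
Proof.
move=> w01 sep.
have [[i iAB ci]|none] := pselect (exists2 i, (A <= i < B)%N & chi w (pos i) = 1).
  right; split; last by exists i.
  rewrite (bigD1_seq i) ?mem_index_iota ?iota_uniq//= ci big1_seq ?addr0// => j.
  rewrite mem_index_iota => /andP[ji jAB].
  have [[//]|[cj _]] := chi_cases (pos j) w01.
  have := chi_separated w01 (y := pos j) (y' := pos i); rewrite ci cj oner_eq0 => /(_ isT isT).
  by have := sep j i jAB iAB ji; lra.
have z i : (A <= i < B)%N -> chi w (pos i) = 0.
  by move=> iAB; have [[]//|[c1 _]] := chi_cases (pos i) w01; exfalso; apply: none; exists i.
by left; split => //; rewrite big_nat big1.
Qed.

Lemma sum_chi_separated_le1 (w : R) (pos : nat -> R) (A B : nat) : 0 <= w <= 1 ->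
  (forall i j, (A <= i < B)%N -> (A <= j < B)%N -> i != j -> w <= dist_int (pos i - pos j)) ->
  \sum_(A <= i < B) chi w (pos i) <= 1.
Proof. by move=> w01 sep; have [[-> _]|[-> _]] := sum_chi_separated w01 sep. Qed.

End separated_arcs.

Section necessity.
Context {R : realType} (alpha : R).
Hypothesis alpha_itv : 0 < alpha < 1.
Hypothesis alpha_irr : irrational alpha.
Notation mu := (@lebesgue_measure R).

Local Notation q := (cf_denominator alpha).
Local Notation a := (partial_quotient alpha).
Local Notation delta := (cf_delta alpha).
Local Notation e := e2ipi.
Local Notation cabs := Normc.normc.
Let q0 n : (0 < q n)%N := cf_denominator_gt0 alpha_itv alpha_irr n.
Let qR n : 0 < (q n)%:R :> R := cf_denominatorR_gt0 alpha_itv alpha_irr n.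

Variables (m : nat) (beta s : 'I_m.+1 -> R) (t : R) (f : R -> R[i]).
Hypothesis s0 : \sum_j s j = 0.
Hypothesis s_prop : forall J : {set 'I_m.+1}, J != finset.set0 ->
  J \proper [set: 'I_m.+1]%SET -> \sum_(j in J) s j \isn't a Num.int.
Hypothesis uf : unim f.
Hypothesis fE : {ae mu, forall x, e (saw s beta x) = e t * (f x / f (x + alpha))}.

(** Finitely many subsets, none of which has an integer sum. *)
Lemma partial_sums_gap : exists2 d : R, 0 < d & forall J : {set 'I_m.+1},
  J != finset.set0 -> J \proper [set: 'I_m.+1]%SET -> d <= cabs (e (\sum_(j in J) s j) - 1).
Proof.
pose Pr (J : {set 'I_m.+1}) := (J != finset.set0) && (J \proper [set: 'I_m.+1]%SET).
pose F (J : {set 'I_m.+1}) : R := cabs (e (\sum_(j in J) s j) - 1).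
have F0 J : Pr J -> 0 < F J.
  move=> /andP[J0 JT]; rewrite lt_neqAle cabs_ge0 andbT eq_sym; apply/eqP => /cabs_eq0/eqP.
  rewrite subr_eq0 => /eqP/e_eq1; apply/negP; exact: s_prop.
have S0 : 0 <= \sum_(J | Pr J) (F J)^-1 by apply: sumr_ge0 => J /F0 h; rewrite invr_ge0 ltW.
exists (1 + \sum_(J | Pr J) (F J)^-1)^-1; first by rewrite invr_gt0; lra.
move=> J J0 JT; have PJ : Pr J by rewrite /Pr J0.
rewrite -/(F J) -[leRHS]invrK lef_pV2 ?posrE ?invr_gt0 ?F0//; last lra.
rewrite (bigD1 J)//= addrCA lerDl addr_ge0// sumr_ge0// => K /andP[/F0 h _].
by rewrite invr_ge0 ltW.
Qed.

Lemma saw_chi (w x : R) : saw s beta x - saw s beta (x + w) = \sum_j s j * chi w (x - beta j).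
Proof.
have : w * \sum_j s j = 0 by rewrite s0 mulr0.
rewrite mulr_sumr => sw; rewrite -[LHS]addr0 -[X in _ + X = _]sw /saw -sumrB -big_split /=.
by apply: eq_bigr => j _; rewrite /chi (addrAC x w); ring.
Qed.

(** The ratio of f to a translate is constant along an orbit, except when the
    orbit meets one of the short arcs that end at the discontinuities. *)
Lemma translate_ratio (u : R) : {ae mu, forall x, forall i k : nat, (i <= k)%N ->
  f (x + k%:R * alpha + u) / f (x + k%:R * alpha) =
  f (x + i%:R * alpha + u) / f (x + i%:R * alpha) *
  e (\sum_j s j * \sum_(i <= l < k) chi u (x + l%:R * alpha - beta j))}.
Proof.
have step : {ae mu, forall x, f (x + alpha + u) / f (x + alpha) =
    f (x + u) / f x * e (\sum_j s j * chi u (x - beta j))}.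
  apply: aeS (aeI fE (ae_shift u fE)) => x [h1 h2].
  have f1 y : f y != 0 by exact: unim_neq0.
  have e1 y : e y != 0 by exact: e_neq0.
  rewrite -saw_chi eB h1 h2 (_ : x + u + alpha = x + alpha + u); last ring.
  by field; rewrite !f1 e1.
have all : {ae mu, forall x, forall l : nat,
    f (x + l%:R * alpha + alpha + u) / f (x + l%:R * alpha + alpha) =
    f (x + l%:R * alpha + u) / f (x + l%:R * alpha) *
    e (\sum_j s j * chi u (x + l%:R * alpha - beta j))}.
  by apply: ae_forall => l; exact: (ae_shift (l%:R * alpha) step).
apply: aeS all => x h i k ik; rewrite -(subnKC ik).
elim: (k - i)%N => [|r IH].
  rewrite addn0 big1 ?e0 ?mulr1// => j _; by rewrite big_geq// mulr0.
have -> : x + (i + r.+1)%:R * alpha = x + (i + r)%:R * alpha + alpha.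
  by rewrite addnS -natr1; ring.
rewrite h IH -mulrA -eD -big_split /=; congr (_ * e _).
by apply: eq_bigr => j _; rewrite addnS big_nat_recr ?leq_addr//=; ring.
Qed.

Lemma orbit_separated n (w : R) (k l : nat) : (0 < n)%N -> w <= (2 * (q n)%:R)^-1 ->
  k != l -> (k < l + q n)%N -> (l < k + q n)%N ->
  w <= dist_int (k%:R * alpha - l%:R * alpha).
Proof.
move=> n0 wq kl h1 h2; apply: (le_trans wq).
have -> : k%:R * alpha - l%:R * alpha = (k%:Z - l%:Z)%:~R * alpha.
  by rewrite intrB -!pmulrn; ring.
rewrite -(prednK n0); apply: le_trans (dist_int_best_approximation alpha_itv alpha_irr (n := n.-1) _ _).
- by rewrite invfM ler_pdivrMl// cf_delta_ge.
- by rewrite subr_eq0 eqz_nat.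
- by rewrite prednK//; lia.
Qed.

(** The translates of f by small numbers are close to f; hence most orbits that
    meet the arc at one discontinuity meet the arcs at all the others within a
    time that is small with respect to q_n, since partial products of the jumps
    are far from 1. *)
Lemma discontinuities_aligned (j0 j : 'I_m.+1) :
  tends0 (fun n => dist_int ((q n)%:R * (beta j - beta j0))).
Proof.
move=> eps0 eps00; wlog [th [th0 th4 the]] : / exists th : R, [/\ 0 < th, th <= 4^-1 & 3 * th <= eps0].
  move=> H; apply: H; exists (Num.min 4^-1 (eps0 / 3)); split.
  - by rewrite lt_min; apply/andP; split; lra.
  - by rewrite ge_min lexx.
  - have : Num.min 4^-1 (eps0 / 3) <= eps0 / 3 by rewrite ge_min lexx orbT.
    by move=> h; lra.
have [d d0 hd] := partial_sums_gap.
(* Two values of g at distance less than d / 4 from 1 cannot differ by a factor at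
   distance d from 1. *)
pose lam := d / 4; have lam0 : 0 < lam by rewrite /lam; lra.
have kap0 : 0 < lam * th ^+ 2 / 2 by rewrite divr_gt0// mulr_gt0// exprn_gt0.
have [r r0 hr] := udist_translation_continuous uf kap0.
pose N := (Num.truncn (th^-1 + th / r)).+1.
exists N => n Nn; rewrite ger0_norm ?dist_int_ge0//.
have n0 : (0 < n)%N by exact: leq_ltn_trans Nn.
have qbig : th^-1 + th / r < (q n)%:R.
  apply: (lt_le_trans (truncnS_gt _)); rewrite ler_nat.
  exact: leq_trans Nn (cf_denominator_ge_id alpha_itv alpha_irr n).
have thr : 0 < th / r by rewrite divr_gt0.
have thV : 0 < th^-1 by rewrite invr_gt0.
have qth : 1 <= th * (q n)%:R.
  by rewrite -ler_pdivrMl// mulr1; lra.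
pose u := th / (q n)%:R.
have u0 : 0 < u by rewrite divr_gt0.
have ur : `|u| <= r.
  rewrite gtr0_norm// /u ler_pdivrMr// mulrC -ler_pdivrMr//; lra.
pose L := Num.truncn (th * (q n)%:R).
have /andP[L1 L2] := truncn_itv (ltW (mulr_gt0 th0 (qR n))); rewrite -/L in L1 L2.
have Lq : (2 * L + 2 <= q n)%N.
  by rewrite -(ler_nat R) natrD natrM; nra.
have uq : u <= (2 * (q n)%:R)^-1.
  by rewrite /u invfM ler_pM2r ?invr_gt0//; lra.
have u01 : 0 <= u <= 1.
  rewrite ltW//= (le_trans uq)// invf_le1 ?mulr_gt0//.
  by have := cf_denominatorR_ge1 alpha_itv alpha_irr n; lra.
pose g x := f (x + u) / f x.
have ug : unim g by apply: unim_div => //; exact: unim_shift.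
have u1 : unim (fun=> 1 : R[i]) by apply: unim_cst; exact: cabs1.
have kap : udist g (fun=> 1) <= lam * th ^+ 2 / 2.
  have := hr u ur; rewrite -(udist_mulr _ _ (unimV uf)); apply: le_trans.
  rewrite le_eqVlt; apply/orP; left; apply/eqP; congr udist; apply/funext => x.
  by rewrite mulfV// unim_neq0.
have cG : circ (fun x => cabs (g x - 1)) by exact: circ_cabsB.
pose hit x := chi u (x + L%:R * alpha - beta j0).
have chit : circ hit.
  by rewrite /hit; under eq_fun do rewrite -addrA; exact: circ_shift (circ_chi u).
(* The orbit of x meets the arc at beta_j0 at time L, in the middle of a window of
   length about 2 th q_n; W measures how far g is from 1 along this window. *)
pose W x := \sum_(0 <= i < (2 * L).+2) hit x * cabs (g (x + i%:R * alpha) - 1).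
have cW1 i : circ (fun x => hit x * cabs (g (x + i%:R * alpha) - 1)).
  by apply: circM => //; exact: (circ_shift _ cG).
have cW : circ W by exact: circ_sum.
have cC i : circ (fun x => chi u (x + (L%:R - i%:R) * alpha - beta j0)).
  by under eq_fun do rewrite -addrA; exact: circ_shift (circ_chi u).
have IW : cint W <= lam * th ^+ 2 / 2.
  rewrite cint_sum//.
  have E i : cint (fun x => hit x * cabs (g (x + i%:R * alpha) - 1)) =
      cint (fun x => chi u (x + (L%:R - i%:R) * alpha - beta j0) * cabs (g x - 1)).
    rewrite -[RHS](cint_shift (i%:R * alpha)); last exact: circM.
    congr cint; apply/funext => x; rewrite /hit; congr (chi u _ * _); ring.
  under eq_bigr do rewrite E.
  rewrite -cint_sum; last by move=> i _; exact: circM.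
  apply: le_trans kap; apply: le_cint => //.
    by apply: circ_sum => i _; exact: circM.
  move=> x; rewrite -mulr_suml ler_piMl ?cabs_ge0//.
  apply: sum_chi_separated_le1 => // i l /andP[_ iL] /andP[_ lL] il.
  have -> : x + (L%:R - i%:R) * alpha - beta j0 - (x + (L%:R - l%:R) * alpha - beta j0) =
     l%:R * alpha - i%:R * alpha by ring.
  apply: (orbit_separated n0 uq); first by rewrite eq_sym.
  - by rewrite (leq_trans lL)// (leq_trans _ (leq_addl _ _)) // -addn2.
  - by rewrite (leq_trans iL)// (leq_trans _ (leq_addl _ _)) // -addn2.
pose Dx x := lam * L.+1%:R * hit x - W x.
have cD : circ Dx by apply: circB => //; exact: circZ.
have Ihit : cint hit = u.
  have := @cint_chi R 1 u (L%:R * alpha - beta j0) isT (ltW u0).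
  under eq_fun do rewrite mul1r addrA; exact.
have D0 : 0 < cint Dx.
  rewrite cintB//; last exact: circZ.
  rewrite cintZ// Ihit subr_gt0; apply: (le_lt_trans IW).
  have : th ^+ 2 < L.+1%:R * u.
    by rewrite /u mulrA ltr_pdivlMr// expr2 -mulrA mulrC ltr_pM2r.
  by rewrite -mulrA; have := exprn_gt0 2 th0; nra.
have [x hx xD] := ae_exists cD D0 (translate_ratio u).
have W0 : 0 <= W x.
  apply: sumr_ge0 => i _; rewrite mulr_ge0 ?cabs_ge0//.
  by have /andP[] := chi_itv (x + L%:R * alpha - beta j0) u01.
have [hit0|hit1] : hit x = 0 \/ hit x = 1.
  by have [[]|[]] := chi_cases (x + L%:R * alpha - beta j0) u01; [left|right].
  by move: xD; rewrite /Dx hit0 mulr0; lra.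
have Wlt : \sum_(0 <= i < (2 * L).+2) cabs (g (x + i%:R * alpha) - 1) < lam * L.+1%:R.
  move: xD; rewrite /Dx hit1 mulr1 subr_gt0; apply: le_lt_trans.
  by rewrite /W; under [leRHS]eq_bigr do rewrite hit1 mul1r.
have find A B : (A <= B <= (2 * L).+2)%N -> (B - A = L.+1)%N ->
    exists2 i, (A <= i < B)%N & cabs (g (x + i%:R * alpha) - 1) < lam.
  move=> /andP[AB BL] BA; apply: contrapT => none.
  have : lam * L.+1%:R <= \sum_(A <= i < B) cabs (g (x + i%:R * alpha) - 1).
    rewrite -BA mulr_natr -sumr_const_nat big_nat [leRHS]big_nat; apply: ler_sum => i iAB.
    by rewrite leNgt; apply/negP => h; apply: none; exists i.
  have : \sum_(A <= i < B) cabs (g (x + i%:R * alpha) - 1) <=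
      \sum_(0 <= i < (2 * L).+2) cabs (g (x + i%:R * alpha) - 1).
    apply: (@le_trans _ _ (\sum_(0 <= i < B) cabs (g (x + i%:R * alpha) - 1))).
      by apply: le_sum_nat_nonneg => i; exact: cabs_ge0.
    by rewrite [leRHS](big_cat_nat (leq0n B) BL) /= lerDl sumr_ge0// => i _; exact: cabs_ge0.
  lra.
have halves l : [/\ (0 <= l.+1 <= (2 * l).+2)%N, (l.+1 - 0 = l.+1)%N,
    (l.+1 <= (2 * l).+2 <= (2 * l).+2)%N & ((2 * l).+2 - l.+1 = l.+1)%N].
  by clear; split; lia.
have [A1 A2 B1 B2] := halves L.
have [i1 /andP[_ i1L] hi1] := find 0%N L.+1 A1 A2.
have [i2 /andP[Li2 i2L] hi2] := find L.+1 (2 * L).+2 B1 B2.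
have i12 : (i1 <= i2)%N by exact: leq_trans (ltnW i1L) Li2.
have within i l : (i1 <= i < i2)%N -> (i1 <= l < i2)%N -> (i < l + q n)%N.
  by clear -i2L Lq; lia.
have Lin : (i1 <= L < i2)%N by rewrite -ltnS i1L.
clear A1 A2 B1 B2.
have rel := hx i1 i2 i12; rewrite -/(g (x + i2%:R * alpha)) -/(g (x + i1%:R * alpha)) in rel.
pose cnt k := \sum_(i1 <= l < i2) chi u (x + l%:R * alpha - beta k).
have cntP k : (cnt k = 0 /\ forall l, (i1 <= l < i2)%N -> chi u (x + l%:R * alpha - beta k) = 0) \/
   (cnt k = 1 /\ exists2 l, (i1 <= l < i2)%N & chi u (x + l%:R * alpha - beta k) = 1).
  apply: (sum_chi_separated (pos := fun l => x + l%:R * alpha - beta k)) => // i l iI lI il.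
  have -> : x + i%:R * alpha - beta k - (x + l%:R * alpha - beta k) =
    i%:R * alpha - l%:R * alpha by ring.
  by apply: (orbit_separated n0 uq) => //; exact: within.
pose J : {set 'I_m.+1} := [set k | cnt k == 1]%SET.
have sumJ : \sum_k s k * cnt k = \sum_(k in J) s k.
  rewrite [RHS]big_mkcond; apply: eq_bigr => k _; rewrite finset.inE.
  by have [[-> _]|[-> _]] := cntP k; rewrite ?eqxx ?mulr1// eq_sym oner_eq0 mulr0.
have JT : J = [set: 'I_m.+1]%SET.
  apply: contrapT => JnT.
  have J0 : J != finset.set0.
    apply/set0Pn; exists j0; rewrite finset.inE; have [[_ z]|[-> _]] := cntP j0; last exact: eqxx.
    by have := z L Lin; rewrite -/(hit x) hit1 => /eqP; rewrite oner_eq0.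
  have Jp : J \proper [set: 'I_m.+1]%SET by rewrite finset.properEneq finset.subsetT andbT; apply/eqP.
  have := hd J J0 Jp; rewrite -sumJ.
  have gE : cabs (e (\sum_k s k * cnt k) - 1) = cabs (g (x + i2%:R * alpha) - g (x + i1%:R * alpha)).
    have -> : g (x + i2%:R * alpha) - g (x + i1%:R * alpha) =
        g (x + i1%:R * alpha) * (e (\sum_k s k * cnt k) - 1).
      by rewrite rel mulrBr mulr1.
    by rewrite Normc.normcM (unim_cabs _ ug) mul1r.
  rewrite gE; have := cabsB_triangle (g (x + i2%:R * alpha)) 1 (g (x + i1%:R * alpha)).
  by rewrite (cabsBC 1) /lam in hi1 hi2 *; lra.
have : j \in J by rewrite JT finset.in_setT.
rewrite finset.inE => /eqP cj; have [[c0 _]|[_ [l lI cl]]] := cntP j.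
  by move: cj; rewrite c0 => /eqP; rewrite eq_sym oner_eq0.
have near : dist_int ((x + l%:R * alpha - beta j) - (x + L%:R * alpha - beta j0)) < u.
  by apply: (chi_separated u01); rewrite ?cl -/(hit x) ?hit1 oner_eq0.
have -> : (q n)%:R * (beta j - beta j0) = (l%:Z - L%:Z)%:~R * ((q n)%:R * alpha) -
    (q n)%:R * ((x + l%:R * alpha - beta j) - (x + L%:R * alpha - beta j0)).
  by rewrite intrB -!pmulrn; ring.
apply: (le_trans (dist_intD _ _)); rewrite dist_intN.
have B1 : dist_int ((l%:Z - L%:Z)%:~R * ((q n)%:R * alpha)) <= 2 * th.
  apply: (le_trans (dist_intMz _ _)).
  have dq := dist_int_cf_denominator alpha_itv alpha_irr n.
  have lL : `|(l%:Z - L%:Z)%:~R| <= L.+1%:R :> R.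
    by rewrite -intr_norm pmulrn ler_int; clear -lI i2L; lia.
  have d1 : delta n <= (q n)%:R^-1.
    apply: (le_trans (cf_delta_le alpha_itv alpha_irr n)).
    by rewrite lef_pV2 ?posrE// ler_nat leq_cf_denominatorS.
  apply: (@le_trans _ _ (L.+1%:R * (q n)%:R^-1)).
    by apply: ler_pM => //; [exact: dist_int_ge0|exact: le_trans dq d1].
  by rewrite ler_pdivrMr// -natr1; lra.
have B2 : dist_int ((q n)%:R * (x + l%:R * alpha - beta j - (x + L%:R * alpha - beta j0))) <= th.
  apply: (le_trans (dist_intMn _ _)).
  apply: (@le_trans _ _ ((q n)%:R * u)); first by rewrite ler_pM2l// ltW.
  by rewrite /u mulrC divfK// gt_eqF.
lra.
Qed.

End necessity.

(** * Birkhoff sums of sawtooth combinations *)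
(* For a negative length, chi w is minus the indicator function of an arc of length
   |w|; this treats both orientations together. *)
Section signed_arcs.
Context {R : realType}.
Implicit Types (w y c : R).

Lemma chiN w y : chi (- w) y = - chi w (y - w).
Proof. by rewrite /chi subrK; ring. Qed.

Lemma chi_signed w y : `|w| <= 1 ->
  chi w y = 0 \/ (chi w y = (-1) ^+ (w < 0)%R /\ dist_int y <= 2 * `|w|).
Proof.
case: (ltrP w 0) => [w0|w0]; last first.
  rewrite ger0_norm// => w1; have w01 : 0 <= w <= 1 by rewrite w0.
  have [[-> _]|[E _]] := chi_cases y w01; [by left|right; rewrite expr0; split => //].
  by have := chi_dist w01 (y := y); rewrite E oner_eq0 => /(_ isT); lra.
rewrite ltr0_norm// => w1; have w01 : 0 <= - w <= 1 by lra.
rewrite -(opprK w) chiN; have [[-> _]|[E _]] := chi_cases (y - - w) w01.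
  by left; rewrite oppr0.
right; rewrite E expr1 !opprK; split => //.
have := chi_dist w01 (y := y - - w); rewrite E oner_eq0 => /(_ isT).
have := dist_intD (y - - w) (- w); rewrite subrK.
have := dist_int_normr (- w); rewrite gtr0_norm; last lra.
lra.
Qed.

Lemma chi_signed_separated w y y' : `|w| <= 1 -> chi w y != 0 -> chi w y' != 0 ->
  dist_int (y - y') < `|w|.
Proof.
case: (ltrP w 0) => [w0|w0]; last first.
  by rewrite ger0_norm// => w1; apply: chi_separated; rewrite w0.
rewrite ltr0_norm// => w1; have w01 : 0 <= - w <= 1 by lra.
have E v : chi w v = - chi (- w) (v - - w) by rewrite -chiN opprK.
rewrite !E !oppr_eq0 => h h'; have -> : y - y' = y - - w - (y' - - w) by ring.
exact: chi_separated.
Qed.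

Lemma circ_chi_shift w c : circ (fun x : R => chi w (x + c)).
Proof. exact: circ_shift (circ_chi w). Qed.

Lemma cint_chi_shift w c : cint (fun x => chi w (x + c)) = w.
Proof.
have E (v d : R) : 0 <= v -> cint (fun x => chi v (x + d)) = v.
  by move=> v0; have := @cint_chi R 1 v d isT v0; under eq_fun do rewrite mul1r.
have [w0|w0] := ltrP w 0; last exact: E.
rewrite -{1}(opprK w); under eq_fun do rewrite chiN -addrA.
by rewrite cintN ?E ?opprK//; [lra|exact: circ_chi_shift].
Qed.

Lemma cint_chi_norm w c : `|w| <= 1 -> cint (fun x => `|chi w (x + c)|) = `|w|.
Proof.
move=> w1; have [w0|w0] := ltrP w 0; last first.
  rewrite ger0_norm// -{2}(cint_chi_shift w c); congr cint; apply/funext => x.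
  have [->|[-> _]] := chi_signed (x + c) w1; first by rewrite normr0.
  by rewrite ltNge w0 /= expr0 normr1.
rewrite ltr0_norm// -{2}(cint_chi_shift w c) -cintN; last exact: circ_chi_shift.
congr cint; apply/funext => x; have [->|[-> _]] := chi_signed (x + c) w1.
  by rewrite normr0 oppr0.
by rewrite w0 expr1 normrN normr1 opprK.
Qed.

End signed_arcs.

Section birkhoff.
Context {R : realType} (alpha : R).
Implicit Types (x y : R).
Variables (I : finType) (s beta : I -> R) (b0 : R) (K : I -> int) (tau : I -> R).
Hypothesis s0 : \sum_j s j = 0.
Hypothesis tauE : forall j, beta j - b0 - (K j)%:~R * alpha - tau j \is a Num.int.

Lemma trans_chi (k : int) (M : nat) (om y : R) : M%:R * alpha - om \is a Num.int ->
  trans alpha k y - trans alpha k (y + M%:R * alpha) =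
  zsum (fun i => chi om (y - (i + 1)%:~R * alpha)) k - k%:~R * om.
Proof.
move=> /intrP[l hl]; rewrite /trans -zsumB -zsum_cst -zsumB; apply: eq_zsum => i _.
rewrite /chi addrK; congr (_ - _).
have -> : y + M%:R * alpha - (i + 1)%:~R * alpha = y - (i + 1)%:~R * alpha + om + l%:~R.
  by rewrite -hl; ring.
exact: psiDz.
Qed.

(** Moving each discontinuity to a point of the orbit of b0 turns the sum into a
    coboundary, up to an integer-valued error that counts the visits to the short
    intervals between the discontinuities and these points. *)
Lemma birkhoff_saw_trans (M : nat) x :
  \sum_(0 <= i < M) saw s beta (x + i%:R * alpha) =
  \sum_j s j * (trans alpha (K j) (x - b0) - trans alpha (K j) (x - b0 + M%:R * alpha)) +
  \sum_j s j * \sum_(0 <= i < M) chi (tau j) (x - b0 + (i%:Z - K j)%:~R * alpha - tau j)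
  - \sum_j s j * (M%:R * tau j).
Proof.
pose Psi k := \sum_(0 <= i < k) psi (x - b0 + i%:R * alpha).
have main (k : nat) j : \sum_(0 <= i < k) psi (x + i%:R * alpha - beta j) = Psi k +
    (trans alpha (K j) (x - b0) - trans alpha (K j) (x - b0 + k%:R * alpha)) +
    \sum_(0 <= i < k) chi (tau j) (x - b0 + (i%:Z - K j)%:~R * alpha - tau j) - k%:R * tau j.
  rewrite /Psi; elim: k => [|k IH].
    by rewrite !big_geq// !mul0r !addr0 subrr !(addr0, subr0).
  rewrite !big_nat_recr//= IH -natr1.
  have /intrP[l hl] := tauE j.
  have -> : x + k%:R * alpha - beta j = x - b0 + (k%:Z - K j)%:~R * alpha - tau j + (- l)%:~R.
    by rewrite mulrNz -hl intrB -!pmulrn; ring.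
  rewrite psiDz; set Sm := \sum_(0 <= i < k) chi _ _; rewrite /chi subrK.
  have := trans_coboundary alpha (K j) (x - b0 + k%:R * alpha).
  rewrite (_ : x - b0 + k%:R * alpha - (K j)%:~R * alpha = x - b0 + (k%:Z - K j)%:~R * alpha); last first.
    by rewrite intrB -!pmulrn; ring.
  rewrite (_ : x - b0 + k%:R * alpha + alpha = x - b0 + (k%:R + 1) * alpha); last by ring.
  set T1 := trans _ _ (_ + (_ + 1) * _); set T2 := trans _ _ (_ + _ * _).
  by move=> h; rewrite -[T1](subKr T2) h; ring.
rewrite /saw exchange_big /=; under eq_bigr do rewrite -mulr_sumr main.
have : Psi M * \sum_j s j = 0 by rewrite s0 mulr0.
rewrite mulr_sumr => sP; rewrite -[RHS]add0r -[X in _ = X + _]sP -big_split -sumrB -big_split /=.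
by apply: eq_bigr => j _; ring.
Qed.

(** The transfer functions are sums of sawtooths, so their increment along M alpha
    counts the visits of a piece of orbit to an arc of length om. *)
Lemma birkhoff_saw_chi (M : nat) (om x : R) : M%:R * alpha - om \is a Num.int ->
  \sum_(0 <= i < M) saw s beta (x + i%:R * alpha) =
  \sum_j s j * zsum (fun i => chi om (x - b0 - (i + 1)%:~R * alpha)) (K j) +
  \sum_j s j * \sum_(0 <= i < M) chi (tau j) (x - b0 + (i%:Z - K j)%:~R * alpha - tau j)
  - \sum_j s j * ((K j)%:~R * om + M%:R * tau j).
Proof.
move=> hom; rewrite birkhoff_saw_trans; under eq_bigr do rewrite (trans_chi _ _ hom) mulrBr.
rewrite sumrB; under [X in _ = _ - X]eq_bigr do rewrite mulrDr.
rewrite big_split /=; ring.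
Qed.

Lemma circ_visits (M : nat) j :
  circ (fun x => \sum_(0 <= i < M) `|chi (tau j) (x - b0 + (i%:Z - K j)%:~R * alpha - tau j)|).
Proof.
apply: circ_sum => i _; apply: circ_norm.
by under eq_fun do rewrite -!addrA; exact: circ_chi_shift.
Qed.

Lemma cint_visits (M : nat) j : `|tau j| <= 1 ->
  cint (fun x => \sum_(0 <= i < M) `|chi (tau j) (x - b0 + (i%:Z - K j)%:~R * alpha - tau j)|)
  = M%:R * `|tau j|.
Proof.
move=> t1; rewrite cint_sum; last first.
  by move=> i _; apply: circ_norm; under eq_fun do rewrite -!addrA; exact: circ_chi_shift.
under eq_bigr => i _.
  under eq_fun do rewrite -!addrA.
  rewrite cint_chi_norm//; over.
by rewrite sumr_const_nat subn0 mulr_natl.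
Qed.

End birkhoff.

(** * Summability of the coefficients *)
Section product.
Context {R : realType}.
Local Notation cabs := Normc.normc.

Lemma chi_near (w y : R) : 0 <= w <= 1 -> dist_int y < w / 2 -> chi w (y - w / 2) = 1.
Proof.
move=> w01; rewrite /dist_int; set k := nearest_int y => /ltr_normlP[h1 h2].
have E : frac (y - w / 2) = y - w / 2 - (k - 1)%:~R.
  by apply: fracE; rewrite intrB; lra.
by apply: chi_eq1; [lra|rewrite E intrB; lra].
Qed.

(** When at most one factor differs from 1, the product is at least as far from 1
    as that factor; the number of pairs of factors that differ from 1 dominates
    the other cases. *)
Lemma product_trichotomy (d : R) (u : nat -> R[i]) (L E : nat -> R) (A B : nat) :
  0 < d -> (A <= B)%N -> (forall n, E n = 0 \/ E n = 1) -> (forall n, E n = 0 -> u n = 1) ->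
  (forall n, d * L n <= cabs (u n - 1)) ->
  let k := \sum_(A <= n < B) E n in
  let pairs := \sum_(A <= n < B) \sum_(A <= l < n) E n * E l in
  let v := \prod_(A <= n < B) u n in
  [\/ [/\ k = 0, pairs = 0, v = 1 & \sum_(A <= n < B) L n <= 0],
      [/\ k = 1, pairs = 0 & d * \sum_(A <= n < B) L n <= cabs (v - 1)] |
      2 <= k /\ k <= 2 * pairs].
Proof.
move=> d0 AB E01 u1 Lu; rewrite -(subnKC AB); elim: (B - A)%N => [|r IH] /=.
  by constructor 1; rewrite addn0 !big_geq.
rewrite !addnS !big_nat_recr ?leq_addr//= -mulr_sumr.
set k := \sum_(A <= n < A + r) E n in IH *.
set pairs := \sum_(A <= n < A + r) \sum_(A <= l < n) _ in IH *.
set v := \prod_(A <= n < A + r) u n in IH *.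
have [z|o] := E01 (A + r)%N.
  have Lz : L (A + r)%N <= 0.
    have := Lu (A + r)%N; rewrite (u1 _ z) subrr cabs0; by rewrite pmulr_rle0.
  rewrite z (u1 _ z) mul0r !addr0 mulr1; case: IH => [[h1 h2 h3 h4]|[h1 h2 h3]|h].
  - by constructor 1; split => //; lra.
  - by constructor 2; split => //; apply: le_trans h3; rewrite ler_pM2l//; lra.
  - by constructor 3.
rewrite o mul1r; case: IH => [[h1 h2 h3 h4]|[h1 h2 h3]|[h1 h2]].
- constructor 2; split; [by rewrite h1 add0r|by rewrite h1 h2 addr0|].
  by rewrite h3 mul1r; apply: le_trans (Lu _); rewrite ler_pM2l//; lra.
- by constructor 3; lra.
- by constructor 3; lra.
Qed.

Lemma product_lower_bound (d : R) (u : nat -> R[i]) (L E : nat -> R) (A B : nat) :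
  0 < d -> (A <= B)%N -> (forall n, E n = 0 \/ E n = 1) -> (forall n, E n = 0 -> u n = 1) ->
  (forall n, d * L n <= cabs (u n - 1)) -> (forall n, L n <= 1) ->
  d * (\sum_(A <= n < B) L n - 2 * \sum_(A <= n < B) \sum_(A <= l < n) E n * E l) <=
  cabs (\prod_(A <= n < B) u n - 1).
Proof.
move=> d0 AB E01 u1 Lu L1.
have LE : \sum_(A <= n < B) L n <= \sum_(A <= n < B) E n.
  apply: ler_sum => n _; have [z|->//] := E01 n; rewrite z.
  by have := Lu n; rewrite (u1 _ z) subrr cabs0 pmulr_rle0.
case: (product_trichotomy d0 AB E01 u1 Lu) => [[h1 h2 h3 h4]|[h1 h2 h3]|[h1 h2]].
- by rewrite h2 h3 mulr0 subr0 subrr cabs0 pmulr_rle0.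
- by rewrite h2 mulr0 subr0.
- by apply: le_trans (cabs_ge0 _); rewrite pmulr_rle0//; lra.
Qed.

(** Where all the factors are 1 the product is 1; this identifies a constant that is
    close to the product. *)
Lemma product_const_bound (c : R[i]) (u : nat -> R[i]) (E : nat -> R) (A B : nat) :
  (A <= B)%N -> (forall n, E n = 0 \/ E n = 1) -> (forall n, E n = 0 -> u n = 1) ->
  cabs (1 - c) * (1 - \sum_(A <= n < B) E n) <= cabs (\prod_(A <= n < B) u n - c).
Proof.
move=> AB E01 u1; have c0 := cabs_ge0 (1 - c).
have neg k : 1 <= k -> cabs (1 - c) * (1 - k) <= cabs (\prod_(A <= n < B) u n - c).
  by move=> k1; apply: le_trans (cabs_ge0 _); rewrite mulr_ge0_le0//; lra.
case: (@product_trichotomy 1 u (fun=> 0) E A B ltr01 AB E01 u1) => [n|[h1 h2 h3 h4]|[h1 _ _]|[h1 _]].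
- by rewrite mulr0 cabs_ge0.
- by rewrite h1 h3 subr0 mulr1.
- by apply: neg; rewrite h1.
- by apply: neg; lra.
Qed.

End product.

Section coefficients.
Context {R : realType} (alpha : R).
Hypothesis alpha_itv : 0 < alpha < 1.
Hypothesis alpha_irr : irrational alpha.
Notation mu := (@lebesgue_measure R).

Local Notation q := (cf_denominator alpha).
Local Notation p := (cf_numerator alpha).
Local Notation a := (partial_quotient alpha).
Local Notation delta := (cf_delta alpha).
Local Notation ksum := (ksum alpha).
Local Notation e := e2ipi.
Local Notation cabs := Normc.normc.
Let q0 n : (0 < q n)%N := cf_denominator_gt0 alpha_itv alpha_irr n.
Let qR n : 0 < (q n)%:R :> R := cf_denominatorR_gt0 alpha_itv alpha_irr n.
Let aR n : 0 < (a n.+1)%:R :> R.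
Proof. by rewrite ltr0n (partial_quotient_gt0 alpha_itv alpha_irr). Qed.

Variables (m : nat) (beta s : 'I_m.+1 -> R) (t : R) (f : R -> R[i]).
Hypothesis s0 : \sum_j s j = 0.
Hypothesis uf : unim f.
Hypothesis fE : {ae mu, forall x, e (saw s beta x) = e t * (f x / f (x + alpha))}.

Lemma birkhoff_cobounding : {ae mu, forall x, forall k : nat,
  e (\sum_(0 <= i < k) saw s beta (x + i%:R * alpha)) =
  e (k%:R * t) * (f x / f (x + k%:R * alpha))}.
Proof.
have all : {ae mu, forall x, forall l : nat, e (saw s beta (x + l%:R * alpha)) =
    e t * (f (x + l%:R * alpha) / f (x + l%:R * alpha + alpha))}.
  by apply: ae_forall => l; exact: (ae_shift (l%:R * alpha) fE).
apply: aeS all => x h k; have f1 y : f y != 0 by exact: unim_neq0.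
elim: k => [|k IH]; first by rewrite big_geq// !mul0r addr0 e0 mulfV// mulr1.
rewrite big_nat_recr//= eD IH h -natr1 mulrDl mul1r eD.
rewrite (_ : x + (k%:R + 1) * alpha = x + k%:R * alpha + alpha); last by ring.
by field; rewrite !f1.
Qed.

Lemma unim_birkhoff k : unim (fun x => e (\sum_(0 <= i < k) saw s beta (x + i%:R * alpha))).
Proof.
by apply: unim_e_circ; apply: circ_sum => i _; exact: circ_shift (circ_saw _ _).
Qed.

Lemma udist_birkhoff k :
  udist (fun x => e (\sum_(0 <= i < k) saw s beta (x + i%:R * alpha))) (fun=> e (k%:R * t))
  <= udist (fun x => f (x + k%:R * alpha)) f.
Proof.
have ufk : unim (fun x => f (x + k%:R * alpha)) by exact: unim_shift.
have uc : unim (fun=> e (k%:R * t)) by apply: unim_cst; exact: cabs_e.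
have ud : unim (fun x => f x / f (x + k%:R * alpha)) by exact: unim_div.
have u1 : unim (fun=> 1 : R[i]) by apply: unim_cst; exact: cabs1.
apply: le_trans (udist_triangle (unim_birkhoff k) (unimM uc ud) uc) _.
rewrite (udist_ae (unim_birkhoff k) (unimM uc ud)); last first.
  by apply: aeS birkhoff_cobounding => x; exact.
rewrite add0r; have := udist_mull (fun x => f x / f (x + k%:R * alpha)) (fun=> 1) uc.
under [X in udist _ X]eq_fun do rewrite mulr1.
move=> ->; rewrite -[leRHS](udist_mulr _ _ (unimV ufk)) [leRHS]udistC.
under [X in _ <= udist _ X]eq_fun do rewrite mulfV ?(unim_neq0 _ ufk)//.
by [].
Qed.

(** Iterating the equation k times leaves f / f(. + k alpha), which is close to 1
    when k alpha is close to an integer. *)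
Lemma birkhoff_almost_constant (eps : R) : 0 < eps -> exists2 r : R, 0 < r &
  forall k : nat, dist_int (k%:R * alpha) <= r ->
  udist (fun x => e (\sum_(0 <= i < k) saw s beta (x + i%:R * alpha))) (fun=> e (k%:R * t)) <= eps.
Proof.
move=> e0; have [r r0 hr] := udist_translation_continuous uf e0.
exists r => // k kr; apply: le_trans (udist_birkhoff k) _.
have -> : (fun x => f (x + k%:R * alpha)) =
    (fun x => f (x + (k%:R * alpha - (nearest_int (k%:R * alpha))%:~R))).
  by apply/funext => x; rewrite addrA -mulrNz unim_periodic_intr.
by apply: hr; exact: kr.
Qed.

End coefficients.

Section one_level.
Context {R : realType} (alpha : R).
Hypothesis alpha_itv : 0 < alpha < 1.
Hypothesis alpha_irr : irrational alpha.

Local Notation q := (cf_denominator alpha).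
Local Notation p := (cf_numerator alpha).
Local Notation a := (partial_quotient alpha).
Local Notation delta := (cf_delta alpha).
Local Notation e := e2ipi.
Local Notation cabs := Normc.normc.
Let q0 n : (0 < q n)%N := cf_denominator_gt0 alpha_itv alpha_irr n.
Let qR n : 0 < (q n)%:R :> R := cf_denominatorR_gt0 alpha_itv alpha_irr n.

Definition cf_theta n : R := (-1) ^+ n * delta n.
Local Notation theta := cf_theta.

Lemma norm_cf_theta n : `|theta n| = delta n.
Proof.
by rewrite normrM normrX normrN1 expr1n mul1r gtr0_norm// (cf_delta_gt0 alpha_itv alpha_irr).
Qed.

Lemma cf_theta_int n : (q n)%:R * alpha - theta n \is a Num.int.
Proof. by rewrite (cf_thetaE alpha n) addrK intr_int. Qed.

Lemma cf_delta_le1 n : delta n <= 1.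
Proof.
apply: (le_trans (cf_delta_le alpha_itv alpha_irr n)).
by rewrite invf_le1// (cf_denominatorR_ge1 alpha_itv alpha_irr).
Qed.

(** Multiplication by q_n maps a piece of orbit of length k to a set of diameter at
    most k delta_n. *)
Lemma dist_int_orbit (n : nat) (k : int) (z r : R) : dist_int z <= r ->
  dist_int ((q n)%:R * (z + k%:~R * alpha)) <= (q n)%:R * r + `|k%:~R| * delta n.
Proof.
move=> zr; rewrite mulrDr; apply: (le_trans (dist_intD _ _)); apply: lerD.
  by apply: (le_trans (dist_intMn _ _)); rewrite ler_pM2l.
rewrite mulrCA; apply: (le_trans (dist_intMz _ _)).
by rewrite ler_wpM2l// (dist_int_cf_denominator alpha_itv alpha_irr).
Qed.

Variables (m : nat) (s : 'I_m.+1 -> R) (b0 : R) (j0 : 'I_m.+1).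
Variables (K : 'I_m.+1 -> int) (tau : 'I_m.+1 -> R) (n : nat) (d : R).
Hypothesis d0 : 0 < d.
Hypothesis hd : forall J : {set 'I_m.+1}, J != finset.set0 -> J \proper [set: 'I_m.+1]%SET ->
  d <= cabs (e (\sum_(j in J) s j) - 1).
Hypothesis K0 : K j0 = 0.
Hypothesis Ksmall : forall j, 2 * `|K j| < (q n.+1)%:Z.
Hypothesis tau1 : forall j, `|tau j| <= 1.

(** The Birkhoff sum of length q_n counts, up to a constant, visits to arcs of length
    delta_n by orbit segments of length |K_j|, and visits to the much shorter
    intervals between beta_j and the orbit of b0. *)
Definition near_visits j x : R := zsum (fun i => chi (theta n) (x - b0 - (i + 1)%:~R * alpha)) (K j).
Definition far_visits j x : R :=
  \sum_(0 <= i < q n) `|chi (tau j) (x - b0 + (i%:Z - K j)%:~R * alpha - tau j)|.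
Definition level_factor x : R[i] := e (\sum_j s j * near_visits j x +
  \sum_j s j * \sum_(0 <= i < q n) chi (tau j) (x - b0 + (i%:Z - K j)%:~R * alpha - tau j)).

Let th1 : `|theta n| <= 1. Proof. by rewrite norm_cf_theta cf_delta_le1. Qed.

(** An orbit of length less than q_(n+1) meets an arc of length delta_n at most
    once, and the discontinuities whose arcs are crossed at this visit form a
    non-empty proper subset of the set of all discontinuities. *)
Lemma near_visits_single x : (forall j, near_visits j x = 0) \/
  (exists2 J : {set 'I_m.+1}, (J != finset.set0) && (J \proper [set: 'I_m.+1]%SET) &
    (forall j, `|near_visits j x| <= 1) /\
    (\sum_j s j * near_visits j x = \sum_(j in J) s j \/
     \sum_j s j * near_visits j x = - \sum_(j in J) s j)).
Proof.
pose u (i : int) := chi (theta n) (x - b0 - (i + 1)%:~R * alpha).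
have [none|/existsNP[j1 nz]] := pselect (forall j, near_visits j x = 0); first by left.
right; have [l lK ul] : exists2 l : int, `|l| <= `|K j1| & u l != 0.
  apply: contrapT => no; apply: nz; rewrite /near_visits (@eq_zsum _ _ (fun=> 0)) ?zsum_cst ?mulr0//.
  by move=> i iK; apply/eqP; rewrite -/(u i) -[_ == _]negbK; apply/negP => h; apply: no; exists i.
have uniq j i : `|i| <= `|K j| -> i != l -> u i = 0.
  move=> iK il; apply/eqP; rewrite -[_ == _]negbK; apply/negP => ui.
  have := chi_signed_separated th1 ui ul; rewrite norm_cf_theta ltNge => /negP; apply.
  have -> : x - b0 - (i + 1)%:~R * alpha - (x - b0 - (l + 1)%:~R * alpha) = (l - i)%:~R * alpha.
    by rewrite !intrD intrN; ring.
  apply: (dist_int_best_approximation alpha_itv alpha_irr); first by rewrite subr_eq0 eq_sym.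
  have := Ksmall j; have := Ksmall j1; have := ler_normB l i; clear -lK iK; lia.
have Z j : near_visits j x = ((l < K j)%R%:R - (l < 0)%R%:R) * u l.
  by rewrite /near_visits (zsum_single (l := l))//; exact: uniq.
have [//|[ulE _]] := chi_signed (x - b0 - (l + 1)%:~R * alpha) th1; first by move=> h; rewrite /u h eqxx in ul.
rewrite -/(u l) in ulE.
have Z1 j : `|near_visits j x| <= 1.
  rewrite Z ulE normrM normrX normrN1 expr1n mulr1.
  by case: (l < K j); case: (l < 0); rewrite ?subrr ?subr0 ?sub0r ?normrN ?normr0 ?normr1 ?ler01.
pose J : {set 'I_m.+1} := [set j | near_visits j x != 0]%SET.
have Jn j : (j \in J) = (near_visits j x != 0) by rewrite finset.inE.
exists J.
  apply/andP; split; first by apply/set0Pn; exists j1; rewrite Jn; apply/eqP.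
  rewrite finset.properEneq finset.subsetT andbT; apply/eqP => JT.
  have : j0 \in J by rewrite JT finset.in_setT.
  by rewrite Jn Z K0 subrr mul0r eqxx.
split => //.
have [sg|sg] : (forall j, near_visits j x = (j \in J)%:R) \/ (forall j, near_visits j x = - (j \in J)%:R).
- case: (ltrP l 0) => l0; case: (ltrP (theta n) 0) => t0;
    [left|right|right|left] => j; rewrite Jn Z ulE ?t0 ?l0 ?(ltNge l) ?(ltNge (theta n)) ?t0 ?l0 /= ?expr1 ?expr0;
    by case: (K j <= l) => /=; rewrite ?subrr ?subr0 ?sub0r ?mul0r ?mulr1 ?mul1r ?mulrNN ?mulr1 ?eqxx ?oppr0 ?oppr_eq0 ?oner_eq0.
- left; rewrite [RHS]big_mkcond /=; apply: eq_bigr => j _; rewrite sg.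
  by case: (j \in J); rewrite ?mulr1 ?mulr0.
- right; rewrite [in RHS]big_mkcond -sumrN /=; apply: eq_bigr => j _; rewrite sg.
  by case: (j \in J); rewrite ?mulrN ?mulr1 ?mulr0 ?oppr0.
Qed.

Lemma far_visits_ge0 j x : 0 <= far_visits j x.
Proof. by apply: sumr_ge0. Qed.

Lemma far_visits_zero j x : far_visits j x < 1 ->
  \sum_(0 <= i < q n) chi (tau j) (x - b0 + (i%:Z - K j)%:~R * alpha - tau j) = 0.
Proof.
move=> h; rewrite big_nat big1// => i iq.
have [//|[E _]] := chi_signed (x - b0 + (i%:Z - K j)%:~R * alpha - tau j) (tau1 j).
exfalso; move: h; rewrite /far_visits (bigD1_seq i) ?mem_index_iota ?iota_uniq//= E.
rewrite normrX normrN1 expr1n ltNge => /negP; apply; rewrite lerDl; exact: sumr_ge0.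
Qed.

(** In the absence of far visits, the factor is 1 or, up to conjugation, e of a
    proper partial sum of the s_j. With a far visit, the left hand side is at most
    0. *)
Lemma level_factor_lower x :
  d * (m.+1%:R^-1 * (\sum_j `|near_visits j x|) - \sum_j far_visits j x) <= cabs (level_factor x - 1).
Proof.
have m0 : 0 < m.+1%:R :> R by rewrite ltr0n.
have V0 : 0 <= \sum_j far_visits j x by apply: sumr_ge0 => j _; exact: far_visits_ge0.
have N1 : m.+1%:R^-1 * (\sum_j `|near_visits j x|) <= 1.
  rewrite ler_pdivrMl// mulr1 -[leRHS]mulr1 mulr_natl -[X in _ *+ X]card_ord -sumr_const.
  apply: ler_sum => j _; case: (near_visits_single x) => [->|[J _ [-> //]]].
  by rewrite normr0 ler01.
have [V1|V1] := lerP 1 (\sum_j far_visits j x).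
  by apply: le_trans (cabs_ge0 _); rewrite pmulr_rle0// subr_le0 (le_trans N1).
have far j : \sum_(0 <= i < q n) chi (tau j) (x - b0 + (i%:Z - K j)%:~R * alpha - tau j) = 0.
  apply: far_visits_zero; apply: le_lt_trans V1; rewrite (bigD1 j)//= lerDl.
  by apply: sumr_ge0 => k _; exact: far_visits_ge0.
rewrite /level_factor [X in e (_ + X)]big1 ?addr0; last by move=> j _; rewrite far mulr0.
case: (near_visits_single x) => [z|[J /andP[J0 JT] [_ zE]]].
  have -> : \sum_j `|near_visits j x| = 0 by apply: big1 => j _; rewrite z normr0.
  rewrite mulr0 sub0r.
  by apply: le_trans (cabs_ge0 _); rewrite pmulr_rle0// oppr_le0.
have hJ := hd J0 JT; have h1 : d * (m.+1%:R^-1 * (\sum_j `|near_visits j x|) - \sum_j far_visits j x) <= d.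
  by rewrite -[leRHS]mulr1 ler_pM2l// (le_trans _ N1)// gerBl.
suff -> : cabs (e (\sum_j s j * near_visits j x) - 1) = cabs (e (\sum_(j in J) s j) - 1).
  exact: le_trans h1 hJ.
case: zE => -> //; rewrite eN.
have E0 := e_neq0 (\sum_(j in J) s j).
have -> : (e (\sum_(j in J) s j))^-1 - 1 = - (e (- \sum_(j in J) s j) * (e (\sum_(j in J) s j) - 1)).
  by rewrite eN mulrBr mulVf// mulr1 opprB.
by rewrite cabsN Normc.normcM cabs_e mul1r.
Qed.

(** The factor differs from 1 only if q_n (x - b0) is close to an integer, even
    after the translation of x along a short piece of orbit. *)
Lemma level_factor_support (k : nat) x (B T : R) :
  (forall j, `|(K j)%:~R| <= B) -> (forall j, `|tau j| <= T) ->
  level_factor (x + k%:R * alpha) != 1 ->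
  dist_int ((q n)%:R * (x - b0)) <= (3 * (q n)%:R + B + 1 + k%:R) * delta n + 3 * (q n)%:R * T.
Proof.
move=> KB tT; apply: contraNle => big.
have dn := cf_delta_gt0 alpha_itv alpha_irr n.
have B0 : 0 <= B by exact: le_trans (normr_ge0 _) (KB j0).
have T0 : 0 <= T by exact: le_trans (normr_ge0 _) (tT j0).
have k0 : 0 <= k%:R :> R by exact: ler0n.
have qT : 0 <= (q n)%:R * T by rewrite mulr_ge0// ltW.
have nearz j : near_visits j (x + k%:R * alpha) = 0.
  rewrite /near_visits (@eq_zsum _ _ (fun=> 0)) ?zsum_cst ?mulr0// => i iK.
  have [//|[_ close]] := chi_signed (x + k%:R * alpha - b0 - (i + 1)%:~R * alpha) th1.
  exfalso; move: big; rewrite ltNge => /negP; apply.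
  rewrite norm_cf_theta in close.
  have := dist_int_orbit n (i + 1 - k%:Z) close.
  rewrite (_ : x + k%:R * alpha - b0 - (i + 1)%:~R * alpha + (i + 1 - k%:Z)%:~R * alpha = x - b0); last first.
    by rewrite intrB intrD -!pmulrn; ring.
  move=> h; apply: (le_trans h).
  have : `|(i + 1 - k%:Z)%:~R| <= B + 1 + k%:R :> R.
    apply: (@le_trans _ _ (`|K j|%:~R + 1 + k%:R)); last by rewrite !lerD2r intr_norm.
    by rewrite -intr_norm pmulrn -(intrD _ _ 1) -intrD ler_int; clear -iK; lia.
  by move=> h2; have := qR n; nra.
have farz j : \sum_(0 <= i < q n)
    chi (tau j) (x + k%:R * alpha - b0 + (i%:Z - K j)%:~R * alpha - tau j) = 0.
  rewrite big_nat big1// => i /andP[_ iq].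
  have [//|[_ close]] := chi_signed (x + k%:R * alpha - b0 + (i%:Z - K j)%:~R * alpha - tau j) (tau1 j).
  exfalso; move: big; rewrite ltNge => /negP; apply.
  have close' : dist_int (x + k%:R * alpha - b0 + (i%:Z - K j)%:~R * alpha) <= 3 * T.
    rewrite -(subrK (tau j) (x + _ - _ + _)); apply: (le_trans (dist_intD _ _)).
    by have := dist_int_normr (tau j); have := tT j; lra.
  have := dist_int_orbit n (K j - i%:Z - k%:Z) close'.
  rewrite (_ : x + k%:R * alpha - b0 + (i%:Z - K j)%:~R * alpha + (K j - i%:Z - k%:Z)%:~R * alpha = x - b0); last first.
    by rewrite !intrB -!pmulrn; ring.
  move=> h; apply: (le_trans h).
  have : `|(K j - i%:Z - k%:Z)%:~R| <= B + (q n)%:R + k%:R :> R.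
    apply: (@le_trans _ _ (`|K j|%:~R + (q n)%:R + k%:R)); last by rewrite !lerD2r intr_norm.
    by rewrite -intr_norm !pmulrn -!intrD ler_int; clear -iq; lia.
  by move=> h2; have := qR n; nra.
apply/eqP; rewrite /level_factor -[RHS]e0; congr e.
by rewrite !big1 ?addr0// => j _; rewrite ?nearz ?farz mulr0.
Qed.

End one_level.

Section summable_coefficients.
Context {R : realType} (alpha : R).
Hypothesis alpha_itv : 0 < alpha < 1.
Hypothesis alpha_irr : irrational alpha.
Notation mu := (@lebesgue_measure R).

Local Notation q := (cf_denominator alpha).
Local Notation p := (cf_numerator alpha).
Local Notation a := (partial_quotient alpha).
Local Notation delta := (cf_delta alpha).
Local Notation ksum := (ksum alpha).
Local Notation ksum_norm := (ksum_norm alpha).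
Local Notation e := e2ipi.
Local Notation cabs := Normc.normc.
Let q0 n : (0 < q n)%N := cf_denominator_gt0 alpha_itv alpha_irr n.
Let qR n : 0 < (q n)%:R :> R := cf_denominatorR_gt0 alpha_itv alpha_irr n.
Let aR n : 0 < (a n.+1)%:R :> R.
Proof. by rewrite ltr0n (partial_quotient_gt0 alpha_itv alpha_irr). Qed.

Variables (m : nat) (beta : 'I_m.+1 -> R) (j0 : 'I_m.+1) (b : 'I_m.+1 -> nat -> int).
Hypothesis b_j0 : forall n, b j0 n = 0.
Hypothesis b_lim : forall j,
  tends0 (fun n => dist_int ((ksum (b j) n)%:~R * alpha - (beta j - beta j0))).

Definition coef_sum n : R := \sum_j `|(b j n)%:~R|.
(** Of the order of the measure of the set where the factor of level n differs
    from 1. *)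
Definition coef_density n : R := coef_sum n / (a n.+1)%:R.

Lemma coef_sum_ge0 n : 0 <= coef_sum n. Proof. exact: sumr_ge0. Qed.

Lemma coef_density_ge0 n : 0 <= coef_density n.
Proof. by rewrite divr_ge0 ?coef_sum_ge0. Qed.

Lemma coef_le_sum j n : `|(b j n)%:~R| <= coef_sum n.
Proof. by rewrite /coef_sum (bigD1 j)//= lerDl sumr_ge0. Qed.

Variables (rho : R) (n0 : nat).
Hypothesis rho0 : 0 < rho.
Hypothesis rho_small : rho <= (64 * m.+1%:R ^+ 2)^-1.
Hypothesis density_le : forall n, (n0 <= n)%N -> coef_density n <= rho.
Hypothesis ksum_norm_le : forall n, (n0 <= n)%N -> \sum_j ksum_norm (b j) n <= rho * (q n)%:R.

Let rho64 : rho <= 64^-1.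
Proof.
apply: (le_trans rho_small); rewrite lef_pV2 ?posrE//.
by rewrite -[leLHS]mulr1 ler_pM2l// -natrX ler1n expn_gt0.
Qed.

Definition active n : bool := (n0 <= n)%N && [exists j, b j n != 0].

Lemma active_ge n : active n -> (n0 <= n)%N. Proof. by case/andP. Qed.

Lemma active_coef n : active n -> 1 <= coef_sum n.
Proof.
move=> /andP[_ /existsP[j bj]]; apply: le_trans (coef_le_sum j n).
by rewrite -intr_norm ler1z; move: bj; clear; lia.
Qed.

Lemma inactive_coef n : (n0 <= n)%N -> ~~ active n -> coef_sum n = 0.
Proof.
rewrite /active => -> /existsPn h; apply: big1 => j _.
by have := h j; rewrite negbK => /eqP ->; rewrite normr0.
Qed.

Lemma coef_sumE n : coef_sum n = coef_density n * (a n.+1)%:R.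
Proof. by rewrite /coef_density divfK// gt_eqF. Qed.

Lemma active_density n : active n -> (a n.+1)%:R^-1 <= coef_density n.
Proof. by move=> /active_coef h; rewrite /coef_density; apply: ler_peMl; rewrite // invr_ge0. Qed.

(** A nonzero coefficient of small density forces a large partial quotient. *)
Lemma active_growth n : active n -> (q n)%:R <= rho * (q n.+1)%:R.
Proof.
move=> an; have := active_coef an; have := density_le (active_ge an).
have : (a n.+1 * q n)%:R <= (q n.+1)%:R :> R by rewrite ler_nat leq_partial_quotientM.
rewrite natrM coef_sumE => h1 h2 h3.
apply: (@le_trans _ _ (rho * ((a n.+1)%:R * (q n)%:R))); last by rewrite ler_pM2l.
rewrite mulrA; apply: ler_peMl; first exact: ltW.
by apply: (le_trans h3); rewrite ler_pM2r.
Qed.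

Definition orbit_gap n j : R :=
  let r := beta j - beta j0 - (ksum (b j) n)%:~R * alpha in r - (nearest_int r)%:~R.

Lemma orbit_gapE n j : beta j - beta j0 - (ksum (b j) n)%:~R * alpha - orbit_gap n j \is a Num.int.
Proof. by rewrite /orbit_gap subKr intr_int. Qed.

Lemma orbit_gap_le n j : (n0 <= n)%N -> `|orbit_gap n j| <= rho * (4 / (q n)%:R).
Proof.
move=> nn; rewrite /orbit_gap -/(dist_int _) -dist_intN opprB.
apply: (ksum_tail alpha_itv alpha_irr (b_lim j)) => l nl.
apply: le_trans (density_le (leq_trans nn nl)).
by rewrite ler_pM2r ?invr_gt0//; exact: coef_le_sum.
Qed.

Lemma orbit_gap_le1 n j : (n0 <= n)%N -> `|orbit_gap n j| <= 1.
Proof.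
move=> nn; apply: (le_trans (orbit_gap_le j nn)).
rewrite mulrA ler_pdivrMr// mul1r.
by have := cf_denominatorR_ge1 alpha_itv alpha_irr n; have := rho64; lra.
Qed.

Lemma ksum_j0 n : ksum (b j0) n = 0.
Proof. by rewrite /ksum big1// => l _; rewrite b_j0 mul0r. Qed.

Lemma ksum_norm_le1 n j : (n0 <= n)%N -> ksum_norm (b j) n <= rho * (q n)%:R.
Proof.
move=> nn; apply: le_trans (ksum_norm_le nn); rewrite (bigD1 j)//= lerDl.
by apply: sumr_ge0 => k _; exact: ksum_norm_ge0.
Qed.

Lemma ksumS_le n j : (n0 <= n)%N ->
  `|(ksum (b j) n.+1)%:~R| <= (coef_sum n + rho) * (q n)%:R :> R.
Proof.
move=> nn; rewrite ksumS intrD intrM; apply: (le_trans (ler_normD _ _)).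
rewrite mulrDl addrC normrM -pmulrn normr_nat; apply: lerD.
  by rewrite ler_pM2r// coef_le_sum.
exact: le_trans (ksum_le _ _ _) (ksum_norm_le1 j nn).
Qed.

Lemma coef_sum_q n : (n0 <= n)%N -> coef_sum n * (q n)%:R <= rho * (q n.+1)%:R.
Proof.
move=> nn; rewrite coef_sumE -mulrA.
have : (a n.+1 * q n)%:R <= (q n.+1)%:R :> R by rewrite ler_nat leq_partial_quotientM.
rewrite natrM => h; apply: ler_pM => //; [exact: coef_density_ge0|exact: density_le].
Qed.

Lemma ksumS_small n j : (n0 <= n)%N -> 2 * `|ksum (b j) n.+1| < (q n.+1)%:Z.
Proof.
move=> nn; rewrite -(ltr_int R) intrM intr_norm -pmulrn.
have h1 := ksumS_le j nn; have h2 := coef_sum_q nn.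
have h3 : (q n)%:R <= (q n.+1)%:R :> R by rewrite ler_nat leq_cf_denominatorS.
have h4 : rho * (q n)%:R <= rho * (q n.+1)%:R by rewrite ler_pM2l.
have h5 : rho * (q n.+1)%:R <= 64^-1 * (q n.+1)%:R by rewrite ler_pM2r.
by have := qR n.+1; rewrite mulrDl in h1; lra.
Qed.

Variables (s : 'I_m.+1 -> R) (d : R).
Hypothesis s0 : \sum_j s j = 0.
Hypothesis d0 : 0 < d.
Hypothesis hd : forall J : {set 'I_m.+1}, J != finset.set0 -> J \proper [set: 'I_m.+1]%SET ->
  d <= cabs (e (\sum_(j in J) s j) - 1).

(** The Birkhoff sum over time N splits into blocks of length q_n, one for each active
    level, the block of level n starting at [time n]. *)
Definition gap n : nat := if active n then q n else 0%N.
Definition time n : nat := \sum_(n0 <= l < n) gap l.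
Local Notation K n := (fun j => ksum (b j) n.+1).
Local Notation tau n := (orbit_gap n.+1).
Definition factor n x : R[i] :=
  if active n then level_factor alpha s (beta j0) (K n) (tau n) n (x + (time n)%:R * alpha) else 1.
Definition lower n x : R := if active n then
  m.+1%:R^-1 * (\sum_j `|near_visits alpha (beta j0) (K n) n j (x + (time n)%:R * alpha)|) -
  \sum_j far_visits alpha (beta j0) (K n) (tau n) n j (x + (time n)%:R * alpha) else 0.
(** An arc at scale 1/q_n that contains the support of the factor; the constant 30
    leaves room for the shifts of the blocks and for the far visits. *)
Definition width n : R := if active n then 30 * coef_density n else 0.
Definition ind n x : R := chi (width n) ((q n)%:R * x + (- (q n)%:R * beta j0 - width n / 2)).

Let m0 : 0 < m.+1%:R :> R. Proof. by rewrite ltr0n. Qed.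

Lemma time_le n : (time n)%:R <= 3 * (q n)%:R :> R.
Proof.
rewrite -natrM ler_nat; apply: leq_trans (sum_cf_denominator alpha_itv alpha_irr n).
rewrite big_nat_recr//=; apply: leq_trans (leq_addr _ _).
have [nn|nn] := leqP n0 n; last by rewrite /time big_geq// ltnW.
rewrite (big_cat_nat (leq0n n0) nn) /=; apply: leq_trans (leq_addl _ _).
by apply: leq_sum => l _; rewrite /gap; case: ifP.
Qed.

Lemma width_itv n : 0 <= width n <= 1.
Proof.
rewrite /width; case: ifP => [/active_ge/density_le h|_]; last by rewrite lexx ler01.
by have := coef_density_ge0 n; have := rho64; lra.
Qed.

Lemma widthE n : (n0 <= n)%N -> width n = 30 * coef_density n.
Proof.
rewrite /width; case: ifPn => // an nn.
by rewrite /coef_density (inactive_coef nn an) mul0r mulr0.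
Qed.

Lemma ind01 n x : ind n x = 0 \/ ind n x = 1.
Proof. by rewrite /ind; have [[->]|[->]] := chi_cases ((q n)%:R * x + (- (q n)%:R * beta j0 - width n / 2)) (width_itv n); [left|right]. Qed.

Lemma circ_ind n : circ (ind n). Proof. exact: circ_chi_affine. Qed.

Lemma cint_ind n : cint (ind n) = width n.
Proof. by rewrite /ind cint_chi//; case/andP: (width_itv n). Qed.

Lemma lower_le n x : d * lower n x <= cabs (factor n x - 1).
Proof.
rewrite /lower /factor; case: ifP => [/active_ge nn|_]; last by rewrite mulr0 cabs_ge0.
apply: level_factor_lower hd _ _ _ _ => //.
- exact: ksum_j0.
- by move=> j; exact: ksumS_small.
- by move=> j; apply: orbit_gap_le1; exact: leqW.
Qed.

Lemma lower_le1 n x : lower n x <= 1.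
Proof.
rewrite /lower; case: ifP => [/active_ge nn|_]; last exact: ler01.
rewrite lerBlDr -[leLHS]addr0; apply: lerD; last by apply: sumr_ge0 => j _; exact: far_visits_ge0.
rewrite ler_pdivrMl// mulr1 -[leRHS]mulr1 [leRHS]mulr_natl -[X in _ <= _ *+ X]card_ord -[leRHS]sumr_const.
apply: ler_sum => j _.
have := @near_visits_single _ _ alpha_itv alpha_irr m s (beta j0) j0 (K n) n.
by move=> /(_ (ksum_j0 _) (fun j => ksumS_small j nn) (x + (time n)%:R * alpha)) [->|[J _ [-> //]]]; rewrite normr0 ler01.
Qed.

(** The blocks start after a time at most 3 q_n, so the shifts move q_n x by at most
    3 q_n delta_n, which is smaller than the width. *)
Lemma factor_ind n x : ind n x = 0 -> factor n x = 1.
Proof.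
rewrite /factor; case: ifPn => // an i0; have nn := active_ge an.
apply/eqP; rewrite -[_ == _]negbK; apply/negP => ne; move: i0; suff -> : ind n x = 1.
  by move/eqP; rewrite oner_eq0.
have aV := active_density an; have B1 := active_coef an.
have aB : coef_sum n * (a n.+1)%:R^-1 = coef_density n by [].
have := @level_factor_support _ _ alpha_itv alpha_irr m s (beta j0) j0 (K n) (tau n) n
  (fun j => orbit_gap_le1 j (leqW nn)) (time n) x ((coef_sum n + rho) * (q n)%:R)
  (rho * (4 / (q n.+1)%:R)) (fun j => ksumS_le j nn) (fun j => orbit_gap_le j (leqW nn)) ne.
move=> close; rewrite /ind addrA mulNr -mulrBr; apply: chi_near; first exact: width_itv.
apply: (le_lt_trans close); rewrite /width an.
have t3 := time_le n; have q1 := cf_denominatorR_ge1 alpha_itv alpha_irr n.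
have dn := cf_delta_gt0 alpha_itv alpha_irr n.
have r64 := rho64.
have h1 : (3 * (q n)%:R + (coef_sum n + rho) * (q n)%:R + 1 + (time n)%:R) * delta n <=
    9 * coef_sum n * ((q n)%:R * delta n).
  rewrite mulrA ler_pM2r//; nra.
have h2 : 9 * coef_sum n * ((q n)%:R * delta n) <= 9 * coef_sum n * (a n.+1)%:R^-1.
  apply: ler_wpM2l; first by lra.
  exact: delta_le_a.
have h3 : 3 * (q n)%:R * (rho * (4 / (q n.+1)%:R)) <= (a n.+1)%:R^-1.
  have : (a n.+1 * q n)%:R <= (q n.+1)%:R :> R by rewrite ler_nat leq_partial_quotientM.
  rewrite natrM => h.
  rewrite !mulrA ler_pdivrMr// [leRHS]mulrC ler_pdivlMr//.
  by have := aR n; have := qR n; have := mulr_gt0 (aR n) (qR n); nra.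
have := coef_density_ge0 n; have ap : 0 < (a n.+1)%:R^-1 :> R by rewrite invr_gt0.
have h4 : 9 * coef_sum n * (a n.+1)%:R^-1 = 9 * coef_density n by rewrite -aB mulrA.
rewrite h4 in h2; lra.
Qed.

Lemma circ_near n j : circ (fun x => near_visits alpha (beta j0) (K n) n j (x + (time n)%:R * alpha)).
Proof.
rewrite /near_visits; apply: circ_zsum => i.
by under eq_fun do rewrite -!addrA; exact: circ_chi_shift.
Qed.

Lemma circ_far n j :
  circ (fun x => far_visits alpha (beta j0) (K n) (tau n) n j (x + (time n)%:R * alpha)).
Proof.
apply: (@circ_shift _ (far_visits alpha (beta j0) (K n) (tau n) n j)); exact: circ_visits.
Qed.

Lemma circ_lower n : circ (lower n).
Proof.
rewrite /lower; case: active; last exact: circ_cst.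
apply: circB; first by apply: circZ; apply: circ_sum => j _; exact: circ_norm (circ_near n j).
by apply: circ_sum => j _; exact: circ_far.
Qed.

Lemma cint_near n j : `|(ksum (b j) n.+1)%:~R| * delta n <=
  cint (fun x => `|near_visits alpha (beta j0) (K n) n j (x + (time n)%:R * alpha)|).
Proof.
apply: le_trans (cint_norm (circ_near n j)).
rewrite -(norm_cf_theta alpha_itv alpha_irr) -normrM.
suff -> : cint (fun x => near_visits alpha (beta j0) (K n) n j (x + (time n)%:R * alpha)) =
  (ksum (b j) n.+1)%:~R * cf_theta alpha n by [].
have Z k : cint (fun x => zsum (fun i => chi (cf_theta alpha n)
    (x + (time n)%:R * alpha - beta j0 - (i + 1)%:~R * alpha)) k) = k%:~R * cf_theta alpha n.
  have C i : circ (fun x => chi (cf_theta alpha n)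
      (x + (time n)%:R * alpha - beta j0 - (i + 1)%:~R * alpha)).
    by under eq_fun do rewrite -!addrA; exact: circ_chi_shift.
  have I i : cint (fun x => chi (cf_theta alpha n)
      (x + (time n)%:R * alpha - beta j0 - (i + 1)%:~R * alpha)) = cf_theta alpha n.
    by under eq_fun do rewrite -!addrA; exact: cint_chi_shift.
  rewrite -zsum_cst; symmetry; move: k; apply: zsum_unique.
    by under eq_fun do rewrite zsum0; rewrite cint_cst.
  move=> k; under eq_fun do rewrite zsumS.
  by rewrite cintD// ?I//; exact: circ_zsum.
exact: Z.
Qed.

(** Each K_j is close to b_n q_n, so the near visits have measure of the order of
    the density, and the far visits are negligible since their intervals are
    controlled by the coefficients of the higher levels. *)
Lemma cint_lower n : (n0 <= n)%N ->
  coef_density n / (16 * m.+1%:R) <= cint (lower n).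
Proof.
move=> nn; rewrite /lower; have [an|an] := boolP (active n); last first.
  by rewrite /coef_density (inactive_coef nn an) !mul0r cint_cst.
have cn j := circ_norm (circ_near n j).
have cN : circ (fun x => \sum_j `|near_visits alpha (beta j0) (K n) n j (x + (time n)%:R * alpha)|).
  by apply: circ_sum => j _; exact: cn.
have cF : circ (fun x => \sum_j far_visits alpha (beta j0) (K n) (tau n) n j (x + (time n)%:R * alpha)).
  by apply: circ_sum => j _; exact: circ_far.
rewrite cintB//; last exact: circZ.
rewrite cintZ//.
have -> : cint (fun x => \sum_j `|near_visits alpha (beta j0) (K n) n j (x + (time n)%:R * alpha)|) =
    \sum_j cint (fun x => `|near_visits alpha (beta j0) (K n) n j (x + (time n)%:R * alpha)|).
  by apply: cint_sum => j _; exact: cn.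
have -> : cint (fun x => \sum_j far_visits alpha (beta j0) (K n) (tau n) n j (x + (time n)%:R * alpha)) =
    \sum_j cint (fun x => far_visits alpha (beta j0) (K n) (tau n) n j (x + (time n)%:R * alpha)).
  by apply: cint_sum => j _; exact: circ_far.
have far : \sum_j cint (fun x => far_visits alpha (beta j0) (K n) (tau n) n j (x + (time n)%:R * alpha))
    <= m.+1%:R * (4 * rho * coef_density n).
  have -> : m.+1%:R * (4 * rho * coef_density n) = \sum_(j < m.+1) (4 * rho * coef_density n).
    by rewrite sumr_const card_ord mulr_natl.
  apply: ler_sum => j _.
  rewrite (@cint_shift _ (far_visits alpha (beta j0) (K n) (tau n) n j)); last exact: circ_visits.
  rewrite cint_visits ?orbit_gap_le1 ?leqW//.
  apply: (@le_trans _ _ ((q n)%:R * (rho * (4 / (q n.+1)%:R)))).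
    by rewrite ler_pM2l// orbit_gap_le// leqW.
  apply: (@le_trans _ _ (4 * rho * (a n.+1)%:R^-1)); last first.
    by rewrite ler_pM2l ?active_density// mulr_gt0.
  rewrite (_ : _ * (_ * _) = 4 * rho * ((q n)%:R / (q n.+1)%:R)); last by ring.
  rewrite ler_pM2l ?mulr_gt0// ler_pdivrMr// [leRHS]mulrC ler_pdivlMr// [leLHS]mulrC -natrM ler_nat.
  exact: leq_partial_quotientM.
have near : coef_density n / 8 <= \sum_j cint (fun x =>
    `|near_visits alpha (beta j0) (K n) n j (x + (time n)%:R * alpha)|).
  apply: (@le_trans _ _ (\sum_j `|(ksum (b j) n.+1)%:~R| * delta n)); last first.
    by apply: ler_sum => j _; exact: cint_near.
  have B1 := active_coef an.
  apply: (@le_trans _ _ (coef_sum n * (q n)%:R / 2 * delta n)).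
    have := cf_delta_ge alpha_itv alpha_irr n.
    have : (q n.+1)%:R <= 2 * ((a n.+1)%:R * (q n)%:R) :> R.
      by rewrite -!natrM ler_nat leq_cf_denominator_double.
    move=> h1 h2; have qa : 0 < (a n.+1)%:R * (q n)%:R :> R by rewrite mulr_gt0.
    have h3 : (2 * ((a n.+1)%:R * (q n)%:R))^-1 <= (q n.+1)%:R^-1 :> R.
      by rewrite lef_pV2 ?posrE ?mulr_gt0.
    have h4 : (a n.+1)%:R^-1 <= 4 * ((q n)%:R * delta n) :> R.
      have -> : (a n.+1)%:R^-1 = 2 * (q n)%:R * (2 * ((a n.+1)%:R * (q n)%:R))^-1 :> R.
        by field; rewrite !gt_eqF.
      by have := qR n; nra.
    rewrite /coef_density; have : coef_sum n * (a n.+1)%:R^-1 <= coef_sum n * (4 * ((q n)%:R * delta n)).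
      by rewrite ler_wpM2l// coef_sum_ge0.
    lra.
  rewrite -mulr_suml ler_pM2r ?(cf_delta_gt0 alpha_itv alpha_irr)//.
  have h : coef_sum n * (q n)%:R - rho * (q n)%:R <= \sum_j `|(ksum (b j) n.+1)%:~R|.
    apply: (@le_trans _ _ (coef_sum n * (q n)%:R - \sum_j ksum_norm (b j) n)).
      by rewrite lerD2l lerN2 ksum_norm_le.
    rewrite mulr_suml -sumrB; apply: ler_sum => j _.
    have := ler_normB (ksum (b j) n.+1)%:~R ((ksum (b j) n)%:~R : R).
    rewrite ksumS intrD [X in `|X - _|]addrC addrK intrM normrM -[(q n)%:~R]pmulrn normr_nat.
    by have := ksum_le alpha (b j) n; lra.
  by have := rho64; have := qR n; nra.
have r1 : rho * m.+1%:R ^+ 2 <= 64^-1.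
  have m2 : 0 < m.+1%:R ^+ 2 :> R by rewrite exprn_gt0.
  by move: rho_small; rewrite invfM ler_pdivlMr.
have p0 := coef_density_ge0 n.
rewrite invfM mulrA ler_pdivrMr//.
set A := \sum_j cint _ in near *; set B := \sum_j cint _ in far *.
have -> : (m.+1%:R^-1 * A - B) * m.+1%:R = A - B * m.+1%:R.
  by rewrite mulrBl mulrC mulVKf// gt_eqF.
have : B * m.+1%:R <= m.+1%:R * (4 * rho * coef_density n) * m.+1%:R by rewrite ler_pM2r.
have -> : m.+1%:R * (4 * rho * coef_density n) * m.+1%:R = 4 * (rho * m.+1%:R ^+ 2) * coef_density n.
  by rewrite expr2; ring.
have : rho * m.+1%:R ^+ 2 * coef_density n <= 64^-1 * coef_density n by rewrite ler_wpM2r.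
lra.
Qed.

(** The indicator functions at two levels are almost independent; the error is small
    because q_l is small compared to q_(l+1) at an active level l. *)
Lemma cint_pair n l : (l < n)%N ->
  cint (fun x => ind n x * ind l x) <=
  width n * width l + 4 * rho * width n * ((q l.+1)%:R / (q n)%:R).
Proof.
move=> ln; have [/andP[wn _] /andP[wl _]] := (width_itv n, width_itv l).
have qq : 0 <= (q l.+1)%:R / (q n)%:R :> R by rewrite divr_ge0.
have [al|nal] := boolP (active l); last first.
  have -> : (fun x => ind n x * ind l x) = fun=> 0.
    have wl0 : width l = 0 by rewrite /width (negbTE nal).
    by apply/funext => x; rewrite {2}/ind wl0 /chi !addr0 subrr mulr0.
  by rewrite cint_cst addr_ge0 ?mulr_ge0// ltW.
have := @cint_chi_decorrelation _ (ind l) (4 * (q l)%:R) (q n) (width n)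
  (- (q n)%:R * beta j0 - width n / 2) (circ_ind l) (L1lip_chi _ _ (q0 l)) (q0 n) wn.
rewrite -/(ind n _) => /ler_normlP[_].
have -> : cint (fun x => ind l x * (chi (width n) ((q n)%:R * x + (- (q n)%:R * beta j0 - width n / 2)) - width n)) =
    cint (fun x => ind n x * ind l x) - width n * width l.
  rewrite -(cint_ind l) -cintZ; last exact: circ_ind.
  rewrite -cintB; [|by apply: circM; exact: circ_ind|by apply: circZ; exact: circ_ind].
  by congr cint; apply/funext => x; rewrite /ind; ring.
have g := active_growth al.
have : 4 * (q l)%:R * width n / (q n)%:R <= 4 * rho * width n * ((q l.+1)%:R / (q n)%:R).
  rewrite mulrA ler_pM2r ?invr_gt0//.
  have : width n * (q l)%:R <= width n * (rho * (q l.+1)%:R) by rewrite ler_wpM2l.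
  by move=> h; lra.
lra.
Qed.

Lemma dist_time N : dist_int ((time N)%:R * alpha) <= 4 / (q n0)%:R.
Proof.
have z : dist_int (0 : R) = 0 := dist_int_int 0.
apply: le_trans (sum_cf_denominatorV alpha_itv alpha_irr n0 N).
rewrite /time; have [h|h] := leqP N n0.
  by rewrite !big_geq// mul0r z.
rewrite natr_sum mulr_suml.
elim/big_rec2: _ => [|l x y _ IH]; first by rewrite z.
apply: (le_trans (dist_intD _ _)); apply: lerD => //.
rewrite /gap; case: ifP => _; last first.
  by rewrite mul0r z invr_ge0.
apply: (le_trans (dist_int_cf_denominator alpha_itv alpha_irr l)).
apply: (le_trans (cf_delta_le alpha_itv alpha_irr l)).
by rewrite lef_pV2 ?posrE// ler_nat leq_cf_denominatorS.
Qed.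

Lemma factor_prod N : (n0 <= N)%N -> exists2 c, cabs c = 1 & forall x,
  \prod_(n0 <= n < N) factor n x =
  c * e (\sum_(0 <= i < time N) saw s beta (x + i%:R * alpha)).
Proof.
move=> /subnKC <-; elim: (N - n0)%N => [|r [c c1 IH]].
  exists 1; first exact: cabs1.
  by move=> x; rewrite addn0 /time !big_geq// e0 mulr1.
rewrite addnS; set n := (n0 + r)%N in IH *.
have nn : (n0 <= n)%N by exact: leq_addr.
have tS : time n.+1 = (time n + gap n)%N by rewrite /time big_nat_recr.
have split x : \sum_(0 <= i < time n.+1) saw s beta (x + i%:R * alpha) =
    \sum_(0 <= i < time n) saw s beta (x + i%:R * alpha) +
    \sum_(0 <= i < gap n) saw s beta (x + (time n)%:R * alpha + i%:R * alpha).
  rewrite tS (big_cat_nat (leq0n _) (leq_addr _ _)) /=; congr (_ + _).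
  rewrite -{1}[time n]add0n big_addn addKn; apply: eq_bigr => i _.
  by rewrite natrD; congr saw; ring.
rewrite /gap in split; move: split; case: ifPn => an split; last first.
  exists c => // x; rewrite big_nat_recr//= IH split (big_geq (leqnn 0)) addr0.
  by rewrite /factor (negbTE an) mulr1.
pose C := - \sum_j s j * ((ksum (b j) n.+1)%:~R * cf_theta alpha n + (q n)%:R * orbit_gap n.+1 j).
exists (c * e (- C)); first by rewrite Normc.normcM c1 cabs_e mul1r.
move=> x; rewrite big_nat_recr//= IH split eD -!mulrA; congr (_ * _).
rewrite (birkhoff_saw_chi s0 (fun j => orbit_gapE n.+1 j) _ (cf_theta_int alpha n)).
rewrite [RHS]mulrCA; congr (_ * _); rewrite /factor an -eD; congr e.
by rewrite /C opprK addrCA subrr addr0.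
Qed.

Lemma unim_level_factor n : unim (factor n).
Proof.
rewrite /factor; case: active; last by apply: unim_cst; exact: cabs1.
apply: (@unim_shift _ (level_factor alpha s (beta j0) (K n) (tau n) n)).
apply: unim_e_circ; apply: circD; apply: circ_sum => j _; apply: circZ.
  by apply: circ_zsum => i; under eq_fun do rewrite -!addrA; exact: circ_chi_shift.
by apply: circ_sum => i _; under eq_fun do rewrite -!addrA; exact: circ_chi_shift.
Qed.

(** The visits at the different levels are almost independent, so the product of
    the factors would be far from constant if the densities had a large sum. *)
Lemma density_sum_bound (N : nat) (kappa : R) (c : R[i]) : (n0 <= N)%N -> cabs c = 1 ->
  udist (fun x => e (\sum_(0 <= i < time N) saw s beta (x + i%:R * alpha))) (fun=> c) <= kappa ->
  let S := \sum_(n0 <= n < N) coef_density n in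
  60 * S <= 1 ->
  d * (S / (16 * m.+1%:R) - 1800 * S ^+ 2 - 720 * rho * S) <= 3 * kappa.
Proof.
move=> nN c1 kap S S60.
have [z z1 prodE] := factor_prod nN.
pose P x := \prod_(n0 <= n < N) factor n x.
have uP : unim P by apply: unim_prod => n _; exact: unim_level_factor.
have wS : \sum_(n0 <= n < N) width n = 30 * S.
  by rewrite mulr_sumr big_nat [RHS]big_nat; apply: eq_bigr => n /andP[nn _]; rewrite widthE.
have uc w : cabs w = 1 -> unim (fun=> w : R[i]) by exact: unim_cst.
have zc1 : cabs (z * c) = 1 by rewrite Normc.normcM z1 c1 mul1r.
have Pc : udist P (fun=> z * c) <= kappa.
  apply: le_trans kap; rewrite -[leRHS](udist_mull _ _ (uc z z1)) le_eqVlt; apply/orP; left.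
  by apply/eqP; congr udist; apply/funext => x; exact: prodE.
(* At least half of the circle lies outside of all the supports, and there the
   product is 1. *)
have c2 : cabs (1 - z * c) <= 2 * kappa.
  have cI : circ (fun x => cabs (1 - z * c) * (1 - \sum_(n0 <= n < N) ind n x)).
    apply: circZ; apply: circB; [exact: circ_cst|apply: circ_sum => n _; exact: circ_ind].
  have : cint (fun x => cabs (1 - z * c) * (1 - \sum_(n0 <= n < N) ind n x)) <= kappa.
    apply: le_trans Pc; apply: le_cint => //; first by apply: circ_cabsB => //; exact: uc.
    move=> x; apply: product_const_bound => // n; [exact: ind01|exact: factor_ind].
  have csum : circ (fun x => \sum_(n0 <= n < N) ind n x).
    by apply: circ_sum => n _; exact: circ_ind.
  rewrite cintZ; last by apply: circB => //; exact: circ_cst.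
  rewrite cintB//; last exact: circ_cst.
  rewrite cint_cst cint_sum; last by move=> n _; exact: circ_ind.
  under eq_bigr do rewrite cint_ind.
  by rewrite wS => h; have := cabs_ge0 (1 - z * c); nra.
have P1 : udist P (fun=> 1) <= 3 * kappa.
  have := udist_triangle uP (uc _ zc1) (uc _ (@cabs1 R)); rewrite udist_cst cabsBC; lra.
apply: le_trans P1.
pose pairs x := \sum_(n0 <= n < N) \sum_(n0 <= l < n) ind n x * ind l x.
have cpair n l : circ (fun x => ind n x * ind l x) by apply: circM; exact: circ_ind.
have cpairs : circ pairs by apply: circ_sum => n _; apply: circ_sum => l _.
have clow : circ (fun x => \sum_(n0 <= n < N) lower n x).
  by apply: circ_sum => n _; exact: circ_lower.
have c2p : circ (fun x => 2 * pairs x) by exact: circZ.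
apply: (@le_trans _ _ (cint (fun x => d * (\sum_(n0 <= n < N) lower n x - 2 * pairs x)))); last first.
  apply: le_cint; [by apply: circZ; apply: circB|by apply: circ_cabsB => //; exact: uc (@cabs1 R)|].
  move=> x; apply: product_lower_bound => // n;
    [exact: ind01|exact: factor_ind|exact: lower_le|exact: lower_le1].
rewrite cintZ; last exact: circB.
rewrite ler_pM2l// cintB// cint_sum; last by move=> n _; exact: circ_lower.
rewrite cintZ//.
have lowS : S / (16 * m.+1%:R) <= \sum_(n0 <= n < N) cint (lower n).
  rewrite mulr_suml big_nat [leRHS]big_nat; apply: ler_sum => n /andP[nn _].
  exact: cint_lower.
have w0 n : 0 <= width n by case/andP: (width_itv n).
have pairS : cint pairs <= 900 * S ^+ 2 + 360 * rho * S.
  rewrite cint_sum; last by move=> n _; apply: circ_sum => l _.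
  under eq_bigr => n _.
    rewrite cint_sum; last by move=> l _; exact: cpair.
    over.
  apply: (@le_trans _ _ (\sum_(n0 <= n < N) (width n * (30 * S) + 12 * rho * width n))).
    rewrite big_nat [leRHS]big_nat; apply: ler_sum => n /andP[nn nN'].
    apply: (@le_trans _ _ (\sum_(n0 <= l < n) (width n * width l +
        4 * rho * width n * ((q l.+1)%:R / (q n)%:R)))).
      by rewrite big_nat [leRHS]big_nat; apply: ler_sum => l /andP[_ ln]; exact: cint_pair.
    rewrite big_split /= -!mulr_sumr; apply: lerD.
      apply: ler_wpM2l => //; rewrite -wS (big_cat_nat nn (ltnW nN')) /= lerDl.
      exact: sumr_ge0.
    rewrite -mulr_suml (_ : 12 * rho * width n = 4 * rho * width n * 3); last by ring.
    apply: ler_wpM2l; first by rewrite !mulr_ge0// ltW.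
    rewrite ler_pdivrMr// -natr_sum -natrM ler_nat.
    apply: leq_trans (sum_cf_denominator alpha_itv alpha_irr n).
    rewrite big_nat_recl//= (big_cat_nat (leq0n n0) nn) /=.
    by apply: leq_trans (leq_addl _ _); exact: leq_addl.
  rewrite big_split /= -mulr_suml -mulr_sumr wS; lra.
move: lowS pairS; move: (S / _) (cint pairs) (\sum_(_ <= _ < _) _) => X Y Z h1 h2; lra.
Qed.

End summable_coefficients.

Section bootstrap_arithmetic.
Context {R : realFieldType}.

(** The linear term absorbs the quadratic one and the correlations. *)
Lemma quadratic_bootstrap (A D c d eta rho S kappa : R) :
  0 <= A -> 0 < c -> 0 < d -> 0 <= S -> S <= eta ->
  A * eta <= c / 4 -> D * rho <= c / 4 -> 12 * kappa <= d * c * eta ->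
  d * (c * S - A * S ^+ 2 - D * rho * S) <= 3 * kappa -> S <= eta / 2.
Proof.
move=> A0 c0 d0 S0 Se e1 r1 k1 h.
have h1 : A * S ^+ 2 <= c / 4 * S.
  by rewrite expr2 mulrA ler_wpM2r//; apply: le_trans e1; rewrite ler_wpM2l.
have h2 : D * rho * S <= c / 4 * S by rewrite ler_wpM2r.
have h3 : d * (c / 2 * S) <= d * (c * S - A * S ^+ 2 - D * rho * S).
  by rewrite ler_pM2l//; lra.
have h4 : d * c * S <= d * c * (eta / 2) by lra.
by move: h4; rewrite ler_pM2l// mulr_gt0.
Qed.

End bootstrap_arithmetic.

Section necessary_expansions.
Context {R : realType} (alpha : R).
Hypothesis alpha_itv : 0 < alpha < 1.
Hypothesis alpha_irr : irrational alpha.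
Notation mu := (@lebesgue_measure R).

Local Notation q := (cf_denominator alpha).
Local Notation a := (partial_quotient alpha).
Local Notation ksum := (ksum alpha).
Local Notation e := e2ipi.
Local Notation cabs := Normc.normc.
Let qR n : 0 < (q n)%:R :> R := cf_denominatorR_gt0 alpha_itv alpha_irr n.
Let aR n : 0 < (a n.+1)%:R :> R.
Proof. by rewrite ltr0n (partial_quotient_gt0 alpha_itv alpha_irr). Qed.

Variables (m : nat) (beta s : 'I_m.+1 -> R) (t : R) (f : R -> R[i]).
Hypothesis s0 : \sum_j s j = 0.
Hypothesis s_prop : forall J : {set 'I_m.+1}, J != finset.set0 ->
  J \proper [set: 'I_m.+1]%SET -> \sum_(j in J) s j \isn't a Num.int.
Hypothesis uf : unim f.
Hypothesis fE : {ae mu, forall x, e (saw s beta x) = e t * (f x / f (x + alpha))}.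

Lemma tends0_unshift (u : nat -> R) : tends0 (fun n => u n.+1) -> tends0 u.
Proof.
by move=> h eps e0; have [N hN] := h eps e0; exists N.+1 => -[//|n] nN; exact: hN.
Qed.

(** The points are aligned at all large scales, so their differences have
    expansions whose coefficients are small compared to the partial quotients. *)
Lemma aligned_expansions (j0 : 'I_m.+1) : exists b : 'I_m.+1 -> nat -> int,
  [/\ forall n, b j0 n = 0,
      tends0 (coef_density alpha b) &
      forall j, tends0 (fun n => dist_int ((ksum (b j) n)%:~R * alpha - (beta j - beta j0)))].
Proof.
have A0 j : tends0 (fun n => dist_int ((q n)%:R * (beta j - beta j0))) :=
  discontinuities_aligned alpha_itv alpha_irr s0 s_prop uf fE j0 j.
have [b hb] := choice (fun j => expansion alpha_itv alpha_irr (beta j - beta j0)).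
(* For beta_j0 all the distances vanish, hence so do all the coefficients. *)
exists b; split.
- have [h1 _ h3] := hb j0.
  have z n : dist_int ((q n)%:R * (beta j0 - beta j0)) = 0.
    by rewrite subrr mulr0; exact: (dist_int_int 0).
  have int0 (k : int) : `|k%:~R| <= 0 :> R -> k = 0.
    by rewrite normr_le0 intr_eq0 => /eqP.
  case=> [|n]; last by apply: int0; apply: (le_trans (h3 n)); rewrite !z mulr0 !addr0.
  apply: int0; have := h1 0%N; rewrite !z addr0 mul0r ksumS.
  by rewrite /ksum big_geq// add0r mulr1.
- pose D j n := dist_int ((q n)%:R * (beta j - beta j0)).
  have T : tends0 (fun n => \sum_j (D j n.+2 + D j n.+1 + D j n)).
    apply: (@tends0_sum R _ (index_enum 'I_m.+1) (fun j n => D j n.+2 + D j n.+1 + D j n)) => j.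
    apply: tends0D; last exact: A0.
    apply: tends0D; first by have := tends0_shift 2 (A0 j); under eq_fun do rewrite addn2.
    by have := tends0_shift 1 (A0 j); under eq_fun do rewrite addn1.
  apply: tends0_unshift; apply: tends0_le T => n.
  rewrite ger0_norm ?coef_density_ge0// /coef_density /coef_sum mulr_suml; apply: ler_sum => j _.
  have [_ _ /(_ n) h3] := hb j; rewrite ler_pdivrMr//; apply: (le_trans h3).
  rewrite -/(D j n.+2) -/(D j n.+1) -/(D j n).
  have a1 : 1 <= (a n.+2)%:R :> R by rewrite ler1n (partial_quotient_gt0 alpha_itv alpha_irr).
  have d2 : 0 <= D j n.+2 by exact: dist_int_ge0.
  have d0 : 0 <= D j n by exact: dist_int_ge0.
  by rewrite !mulrDl; have := ler_peMr d2 a1; have := ler_peMr d0 a1; lra.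
- move=> j; have [h1 h2 _] := hb j.
  pose D n := dist_int ((q n)%:R * (beta j - beta j0)).
  apply: tends0_unshift.
  have T : tends0 (fun n => D n.+1 + (D n.+1 + D n)).
    have S1 : tends0 (fun n => D n.+1) by have := tends0_shift 1 (A0 j); under eq_fun do rewrite addn1.
    by apply: tends0D => //; apply: tends0D => //; exact: A0.
  apply: tends0_le T => n; rewrite ger0_norm ?dist_int_ge0//.
  by apply: (le_trans (h2 n.+1)); rewrite lerD2l ler_pdivrMr.
Qed.

Variables (j0 : 'I_m.+1) (b : 'I_m.+1 -> nat -> int).
Hypothesis b_j0 : forall n, b j0 n = 0.
Hypothesis b_small : tends0 (coef_density alpha b).
Hypothesis b_lim : forall j,
  tends0 (fun n => dist_int ((ksum (b j) n)%:~R * alpha - (beta j - beta j0))).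

Lemma tends0_coef j : tends0 (fun n => `|(b j n)%:~R| / (a n.+1)%:R : R).
Proof.
apply: tends0_le b_small => n; rewrite ger0_norm ?divr_ge0//.
by rewrite ler_pM2r ?invr_gt0//; exact: coef_le_sum.
Qed.

Lemma ksum_norm_eventually (rho : R) : 0 < rho -> exists n0, forall n, (n0 <= n)%N ->
  \sum_j ksum_norm alpha (b j) n <= rho * (q n)%:R.
Proof.
move=> rho0; have T : tends0 (fun n => \sum_j ksum_norm alpha (b j) n / (q n)%:R).
  apply: (@tends0_sum R _ (index_enum 'I_m.+1) (fun j n => ksum_norm alpha (b j) n / (q n)%:R)) => j.
  exact: ksum_norm_little (tends0_coef j).
have [N hN] := T rho rho0; exists N => n nN.
by rewrite -ler_pdivrMr// mulr_suml; apply: le_trans (hN n nN); exact: ler_norm.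
Qed.

(** The sums of densities satisfy a quadratic inequality, which excludes the values
    between eta/2 and eta, while each density is at most eta/2 from level n0 on. *)
Lemma densities_summable : summ (coef_density alpha b).
Proof.
have [d d0 hd] := partial_sums_gap s_prop.
have m0 : 0 < m.+1%:R :> R by rewrite ltr0n.
have m1 : 1 <= m.+1%:R :> R by rewrite ler1n.
pose c1 : R := (16 * m.+1%:R)^-1.
have c10 : 0 < c1 by rewrite invr_gt0 mulr_gt0.
have [eta [eta0 eta1 eta2]] : exists eta : R, [/\ 0 < eta, 60 * eta <= 1 & 7200 * eta <= c1].
  exists (Num.min 60^-1 (c1 / 7200)); split.
  - by rewrite lt_min; apply/andP; split; lra.
  - have : Num.min 60^-1 (c1 / 7200) <= 60^-1 by rewrite ge_min lexx.
    by move=> h; lra.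
  - have : Num.min 60^-1 (c1 / 7200) <= c1 / 7200 by rewrite ge_min lexx orbT.
    by move=> h; lra.
have [rho [rho0 rho1 rho2 rho3]] : exists rho : R, [/\ 0 < rho,
    rho <= (64 * m.+1%:R ^+ 2)^-1, rho <= eta / 2 & 2880 * rho <= c1].
  set r1 := (64 * _)^-1; have r10 : 0 < r1 by rewrite invr_gt0 mulr_gt0// exprn_gt0.
  exists (Num.min r1 (Num.min (eta / 2) (c1 / 2880))); split.
  - by rewrite !lt_min r10 /=; apply/andP; split; lra.
  - by rewrite ge_min lexx.
  - by rewrite !ge_min lexx !orbT.
  - have : Num.min r1 (Num.min (eta / 2) (c1 / 2880)) <= c1 / 2880.
      by rewrite !ge_min lexx !orbT.
    by move=> h; lra.
pose kap := d * c1 * eta / 12.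
have kap0 : 0 < kap by rewrite divr_gt0// !mulr_gt0.
have [r r0 hr] := birkhoff_almost_constant uf fE kap0.
have [n1 hn1] := b_small rho0.
have [n2 hn2] := ksum_norm_eventually rho0.
pose n3 := (Num.truncn (4 / r)).+1.
pose n0 := maxn (maxn n1 n2) n3.
have density_le n : (n0 <= n)%N -> coef_density alpha b n <= rho.
  by rewrite !geq_max => /andP[/andP[h _] _]; apply: le_trans (hn1 n h); exact: ler_norm.
have norm_le n : (n0 <= n)%N -> \sum_j ksum_norm alpha (b j) n <= rho * (q n)%:R.
  by rewrite !geq_max => /andP[/andP[_ h] _]; exact: hn2.
have q3 : 4 / (q n0)%:R <= r.
  rewrite ler_pdivrMr// mulrC -ler_pdivrMr//; apply: ltW.
  apply: (lt_le_trans (truncnS_gt _)); rewrite ler_nat.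
  apply: leq_trans (cf_denominator_ge_id alpha_itv alpha_irr n0).
  exact: leq_maxr.
have c0 n := coef_density_ge0 alpha b n.
have tail N : \sum_(n0 <= n < N) coef_density alpha b n <= eta / 2.
  apply: bootstrap => [n nn||M MN Seta]; [exact: le_trans (density_le n nn) rho2|exact: ltW|].
  have [Mn|nM] := leqP M n0; first by rewrite big_geq// divr_ge0// ltW.
  have P := density_sum_bound alpha_itv alpha_irr b_j0 b_lim rho0 rho1 density_le norm_le
    s0 d0 hd (ltnW nM) (cabs_e _) (hr _ _).
  have {}P := P (le_trans (dist_time alpha_itv alpha_irr b n0 M) q3).
  move: Seta P => /=; set S := \sum_(_ <= _ < _) _ => Seta.
  have S0 : 0 <= S by apply: sumr_ge0.
  have S60 : 60 * S <= 1 by apply: le_trans eta1; rewrite ler_pM2l.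
  rewrite (_ : S / (16 * m.+1%:R) = c1 * S); last by rewrite mulrC.
  move=> /(_ S60); apply: quadratic_bootstrap c10 d0 S0 Seta _ _ _; [lra|lra|lra|].
  by rewrite /kap mulrC divfK.
exists (\sum_(0 <= n < n0) coef_density alpha b n + eta / 2) => N.
have [Nn|nN] := leqP N n0.
  rewrite [X in X + _](big_cat_nat (leq0n N) Nn) /= -addrA lerDl.
  by apply: addr_ge0; [exact: sumr_ge0|rewrite divr_ge0// ltW].
by rewrite (big_cat_nat (leq0n n0) (ltnW nN)) /= lerD2l.
Qed.

End necessary_expansions.

(** * Means of products of lacunary two-valued functions *)
Section complex_mean.
Context {R : realType}.
Implicit Types (g : R -> R[i]) (h : R -> R).
Local Notation cabs := Normc.normc.
Local Notation e := e2ipi.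

Definition cmean g : R[i] :=
  Complex (cint (fun x => complex.Re (g x))) (cint (fun x => complex.Im (g x))).

Lemma norm_Re_le (z : R[i]) : `|complex.Re z| <= cabs z.
Proof.
rewrite -(ler_pXn2r (n := 2)) ?nnegrE ?cabs_ge0// cabs_sqr real_normK ?num_real//.
by rewrite lerDl sqr_ge0.
Qed.

Lemma norm_Im_le (z : R[i]) : `|complex.Im z| <= cabs z.
Proof.
rewrite -(ler_pXn2r (n := 2)) ?nnegrE ?cabs_ge0// cabs_sqr real_normK ?num_real//.
by rewrite lerDr sqr_ge0.
Qed.

Lemma cmean_cst (z : R[i]) : cmean (fun=> z) = z.
Proof. by rewrite /cmean !cint_cst; case: z. Qed.

Lemma cmean_udist g g' : unim g -> unim g' -> cabs (cmean g - cmean g') <= 2 * udist g g'.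
Proof.
move=> ug ug'; apply: (le_trans (cabs_le_ReIm _)); rewrite /cmean /=.
have half (P P' : R -> R) : circ P -> circ P' ->
    (forall x, `|P x - P' x| <= cabs (g x - g' x)) -> `|cint P - cint P'| <= udist g g'.
  move=> cP cP' h; rewrite -cintB//; apply: (le_trans (cint_norm (circB cP cP'))).
  by apply: le_cint => //; [apply: circ_norm; exact: circB|exact: circ_cabsB].
rewrite mulr2n mulrDl mul1r; apply: lerD.
- apply: half; [exact: circ_Re|exact: circ_Re|].
  by move=> x; apply: le_trans (norm_Re_le _); case: (g x) (g' x) => ? ? [].
- apply: half; [exact: circ_Im|exact: circ_Im|].
  by move=> x; apply: le_trans (norm_Im_le _); case: (g x) (g' x) => ? ? [].
Qed.

(** Perturbing g on an event of probability v that is almost independent of g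
    multiplies the mean by an average of 1 and of the perturbation. *)
Lemma cmean_perturb g h (w : R[i]) (v r : R) : unim g -> circ h ->
  `|cint (fun x => complex.Re (g x) * (h x - v))| <= r ->
  `|cint (fun x => complex.Im (g x) * (h x - v))| <= r ->
  cabs (cmean (fun x => g x * (1 + w * Complex (h x) 0))) <=
  cabs (1 + w * Complex v 0) * cabs (cmean g) + 2 * (cabs w * r).
Proof.
move=> ug ch hr hi; have cr := circ_Re ug; have ci := circ_Im ug.
have chv : circ (fun x => h x - v) by apply: circB => //; exact: circ_cst.
set A' := cint (fun x => complex.Re (g x) * _) in hr.
set B' := cint (fun x => complex.Im (g x) * _) in hi.
have cA : circ (fun x => complex.Re (g x) * (h x - v)) by exact: circM.
have cB : circ (fun x => complex.Im (g x) * (h x - v)) by exact: circM.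
case: w => wr wi; set w := Complex wr wi.
have -> : cmean (fun x => g x * (1 + w * Complex (h x) 0)) =
    (1 + w * Complex v 0) * cmean g + w * Complex A' B'.
  rewrite /cmean.
  have -> : cint (fun x => complex.Re (g x * (1 + w * Complex (h x) 0))) =
     (1 + v * wr) * cint (fun x => complex.Re (g x)) +
     (- (v * wi) * cint (fun x => complex.Im (g x)) + (wr * A' + - wi * B')).
    rewrite /A' /B' -!cintZ// -!cintD//; do ?by [exact: circZ|apply: circD; exact: circZ|apply: circD; [exact: circZ|apply: circD; exact: circZ]].
    congr cint; apply/funext => x; case: (g x) => gr gi /=; ring.
  have -> : cint (fun x => complex.Im (g x * (1 + w * Complex (h x) 0))) =
     (1 + v * wr) * cint (fun x => complex.Im (g x)) +
     (v * wi * cint (fun x => complex.Re (g x)) + (wr * B' + wi * A')).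
    rewrite /A' /B' -!cintZ// -!cintD//; do ?by [exact: circZ|apply: circD; exact: circZ|apply: circD; [exact: circZ|apply: circD; exact: circZ]].
    congr cint; apply/funext => x; case: (g x) => gr gi /=; ring.
  by congr Complex; rewrite /=; ring.
apply: (le_trans (cabsD _ _)); rewrite !Normc.normcM lerD2l mulrCA ler_wpM2l ?cabs_ge0//.
by apply: (le_trans (cabs_le_ReIm _)) => /=; lra.
Qed.

(** A proper average of 1 and of a number z of modulus 1 is smaller than 1. *)
Lemma cabs_average (z : R[i]) (v : R) : cabs z = 1 -> 4^-1 <= v <= 3 / 4 ->
  cabs (1 + (z - 1) * Complex v 0) <= 1 - 3 / 32 * cabs (z - 1) ^+ 2.
Proof.
move=> z1 v14; have x2 : cabs (z - 1) <= 2 by exact: cabs_sub_le2 _ (@cabs1 R).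
have x0 := cabs_ge0 (z - 1).
rewrite -(ler_pXn2r (n := 2)) ?nnegrE ?cabs_ge0//; last by nra.
rewrite [leLHS]cabs_sqr; have h2 := cabs_sqr (z - 1); have h1 := cabs_sqr z; rewrite z1 expr1n in h1.
move: (sqr_ge0 (cabs (z - 1))) h2 h1; move: (cabs (z - 1) ^+ 2) => X; clear z1 x2 x0.
case: z => zr zi /= X0 h2 h1.
have -> : (1 + ((zr - 1) * v - (zi - 0) * 0)) ^+ 2 + (0 + ((zr - 1) * 0 + (zi - 0) * v)) ^+ 2
   = 1 - v * (1 - v) * X + v * (zr ^+ 2 + zi ^+ 2 - 1) by rewrite h2; ring.
rewrite -h1 subrr mulr0 addr0.
have h : 3 / 16 * X <= v * (1 - v) * X by apply: ler_wpM2r => //; nra.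
have -> : (1 - 3 / 32 * X) ^+ 2 = 1 - 3 / 16 * X + (3 / 32 * X) ^+ 2 by field.
by have := sqr_ge0 (3 / 32 * X); lra.
Qed.

End complex_mean.

Section oscillating_product.
Context {R : realType} (alpha : R).
Hypothesis alpha_itv : 0 < alpha < 1.
Hypothesis alpha_irr : irrational alpha.
Local Notation q := (cf_denominator alpha).
Local Notation e := e2ipi.
Local Notation cabs := Normc.normc.
Let q0 n : (0 < q n)%N := cf_denominator_gt0 alpha_itv alpha_irr n.
Let qR n : 0 < (q n)%:R :> R := cf_denominatorR_gt0 alpha_itv alpha_irr n.

Variables (n0 : nat) (rho : R) (eps v c : nat -> R).
Hypothesis rho0 : 0 <= rho.
Let x n : R := cabs (e (eps n) - 1).
Hypothesis v01 : forall n, 0 <= v n <= 1.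
Hypothesis v_mid : forall n, (n0 <= n)%N -> eps n != 0 -> 4^-1 <= v n <= 3 / 4.
Hypothesis growth : forall n, (n0 <= n)%N -> eps n != 0 -> (q n)%:R <= rho * (q n.+1)%:R.

Definition osc n y : R[i] := e (eps n * chi (v n) ((q n)%:R * y + c n)).
Definition osc_prod N y : R[i] := \prod_(n0 <= n < N) osc n y.

Let x0 n : 0 <= x n. Proof. exact: cabs_ge0. Qed.

Lemma unim_osc n : unim (osc n).
Proof. by apply: unim_e_circ; apply: circZ; exact: circ_chi_affine. Qed.

Lemma unim_osc_prod N : unim (osc_prod N).
Proof. by apply: unim_prod => n _; exact: unim_osc. Qed.

Lemma oscE n y : osc n y = 1 + (e (eps n) - 1) * Complex (chi (v n) ((q n)%:R * y + c n)) 0.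
Proof.
rewrite /osc; have [[-> _]|[-> _]] := chi_cases ((q n)%:R * y + c n) (v01 n).
  by rewrite mulr0 e0 (_ : Complex 0 0 = 0 :> R[i])// mulr0 addr0.
by rewrite mulr1 (_ : Complex 1 0 = 1 :> R[i])// mulr1 addrC subrK.
Qed.

Lemma osc_lipschitz n u : udist (fun y => osc n (y + u)) (osc n) <= x n * (4 * (q n)%:R * `|u|).
Proof.
pose C y := chi (v n) ((q n)%:R * y + c n).
have cC : circ C by exact: circ_chi_affine.
have cD : circ (fun y => `|C (y + u) - C y|).
  by apply: circ_norm; apply: circB => //; exact: (circ_shift u cC).
apply: (@le_trans _ _ (cint (fun y => x n * `|C (y + u) - C y|))).
  apply: udist_le; [exact: unim_shift (unim_osc n)|exact: unim_osc|exact: circZ|].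
  move=> y; rewrite !oscE -/(C (y + u)) -/(C y) /x.
  have -> : 1 + (e (eps n) - 1) * Complex (C (y + u)) 0 - (1 + (e (eps n) - 1) * Complex (C y) 0)
     = (e (eps n) - 1) * (Complex (C (y + u) - C y) 0).
    rewrite opprD addrACA subrr add0r -mulrBr; congr (_ * _).
    by rewrite /GRing.opp /GRing.add /= oppr0 addr0.
  by rewrite Normc.normcM [X in _ * X]/Normc.normc /= expr0n addr0 sqrtr_sqr.
rewrite cintZ// ler_wpM2l//; exact: L1lip_chi.
Qed.

Lemma osc_growth l : (n0 <= l)%N -> x l * (q l)%:R <= x l * (rho * (q l.+1)%:R).
Proof.
move=> nl; have [z|nz] := eqVneq (eps l) 0; last by rewrite ler_wpM2l// growth.
by rewrite /x z e0 subrr cabs0 !mul0r.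
Qed.

(** Only the factors with eps_l nonzero contribute, and for these q_l is small
    compared to q_(l+1). *)
Lemma osc_prod_lipschitz N : let V := 4 * rho * \sum_(n0 <= l < N) x l * (q l.+1)%:R in
  L1lip V (fun y => complex.Re (osc_prod N y)) /\ L1lip V (fun y => complex.Im (osc_prod N y)).
Proof.
move=> V; have up := unim_osc_prod N.
have D u : udist (fun y => osc_prod N (y + u)) (osc_prod N) <= V * `|u|.
  apply: le_trans (udist_prod _ _ _) _; [by move=> n _; exact: (unim_shift u (unim_osc n))|by move=> n _; exact: unim_osc|].
  rewrite /V mulr_sumr mulr_suml big_nat [leRHS]big_nat; apply: ler_sum => l /andP[nl _].
  apply: le_trans (osc_lipschitz l u) _.
  have h : 4 * `|u| * (x l * (q l)%:R) <= 4 * `|u| * (x l * (rho * (q l.+1)%:R)).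
    by apply: ler_wpM2l; [rewrite mulr_ge0|exact: osc_growth].
  by lra.
have half (P : R[i] -> R) u : circ (fun y => P (osc_prod N y)) ->
    (forall z w, `|P z - P w| <= cabs (z - w)) ->
    cint (fun y => `|P (osc_prod N (y + u)) - P (osc_prod N y)|) <= V * `|u|.
  move=> cP h; apply: le_trans (D u); apply: le_cint => //.
    by apply: circ_norm; apply: circB => //; exact: (circ_shift u cP).
  by apply: circ_cabsB => //; exact: unim_shift.
split=> u; apply: half.
- exact: circ_Re.
- by move=> [? ?] [? ?]; apply: le_trans (norm_Re_le _).
- exact: circ_Im.
- by move=> [? ?] [? ?]; apply: le_trans (norm_Im_le _).
Qed.

(** Each factor shrinks the mean by an amount of order x_n^2, up to correlations
    that sum to little because the denominators are lacunary. *)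
Lemma cmean_osc_prod N : (n0 <= N)%N ->
  cabs (cmean (osc_prod N)) <= (1 + 3 / 32 * \sum_(n0 <= n < N) x n ^+ 2)^-1 +
    32 * rho * \sum_(n0 <= n < N) x n ^+ 2.
Proof.
move=> nN; set X := \sum_(_ <= _ < _) _.
(* The bounds (1 + 3/32 X)^-1 satisfy the recursion without error, because
   (1 - y) (S + y) <= S for S >= 1. *)
pose Err M := \sum_(n0 <= n < M) 8 * rho * \sum_(n0 <= l < n) x n * x l * ((q l.+1)%:R / (q n)%:R).
pose XX M := \sum_(n0 <= n < M) x n ^+ 2.
suff main M : (n0 <= M)%N -> cabs (cmean (osc_prod M)) <= (1 + 3 / 32 * XX M)^-1 + Err M.
  apply: (le_trans (main N nN)); rewrite lerD2l /Err -mulr_sumr.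
  rewrite (_ : 32 * rho * X = 8 * rho * (4 * X)); last by ring.
  apply: ler_wpM2l; first by rewrite mulr_ge0.
  exact: (lacunary_schur alpha_itv alpha_irr).
move=> /subnKC <-; elim: (M - n0)%N => [|r IH].
  rewrite addn0 /osc_prod /Err /XX; under eq_fun do rewrite big_geq//.
  by rewrite cmean_cst cabs1 !big_geq// mulr0 !addr0 invr1.
rewrite addnS; set n := (n0 + r)%N in IH *; have nn : (n0 <= n)%N by exact: leq_addr.
have XS : XX n.+1 = XX n + x n ^+ 2 by rewrite /XX big_nat_recr.
have ES : Err n.+1 = Err n + 8 * rho * \sum_(n0 <= l < n) x n * x l * ((q l.+1)%:R / (q n)%:R).
  by rewrite /Err big_nat_recr.
have [LR LI] := osc_prod_lipschitz n.
set V := 4 * rho * _ in LR LI.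
have /andP[vn0 vn1] := v01 n.
have up := unim_osc_prod n.
have V0 : 0 <= V by rewrite !mulr_ge0// sumr_ge0// => l _; rewrite mulr_ge0.
have bound (P : R -> R) : circ P -> L1lip V P ->
    `|cint (fun y => P y * (chi (v n) ((q n)%:R * y + c n) - v n))| <= V / (q n)%:R.
  move=> cP LP; apply: (le_trans (cint_chi_decorrelation (c n) cP LP (q0 n) vn0)).
  by rewrite ler_pM2r ?invr_gt0// ler_piMr.
have step : cabs (cmean (osc_prod n.+1)) <=
    cabs (1 + (e (eps n) - 1) * Complex (v n) 0) * cabs (cmean (osc_prod n)) + 2 * (x n * (V / (q n)%:R)).
  have -> : osc_prod n.+1 = (fun y => osc_prod n y * (1 + (e (eps n) - 1) *
      Complex (chi (v n) ((q n)%:R * y + c n)) 0)).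
    by apply/funext => y; rewrite /osc_prod big_nat_recr//= oscE.
  apply: cmean_perturb => //; first exact: circ_chi_affine.
  - by apply: bound => //; exact: circ_Re.
  - by apply: bound => //; exact: circ_Im.
have avg : cabs (1 + (e (eps n) - 1) * Complex (v n) 0) <= 1 - 3 / 32 * x n ^+ 2.
  have [z|nz] := eqVneq (eps n) 0; last by apply: cabs_average; [exact: cabs_e|exact: v_mid].
  by rewrite /x z e0 subrr mul0r addr0 cabs0 cabs1 expr0n mulr0 subr0.
apply: (le_trans step); rewrite XS ES.
have -> : 2 * (x n * (V / (q n)%:R)) =
    8 * rho * \sum_(n0 <= l < n) x n * x l * ((q l.+1)%:R / (q n)%:R).
  have -> : \sum_(n0 <= l < n) x n * x l * ((q l.+1)%:R / (q n)%:R) =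
      x n * (\sum_(n0 <= l < n) x l * (q l.+1)%:R) / (q n)%:R.
    by rewrite mulr_sumr mulr_suml; apply: eq_bigr => l _; rewrite !mulrA.
  by rewrite /V; ring.
have XX0 : 0 <= XX n by apply: sumr_ge0 => l _; exact: sqr_ge0.
have Err0 : 0 <= Err n.
  apply: sumr_ge0 => l _; rewrite !mulr_ge0// sumr_ge0// => i _.
  by rewrite !mulr_ge0// divr_ge0.
rewrite addrA lerD2r.
set y := 3 / 32 * x n ^+ 2 in avg; set S := 1 + 3 / 32 * XX n in IH.
have y0 : 0 <= y by rewrite mulr_ge0// sqr_ge0.
have S1 : 1 <= S by rewrite /S; lra.
have y1 : 0 <= 1 - y by apply: le_trans avg; exact: cabs_ge0.
have -> : 1 + 3 / 32 * (XX n + x n ^+ 2) = S + y by rewrite /S /y; ring.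
apply: (@le_trans _ _ ((1 - y) * (S^-1 + Err n))).
  by apply: ler_pM => //; exact: cabs_ge0.
rewrite mulrDr; apply: lerD; last by rewrite ler_piMl//; lra.
rewrite ler_pdivrMr; last by lra.
rewrite mulrC ler_pdivlMr; last by lra.
by nra.
Qed.

End oscillating_product.

(** * Square summability of the distances to the integers *)
Section mean_arithmetic.
Context {R : realFieldType}.

Lemma mean_bound_arith (A B X rho : R) : 0 <= X -> X <= 64 -> 0 <= rho -> 128 * (64 * rho) <= 1 ->
  1 <= B + A -> B <= 2^-1 -> A <= (1 + 3 / 32 * X)^-1 + 32 * rho * X -> X <= 32.
Proof.
move=> X0 X64 r0 r1 h1 h2 h3; have rX : 32 * rho * X <= 4^-1 by nra.
have : 4^-1 <= (1 + 3 / 32 * X)^-1 by lra.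
by rewrite lef_pV2 ?posrE//; lra.
Qed.

(** Small enough for the error terms that carry the factor rho. *)
Lemma small_parameter (A Sg : R) : 0 < A -> 0 <= Sg -> exists rho : R,
  [/\ 0 < rho, rho <= A, 128 * (64 * rho) <= 1 & 128 * rho * Sg <= 16^-1].
Proof.
move=> A0 S0; have S1 : 0 < 128 * (16 * (1 + Sg)) by lra.
set r1 := 128^-1 * 64^-1 : R; set r2 := (128 * (16 * (1 + Sg)))^-1.
have r10 : 0 < r1 by rewrite /r1; lra.
have r20 : 0 < r2 by rewrite invr_gt0.
have r2E : r2 * (128 * (16 * (1 + Sg))) = 1 by apply: mulVf; exact: lt0r_neq0.
pose rho := Num.min A (Num.min r1 r2).
have h1 : rho <= r1 by rewrite !ge_min lexx !orbT.
have h2 : rho <= r2 by rewrite !ge_min lexx !orbT.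
have h0 : 0 < rho by rewrite !lt_min A0 r10.
have h3 : rho <= A by rewrite ge_min lexx.
have r1E : 128 * (64 * r1) = 1 by rewrite /r1; lra.
have h4 : 128 * (64 * rho) <= 1 by lra.
have h5 : rho * (128 * (16 * (1 + Sg))) <= 1 by rewrite -[leRHS]r2E ler_pM2r.
have h6 : 0 <= rho * Sg by apply: mulr_ge0; [exact: ltW|].
by exists rho; split; [exact: h0|exact: h3|exact: h4|lra].
Qed.

End mean_arithmetic.

Section half_periods.
Context {R : realType} (alpha : R).
Hypothesis alpha_itv : 0 < alpha < 1.
Hypothesis alpha_irr : irrational alpha.
Notation mu := (@lebesgue_measure R).

Local Notation q := (cf_denominator alpha).
Local Notation a := (partial_quotient alpha).
Local Notation delta := (cf_delta alpha).
Local Notation theta := (cf_theta alpha).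
Local Notation ksum := (ksum alpha).
Local Notation ksum_norm := (ksum_norm alpha).
Local Notation e := e2ipi.
Local Notation cabs := Normc.normc.
Let q0 n : (0 < q n)%N := cf_denominator_gt0 alpha_itv alpha_irr n.
Let qR n : 0 < (q n)%:R :> R := cf_denominatorR_gt0 alpha_itv alpha_irr n.
Let aR n : 0 < (a n.+1)%:R :> R.
Proof. by rewrite ltr0n (partial_quotient_gt0 alpha_itv alpha_irr). Qed.
Let dR n : 0 < delta n := cf_delta_gt0 alpha_itv alpha_irr n.

Variables (m : nat) (beta : 'I_m.+1 -> R) (j0 : 'I_m.+1) (b : 'I_m.+1 -> nat -> int).
Hypothesis b_lim : forall j,
  tends0 (fun n => dist_int ((ksum (b j) n)%:~R * alpha - (beta j - beta j0))).

Variables (rho : R) (n0 : nat).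
Hypothesis rho0 : 0 < rho.
Hypothesis rho_small : rho <= (64 * m.+1%:R ^+ 2)^-1.
Hypothesis density_le : forall n, (n0 <= n)%N -> coef_density alpha b n <= rho.
Hypothesis ksum_norm_le : forall n, (n0 <= n)%N -> \sum_j ksum_norm (b j) n <= rho * (q n)%:R.

Let rho64 : rho <= 64^-1.
Proof.
apply: (le_trans rho_small); rewrite lef_pV2 ?posrE//.
by rewrite -[leLHS]mulr1 ler_pM2l// -natrX ler1n expn_gt0.
Qed.

Definition half n : nat := if active b n0 n then (a n.+1)./2 else 0%N.
Definition half_gap n : nat := (half n * q n)%N.
Definition half_time N : nat := \sum_(n0 <= l < N) half_gap l.

Lemma half_le n : 2 * (half n)%:R <= (a n.+1)%:R :> R.
Proof.
rewrite -natrM ler_nat /half; case: ifP => // _.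
by rewrite -{2}(odd_double_half (a n.+1)) mul2n leq_addl.
Qed.

Lemma half_ge n : active b n0 n -> (a n.+1)%:R - 1 <= 2 * (half n)%:R :> R.
Proof.
move=> an; rewrite lerBlDr -natrM natr1 ler_nat /half an.
by rewrite -{1}(odd_double_half (a n.+1)) mul2n -[leqRHS]addn1 addnC leq_add2l; case: odd.
Qed.

Lemma half_gap_le n : (2 * half_gap n <= q n.+1)%N.
Proof.
rewrite /half_gap mulnA -(ler_nat R) natrM natrM; apply: (@le_trans _ _ ((a n.+1)%:R * (q n)%:R)).
  by rewrite ler_pM2r//; exact: half_le.
by rewrite -natrM ler_nat leq_partial_quotientM.
Qed.

Lemma half_time_le N : 2 * (half_time N)%:R <= 3 * (q N)%:R :> R.
Proof.
rewrite -!natrM ler_nat; apply: leq_trans (sum_cf_denominator alpha_itv alpha_irr N).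
rewrite big_nat_recl//=; apply: leq_trans (leq_addl _ _).
have [nn|nn] := leqP n0 N; last by rewrite /half_time big_geq// ltnW.
rewrite (big_cat_nat (leq0n n0) nn) /=; apply: leq_trans (leq_addl _ _).
by rewrite /half_time big_distrr /=; apply: leq_sum => l _; exact: half_gap_le.
Qed.

Lemma half_delta l : (half l)%:R * delta l <= (2 * (q l)%:R)^-1.
Proof.
rewrite invfM ler_pdivlMr// -mulrA -(mulrC (q l)%:R).
apply: (@le_trans _ _ ((half l)%:R * (a l.+1)%:R^-1)).
  by apply: ler_wpM2l => //; exact: delta_le_a.
by rewrite ler_pdivrMr//; have := half_le l; lra.
Qed.

Lemma dist_half_time N : dist_int ((half_time N)%:R * alpha) <= 2 / (q n0)%:R.
Proof.
have z : dist_int (0 : R) = 0 := dist_int_int 0.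
have -> : 2 / (q n0)%:R = 2^-1 * (4 / (q n0)%:R) :> R by field; rewrite gt_eqF.
apply: le_trans (ler_wpM2l _ (sum_cf_denominatorV alpha_itv alpha_irr n0 N)); last by lra.
rewrite /half_time; have [h|h] := leqP N n0; first by rewrite !big_geq// mul0r z mulr0.
rewrite natr_sum mulr_suml mulr_sumr.
elim/big_rec2: _ => [|l x y _ IH]; first by rewrite z.
apply: (le_trans (dist_intD _ _)); apply: lerD => //.
rewrite /half_gap natrM -mulrA; apply: (le_trans (dist_intMn _ _)).
rewrite -invfM; apply: le_trans (half_delta l); apply: ler_wpM2l => //.
exact: dist_int_cf_denominator.
Qed.

(** The time half_time N rotates the n-th scale by about half a turn: the own
    contribution of level n is about 1/2, and those of the other levels are
    negligible because the partial quotients at active levels are large. *)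
Lemma half_time_phase (n N : nat) : (n < N)%N -> active b n0 n ->
  4^-1 <= frac ((q n)%:R * ((half_time N)%:R * alpha)) <= 3 / 4.
Proof.
move=> nN an; have nn := active_ge an.
have qd : (q n)%:R * delta n <= rho.
  apply: (le_trans (delta_le_a alpha_itv alpha_irr n)).
  exact: le_trans (active_density alpha an) (density_le nn).
set Y := (q n)%:R * _.
pose r1 := \sum_(n0 <= l < n) (half_gap l)%:R * theta n.
pose r2 := (half n)%:R * ((q n)%:R * theta n).
pose r3 := \sum_(n.+1 <= l < N) (q n)%:R * ((half l)%:R * theta l).
have Yr : Y - (r1 + r2 + r3) \is a Num.int.
  have -> : Y = \sum_(n0 <= l < n) (half_gap l)%:R * ((q n)%:R * alpha) +
     (half_gap n)%:R * ((q n)%:R * alpha) + \sum_(n.+1 <= l < N) (half_gap l)%:R * ((q n)%:R * alpha).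
    rewrite /Y /half_time mulrCA (big_cat_nat nn (ltnW nN)) /= [X in (_ + X)%N]big_ltn//.
    by rewrite !natrD !natr_sum !mulrDl !mulr_suml addrA.
  rewrite /r1 /r2 /r3.
  have -> (x1 x2 x3 y1 y2 y3 : R) : x1 + x2 + x3 - (y1 + y2 + y3) = (x1 - y1) + (x2 - y2) + (x3 - y3) by ring.
  have I n' : (q n')%:R * alpha - theta n' \is a Num.int := cf_theta_int alpha n'.
  rewrite -!sumrB; apply: rpredD; first apply: rpredD.
  - by apply: rpred_sum => l _; rewrite -mulrBr rpredM// natr_int.
  - by rewrite /half_gap natrM -mulrA -mulrBr -mulrBr rpredM ?natr_int// rpredM ?natr_int.
  - apply: rpred_sum => l _; rewrite /half_gap natrM.
    have -> : (half l)%:R * (q l)%:R * ((q n)%:R * alpha) - (q n)%:R * ((half l)%:R * theta l) =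
      (q n)%:R * (half l)%:R * ((q l)%:R * alpha - theta l) by ring.
    by rewrite rpredM// -natrM natr_int.
have th n' : `|theta n'| = delta n' := norm_cf_theta alpha_itv alpha_irr n'.
have b1 : `|r1| <= 3 / 2 * rho.
  rewrite /r1 -mulr_suml -natr_sum normrM th normr_nat -/(half_time n).
  by have := half_time_le n; have := dR n; nra.
have b3 : `|r3| <= 2 * rho.
  apply: (le_trans (ler_norm_sum _ _ _)).
  apply: (@le_trans _ _ ((q n)%:R / 2 * \sum_(n.+1 <= l < N) (q l)%:R^-1)).
    rewrite mulr_sumr; apply: ler_sum => l _; rewrite normrM normrM th !normr_nat -mulrA ler_pM2l//.
    by rewrite -invfM; exact: half_delta.
  have S := sum_cf_denominatorV alpha_itv alpha_irr n.+1 N.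
  apply: (@le_trans _ _ ((q n)%:R / 2 * (4 / (q n.+1)%:R))).
    by apply: ler_wpM2l => //; rewrite divr_ge0.
  have := active_growth alpha_itv alpha_irr rho0 density_le an; rewrite -ler_pdivrMr// => g.
  by rewrite (_ : _ * _ = 2 * ((q n)%:R / (q n.+1)%:R)); [lra|field; rewrite gt_eqF].
have b2 : 2^-1 - 2 * rho <= `|r2| <= 2^-1.
  rewrite /r2 normrM normrM th !normr_nat.
  have h1 := half_le n; have h2 := half_ge an.
  have aqd : (a n.+1)%:R * ((q n)%:R * delta n) <= 1.
    by rewrite -ler_pdivlMl// mulr1; exact: delta_le_a.
  have qd0 : 0 < (q n)%:R * delta n by rewrite mulr_gt0.
  have low : 1 - 2 * rho <= (a n.+1)%:R * ((q n)%:R * delta n).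
    have := cf_delta_det alpha n; have := cf_deltaS_le alpha_itv alpha_irr n.
    have : (q n.+1)%:R <= (a n.+1)%:R * (q n)%:R + (q n)%:R :> R.
      by rewrite -natrM -natrD ler_nat leq_cf_denominatorM.
    by have := dR n; have := qR n; nra.
  by apply/andP; split; nra.
set r := r1 + r2 + r3 in Yr.
have rl : 2^-1 - 6 * rho <= `|r| <= 2^-1 + 4 * rho.
  have := ler_normD (r1 + r2) r3; have := ler_normD r1 r2.
  have := ler_normB r (r1 + r3); rewrite (_ : r - (r1 + r3) = r2); last by rewrite /r; ring.
  by have := ler_normD r1 r3; rewrite -/r; lra.
have /intrP[k hk] := Yr.
have Yk : Y = r + k%:~R by rewrite -hk; ring.
have r64 := rho64.
have [rp|rn] := lerP 0 r.
  rewrite ger0_norm// in rl.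
  have -> : frac Y = r by rewrite Yk fracDz (@fracE _ r 0) mulr0z subr0//; lra.
  by lra.
rewrite ltr0_norm// in rl.
have -> : frac Y = r + 1.
  by rewrite Yk fracDz (@fracE _ r (-1)) mulrNz mulr1z opprK//; lra.
by lra.
Qed.

Variables (s : 'I_m.+1 -> R).
Hypothesis s0 : \sum_j s j = 0.

Local Notation bt := (block_trans alpha xpredT s b (beta j0)).
Local Notation eps := (block_eps xpredT s b).
Local Notation eta := (block_eta alpha xpredT b).
Let Sg : R := \sum_j `|s j|.
Let Sg0 : 0 <= Sg. Proof. exact: sumr_ge0. Qed.
Let v N n : R := if (n < N)%N then frac ((q n)%:R * ((half_time N)%:R * alpha)) else 2^-1.
Let c n : R := - (q n)%:R * beta j0.

Let btE N x : bt N x - bt N (x + (half_time N)%:R * alpha) =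
  \sum_j s j * (trans alpha (ksum (b j) N) (x - beta j0) -
    trans alpha (ksum (b j) N) (x - beta j0 + (half_time N)%:R * alpha)).
Proof.
rewrite /block_trans -sumrB; apply: eq_bigr => j _; rewrite -mulrBr.
by rewrite (addrAC x).
Qed.

(** At level N the far visits are rare even along the whole time half_time N, which
    is at most 3/2 q_N. *)
Lemma birkhoff_block_trans N : (n0 <= N)%N -> exists2 z, cabs z = 1 &
  udist (fun x => e (\sum_(0 <= i < half_time N) saw s beta (x + i%:R * alpha)))
    (fun x => z * (e (bt N x) / e (bt N (x + (half_time N)%:R * alpha)))) <= 96 * rho * Sg.
Proof.
move=> nN; set M := half_time N.
pose tau := orbit_gap alpha beta j0 b N.
have tau1 j : `|tau j| <= 1 := orbit_gap_le1 alpha_itv alpha_irr b_lim rho_small density_le j nN.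
exists (e (- \sum_j s j * (M%:R * tau j))); first exact: cabs_e.
pose V j x := \sum_(0 <= i < M) chi (tau j) (x - beta j0 + (i%:Z - ksum (b j) N)%:~R * alpha - tau j).
pose E x := \sum_j s j * V j x.
have cV j : circ (V j).
  by apply: circ_sum => i _; under eq_fun do rewrite -!addrA; exact: circ_chi_shift.
have cE : circ E by apply: circ_sum => j _; exact: circZ.
pose H x := e (- \sum_j s j * (M%:R * tau j)) * (e (bt N x) / e (bt N (x + M%:R * alpha))).
have uH : unim H.
  apply: unimM; first by apply: unim_cst; exact: cabs_e.
  have ub : unim (fun x => e (bt N x)) by apply: unim_e_circ; exact: circ_block_trans.
  by apply: unim_div => //; exact: (unim_shift _ ub).
have -> : (fun x => e (\sum_(0 <= i < M) saw s beta (x + i%:R * alpha))) = (fun x => H x * e (E x)).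
  apply/funext => x; rewrite (birkhoff_saw_trans s0 (orbit_gapE alpha beta j0 b N)).
  by rewrite /H -eB btE -!eD; congr e; rewrite /E /V -/tau; ring.
have := udist_mull (fun x => e (E x)) (fun=> 1) uH.
under [X in udist _ X = _]eq_fun do rewrite mulr1.
rewrite -/H => ->; rewrite -(e0 (R := R)).
apply: (le_trans (udist_e cE (circ_cst 0))).
have q4 : M%:R * (rho * (4 / (q N)%:R)) <= 6 * rho.
  rewrite (_ : _ * (_ * _) = 2 * rho * (2 * M%:R / (q N)%:R)); last by ring.
  have : 2 * M%:R / (q N)%:R <= 3 :> R by rewrite ler_pdivrMr// half_time_le.
  by move=> h; have := ler_wpM2l (ltW (mulr_gt0 (ltr0n _ 2) rho0)) h; lra.
have cvis j := @circ_visits _ alpha _ (beta j0) (fun j => ksum (b j) N) tau M j.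
have ivis j := cint_visits alpha (beta j0) (fun j => ksum (b j) N) M (tau1 j).
have Eb : cint (fun x => `|E x - 0|) <= Sg * (6 * rho).
  apply: (@le_trans _ _ (cint (fun x => \sum_j `|s j| * \sum_(0 <= i < M)
      `|chi (tau j) (x - beta j0 + (i%:Z - ksum (b j) N)%:~R * alpha - tau j)|))).
    apply: le_cint.
    - by apply: circ_norm; apply: circB => //; exact: circ_cst.
    - by apply: circ_sum => j _; apply: circZ; exact: cvis.
    move=> x; rewrite subr0; apply: (le_trans (ler_norm_sum _ _ _)); apply: ler_sum => j _.
    by rewrite normrM ler_wpM2l//; exact: ler_norm_sum.
  rewrite cint_sum; last by move=> j _; apply: circZ; exact: cvis.
  rewrite mulr_suml; apply: ler_sum => j _; rewrite cintZ; last exact: cvis.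
  rewrite ivis ler_wpM2l//; apply: le_trans q4.
  exact: ler_wpM2l (ler0n _ _) _ _ (orbit_gap_le alpha_itv alpha_irr b_lim density_le j nN).
by lra.
Qed.

(** Below level n0 the shift by the half time is too small to matter. *)
Lemma block_trans_base N : exists2 z, cabs z = 1 &
  udist (fun x => e (bt n0 x) / e (bt n0 (x + (half_time N)%:R * alpha))) (fun=> z)
    <= 32 * rho * Sg.
Proof.
set M := half_time N; pose om := M%:R * alpha - (nearest_int (M%:R * alpha))%:~R.
have omI : M%:R * alpha - om \is a Num.int by rewrite /om subKr intr_int.
have omE : `|om| = dist_int (M%:R * alpha) by [].
have om1 : `|om| <= 1 by rewrite omE; have := dist_int_le_half (M%:R * alpha); lra.
pose Z j x := zsum (fun i => chi om (x - beta j0 - (i + 1)%:~R * alpha)) (ksum (b j) n0).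
have cZ j : circ (Z j).
  by apply: circ_zsum => i; under eq_fun do rewrite -!addrA; exact: circ_chi_shift.
pose E x := \sum_j s j * Z j x.
have cE : circ E by apply: circ_sum => j _; exact: circZ.
pose C := - \sum_j s j * ((ksum (b j) n0)%:~R * om).
exists (e C); first exact: cabs_e.
have -> : (fun x => e (bt n0 x) / e (bt n0 (x + M%:R * alpha))) = (fun x => e (E x + C)).
  apply/funext => x; rewrite -eB; congr e; rewrite /block_trans /E /C -sumrN -sumrB -big_split /=.
  apply: eq_bigr => j _; rewrite -mulrBr (addrAC x) (trans_chi _ _ omI) -/(Z j x); ring.
apply: (le_trans (udist_e (circD cE (circ_cst C)) (circ_cst C))).
under eq_fun do rewrite addrK.
have Zb j : cint (fun x => `|Z j x|) <= 2 * rho.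
  apply: (@le_trans _ _ (`|(ksum (b j) n0)%:~R| * `|om|)).
    apply: cint_zsum_norm => i.
      by under eq_fun do rewrite -!addrA; exact: circ_chi_shift.
    by under eq_fun do rewrite -!addrA; rewrite cint_chi_norm.
  have h1 : `|(ksum (b j) n0)%:~R| <= rho * (q n0)%:R.
    exact: le_trans (ksum_le _ _ _) (ksum_norm_le1 ksum_norm_le j (leqnn n0)).
  apply: (@le_trans _ _ (rho * (q n0)%:R * (2 / (q n0)%:R))).
    by apply: ler_pM => //; rewrite omE; exact: dist_half_time.
  by rewrite le_eqVlt; apply/orP; left; apply/eqP; field; rewrite gt_eqF.
have : cint (fun x => `|E x|) <= Sg * (2 * rho).
  apply: (@le_trans _ _ (cint (fun x => \sum_j `|s j| * `|Z j x|))).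
    apply: le_cint; [exact: circ_norm|by apply: circ_sum => j _; apply: circZ; exact: circ_norm|].
    by move=> x; apply: (le_trans (ler_norm_sum _ _ _)); apply: ler_sum => j _; rewrite normrM.
  rewrite cint_sum; last by move=> j _; apply: circZ; exact: circ_norm.
  rewrite mulr_suml; apply: ler_sum => j _; rewrite cintZ ?ler_wpM2l//; exact: circ_norm.
lra.
Qed.

Let W n x := e (bt n.+1 x) / e (bt n x).

Let ub n : unim (fun x => e (bt n x)).
Proof. by apply: unim_e_circ; exact: circ_block_trans. Qed.

Let uW n : unim (W n). Proof. exact: unim_div. Qed.

(** The quotient of an oscillating factor e(eps psi) by its shift takes two values,
    on arcs whose length is the phase of the shift at scale 1/q_n. *)
Lemma block_ratio N n : (n < N)%N -> exists2 w, cabs w = 1 &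
  udist (fun x => W n x / W n (x + (half_time N)%:R * alpha))
    (fun x => w * osc alpha eps (v N) c n x) <= 8 * eta n.
Proof.
move=> nN; set u := (half_time N)%:R * alpha.
have [z z1 hz] := block_step alpha_itv alpha_irr xpredT s b (beta j0) n.
pose F := block_factor alpha xpredT s b (beta j0) z n.
pose O := block_osc alpha xpredT s b (beta j0) n.
have uF : unim F := unim_block_factor alpha xpredT s b (beta j0) n z1.
have uO : unim O := unim_block_osc alpha xpredT s b (beta j0) n.
have D : udist (fun x => F x / F (x + u)) (fun x => O x / O (x + u)) <= 8 * eta n.
  apply: (le_trans (udist_div uF uO (unim_shift u uF) (unim_shift u uO))).
  by rewrite udist_shift//; lra.
pose k := (- block_int xpredT s b n * (q n)%:Z)%:~R : R.
pose w1 := e (- (k * u)).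
pose w2 := e (- (eps n * v N n)).
have w11 : cabs w1 = 1 := cabs_e _.
have w10 : w1 != 0 := e_neq0 _.
exists (w1^-1 * w2).
  by rewrite /w1 -eN /w2 -eD cabs_e.
have uc : unim (fun=> w1) by exact: unim_cst.
apply: le_trans D; rewrite -[leLHS](udist_mull _ _ uc) le_eqVlt; apply/orP; left; apply/eqP.
have AF : (fun x => w1 * (W n x / W n (x + u))) = (fun x => F x / F (x + u)).
  apply/funext => x; rewrite /F /block_factor -/(W n x) -/(W n (x + u)) -/k.
  have W0 : W n (x + u) != 0 by exact: unim_neq0.
  have z0 : z != 0 by exact: cabs_unit_neq0.
  have -> : e (k * (x + u)) = e (k * x) / w1 by rewrite /w1 -eB; congr e; ring.
  by field; rewrite W0 z0 w10 e_neq0.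
rewrite AF; have -> // : (fun x => w1 * (w1^-1 * w2 * osc alpha eps (v N) c n x)) =
    (fun x => O x / O (x + u)).
apply/funext => x.
rewrite mulrA mulrA mulfV// mul1r /O /block_osc -eB /w2 /osc -eD; congr e.
have -> : (q n)%:R * (x + u) + - (q n)%:R * beta j0 =
    (q n)%:R * x + - (q n)%:R * beta j0 + v N n + (Num.floor ((q n)%:R * u))%:~R.
  by rewrite /v nN /frac -/u; ring.
by rewrite psiDz /chi /c; ring.
Qed.

Lemma block_ratio_prod N x u : (n0 <= N)%N -> e (bt N x) / e (bt N (x + u)) =
  e (bt n0 x) / e (bt n0 (x + u)) * \prod_(n0 <= n < N) (W n x / W n (x + u)).
Proof.
move=> /subnKC <-; elim: (N - n0)%N => [|r IH]; first by rewrite addn0 big_geq// mulr1.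
rewrite addnS big_nat_recr ?leq_addr//= mulrA -IH /W.
by field; rewrite !e_neq0.
Qed.

Lemma birkhoff_osc_prod N : (n0 <= N)%N -> exists2 z, cabs z = 1 &
  udist (fun x => e (\sum_(0 <= i < half_time N) saw s beta (x + i%:R * alpha)))
    (fun x => z * osc_prod alpha n0 eps (v N) c N x)
  <= 128 * rho * Sg + 8 * \sum_(n0 <= n < N) eta n.
Proof.
move=> nN; set u := (half_time N)%:R * alpha.
have [z1 z11 h1] := birkhoff_block_trans nN.
have [z2 z21 h2] := block_trans_base N.
have ex n : exists w, cabs w = 1 /\ ((n < N)%N ->
    udist (fun x => W n x / W n (x + u)) (fun x => w * osc alpha eps (v N) c n x) <= 8 * eta n).
  case: (ltnP n N) => [nn|nn]; last by exists 1; split; [exact: cabs1|].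
  by have [w w1 hw] := block_ratio nn; exists w.
have [w hw] := choice ex.
pose pw := \prod_(n0 <= n < N) w n.
have pw1 : cabs pw = 1.
  rewrite /pw; elim/big_rec: _ => [|i y _ y1]; first exact: cabs1.
  by rewrite Normc.normcM y1 mulr1; case: (hw i).
have uosc := unim_osc alpha eps (v N) c.
have usc (z : R[i]) (f : R -> R[i]) : cabs z = 1 -> unim f -> unim (fun x => z * f x).
  by move=> zz uf; apply: unimM => //; exact: unim_cst.
have uR n : unim (fun x => W n x / W n (x + u)).
  by apply: unim_div => //; exact: (unim_shift u (uW n)).
have uB : unim (fun x => e (bt n0 x) / e (bt n0 (x + u))).
  by apply: unim_div => //; exact: (unim_shift u (ub n0)).
have uP : unim (fun x => \prod_(n0 <= n < N) (W n x / W n (x + u))) by exact: unim_prod.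
have uQ : unim (fun x => pw * osc_prod alpha n0 eps (v N) c N x).
  by apply: usc => //; exact: unim_osc_prod.
have hP : udist (fun x => \prod_(n0 <= n < N) (W n x / W n (x + u)))
    (fun x => pw * osc_prod alpha n0 eps (v N) c N x) <= 8 * \sum_(n0 <= n < N) eta n.
  have -> : (fun x => pw * osc_prod alpha n0 eps (v N) c N x) =
      (fun x => \prod_(n0 <= n < N) (w n * osc alpha eps (v N) c n x)).
    by apply/funext => x; rewrite big_split.
  apply: (le_trans (udist_prod _ _ _)) => [n _|n _|]; [exact: uR|by apply: usc; [case: (hw n)|exact: uosc]|].
  rewrite mulr_sumr big_nat [leRHS]big_nat; apply: ler_sum => n /andP[_ nn].
  by case: (hw n) => _; exact.
exists (z1 * (z2 * pw)); first by rewrite !Normc.normcM z11 z21 pw1 !mulr1.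
have uS : unim (fun x => e (\sum_(0 <= i < half_time N) saw s beta (x + i%:R * alpha))).
  exact: unim_birkhoff.
have uN : unim (fun x => e (bt N x) / e (bt N (x + u))).
  by apply: unim_div => //; exact: (unim_shift u (ub N)).
have uc2 : unim (fun=> z2 : R[i]) by exact: unim_cst.
have u2 : unim (fun x => z2 * (pw * osc_prod alpha n0 eps (v N) c N x)) by exact: usc.
have -> : (fun x => z1 * (z2 * pw) * osc_prod alpha n0 eps (v N) c N x) =
    (fun x => z1 * (z2 * (pw * osc_prod alpha n0 eps (v N) c N x))).
  by apply/funext => x; rewrite !mulrA.
apply: (le_trans (udist_triangle uS (usc _ _ z11 uN) (usc _ _ z11 u2))).
have uc1 : unim (fun=> z1 : R[i]) by exact: unim_cst.
rewrite (udist_mull _ _ uc1).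
have : udist (fun x => e (bt N x) / e (bt N (x + u)))
    (fun x => z2 * (pw * osc_prod alpha n0 eps (v N) c N x)) <=
    32 * rho * Sg + 8 * \sum_(n0 <= n < N) eta n.
  have -> : (fun x => e (bt N x) / e (bt N (x + u))) = (fun x => e (bt n0 x) / e (bt n0 (x + u)) *
      \prod_(n0 <= n < N) (W n x / W n (x + u))).
    by apply/funext => x; exact: block_ratio_prod.
  by apply: (le_trans (udistM uB uc2 uP uQ)); exact: lerD.
by move: h1; rewrite -/u; lra.
Qed.

Lemma eps_active n : (n0 <= n)%N -> eps n != 0 -> active b n0 n.
Proof.
move=> nn; apply: contraNT => na; apply/eqP.
have b0 j : b j n = 0.
  by move: na; rewrite /active nn /= => /existsPn /(_ j); rewrite negbK => /eqP.
have z : block_sum xpredT s b n = 0 by apply: big1 => j _; rewrite b0 mul0r.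
apply/eqP; rewrite -normr_eq0 block_eps_dist z dist_int_eq0; exact: int_num0.
Qed.

(** The Birkhoff sum is almost constant, so the mean of the product of two-valued
    factors has modulus at least 1/2; but this mean decreases as the sum
    increases. *)
Lemma eps_sum_bound N (kappa : R) (C : R[i]) : (n0 <= N)%N -> cabs C = 1 ->
  udist (fun x => e (\sum_(0 <= i < half_time N) saw s beta (x + i%:R * alpha))) (fun=> C)
    <= kappa ->
  kappa + 128 * rho * Sg + 8 * \sum_(n0 <= n < N) eta n <= 4^-1 ->
  128 * (64 * rho) <= 1 ->
  \sum_(n0 <= n < N) cabs (e (eps n) - 1) ^+ 2 <= 64 ->
  \sum_(n0 <= n < N) cabs (e (eps n) - 1) ^+ 2 <= 32.
Proof.
move=> nN C1 hk tot r1; set X := \sum_(_ <= _ < _) _ => X64.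
have [z z1 hz] := birkhoff_osc_prod nN.
have v01 n : 0 <= v N n <= 1.
  by rewrite /v; case: ifP => _; [have /andP[h1 h2] := frac_itv ((q n)%:R * ((half_time N)%:R * alpha)); rewrite h1 ltW|lra].
have vmid n : (n0 <= n)%N -> eps n != 0 -> 4^-1 <= v N n <= 3 / 4.
  move=> nn en; rewrite /v; case: ifP => h; last by lra.
  by apply: half_time_phase => //; exact: eps_active.
have gr n : (n0 <= n)%N -> eps n != 0 -> (q n)%:R <= rho * (q n.+1)%:R.
  by move=> nn en; apply: (active_growth alpha_itv alpha_irr rho0 density_le); exact: eps_active.
have main := cmean_osc_prod alpha_itv alpha_irr c (ltW rho0) v01 vmid gr nN; rewrite -/X in main.
have uo := unim_osc_prod alpha n0 eps (v N) c N.
have uz : unim (fun=> z : R[i]) by exact: unim_cst.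
have uzo := unimM uz uo.
have uC : unim (fun=> C) by exact: unim_cst.
have uS := unim_birkhoff alpha beta s (half_time N).
have d1 : udist (fun x => z * osc_prod alpha n0 eps (v N) c N x) (fun=> C) <= 4^-1.
  apply: (le_trans (udist_triangle uzo uS uC)); rewrite udistC; lra.
have zV : cabs (z^-1) = 1.
  have zz : z != 0 by exact: cabs_unit_neq0.
  have := Normc.normcM z z^-1; rewrite mulfV// z1 mul1r => <-; exact: cabs1.
have uzV : unim (fun=> z^-1 : R[i]) by exact: unim_cst.
have d2 : udist (osc_prod alpha n0 eps (v N) c N) (fun=> z^-1 * C) <= 4^-1.
  apply: le_trans d1; rewrite -[leRHS](udist_mull _ _ uzV) le_eqVlt; apply/orP; left; apply/eqP.
  by congr udist; apply/funext => x; rewrite mulKf// cabs_unit_neq0.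
have cC : cabs (z^-1 * C) = 1 by rewrite Normc.normcM zV C1 mul1r.
have := cmean_udist uo (unim_cst cC); rewrite cmean_cst.
set Mn := cmean _ in main * => d3.
have low : 1 <= cabs (Mn - z^-1 * C) + cabs Mn.
  rewrite -cC; have := cabsB_triangle (z^-1 * C) Mn 0; rewrite !subr0.
  by rewrite cabsBC.
have X0 : 0 <= X by apply: sumr_ge0 => n _; exact: sqr_ge0.
apply: mean_bound_arith X0 X64 (ltW rho0) r1 low _ main.
by apply: (le_trans d3); lra.
Qed.

End half_periods.

(** * Necessity *)
Section necessity_of_condition_C.
Context {R : realType} (alpha : R).
Hypothesis alpha_itv : 0 < alpha < 1.
Hypothesis alpha_irr : irrational alpha.
Notation mu := (@lebesgue_measure R).

Local Notation q := (cf_denominator alpha).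
Local Notation a := (partial_quotient alpha).
Local Notation delta := (cf_delta alpha).
Local Notation ksum := (ksum alpha).
Local Notation e := e2ipi.
Local Notation cabs := Normc.normc.
Let qR n : 0 < (q n)%:R :> R := cf_denominatorR_gt0 alpha_itv alpha_irr n.
Let aR n : 0 < (a n.+1)%:R :> R.
Proof. by rewrite ltr0n (partial_quotient_gt0 alpha_itv alpha_irr). Qed.

Let unim_ce (g : R -> R[i]) (z : R) : unim g -> unim (fun x => e z * g x).
Proof. by move=> ug; apply: unimM => //; apply: unim_cst; exact: cabs_e. Qed.

Lemma eigenfunction_iterate (h : R -> R[i]) (theta : R) (k : nat) : unim h ->
  udist (fun x => h (x + alpha)) (fun x => e theta * h x) = 0 ->
  udist (fun x => h (x + k%:R * alpha)) (fun x => e (k%:R * theta) * h x) = 0.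
Proof.
move=> uh h0; elim: k => [|k IH].
  under eq_fun do rewrite mul0r addr0; under [X in udist _ X]eq_fun do rewrite mul0r e0 mul1r.
  exact: udistxx.
have us u : unim (fun x => h (x + u)) := unim_shift u uh.
apply/eqP; rewrite eq_le udist_ge0 andbT.
have ut := unim_shift alpha (unim_ce (k%:R * theta) uh).
have -> : (fun x => h (x + k.+1%:R * alpha)) = (fun x => h (x + alpha + k%:R * alpha)).
  by apply/funext => x; rewrite -natr1; congr h; ring.
apply: (le_trans (udist_triangle (unim_shift alpha (us (k%:R * alpha))) ut (unim_ce _ uh))).
rewrite (udist_shift alpha (us (k%:R * alpha)) (unim_ce (k%:R * theta) uh)) IH add0r.
have -> : (fun x => e (k.+1%:R * theta) * h x) = (fun x => e (k%:R * theta) * (e theta * h x)).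
  by apply/funext => x; rewrite mulrA -eD -natr1; congr (e _ * _); ring.
by rewrite udist_mull ?h0//; apply: unim_cst; exact: cabs_e.
Qed.

(** An eigenfunction is almost invariant under the times j q_n with j at most
    a_(n+1), so the multiples j q_n theta stay close to the integers; this makes
    theta a multiple of alpha. *)
Lemma eigenvalue_multiple (h : R -> R[i]) (theta : R) : unim h ->
  udist (fun x => h (x + alpha)) (fun x => e theta * h x) = 0 ->
  exists k : int, eqmod1 theta (k%:~R * alpha).
Proof.
move=> uh h0.
have close (eps : R) : 0 < eps -> exists n0, forall n, (n0 <= n)%N ->
    forall j, (j <= a n.+1)%N -> dist_int (j%:R * ((q n)%:R * theta)) <= eps.
  move=> ep0; have [r r0 hr] := udist_translation_continuous uh ep0.
  exists (Num.truncn r^-1).+1 => n nn j ja.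
  have small : dist_int ((j * q n)%:R * alpha) <= r.
    rewrite natrM -mulrA; apply: (le_trans (dist_intMn _ _)).
    apply: (@le_trans _ _ ((a n.+1)%:R * delta n)).
      apply: ler_pM => //; [exact: dist_int_ge0|by rewrite ler_nat|].
      exact: dist_int_cf_denominator.
    apply: (@le_trans _ _ (q n)%:R^-1).
      by rewrite -ler_pdivlMl// -invfM mulrC invfM ler_pdivlMl// delta_le_a.
    rewrite -[leRHS]invrK lef_pV2 ?posrE ?invr_gt0//.
    apply: (@le_trans _ _ (Num.truncn r^-1).+1%:R); first exact/ltW/truncnS_gt.
    by rewrite ler_nat (leq_trans nn)// cf_denominator_ge_id.
  have T : udist (fun x => e ((j * q n)%:R * theta) * h x) h <= eps.
    apply: (le_trans (udist_triangle (unim_ce _ uh) (unim_shift ((j * q n)%:R * alpha) uh) uh)).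
    rewrite udistC eigenfunction_iterate// add0r.
    set l := nearest_int ((j * q n)%:R * alpha).
    have -> : (fun x => h (x + (j * q n)%:R * alpha)) =
        (fun x => h (x + ((j * q n)%:R * alpha - l%:~R))).
      apply/funext => x; rewrite addrA -mulrNz; symmetry.
      exact: unim_periodic_intr.
    exact: hr.
  have uc z : unim (fun=> e z : R[i]) by apply: unim_cst; exact: cabs_e.
  have : cabs (e ((j * q n)%:R * theta) - 1) <= eps.
    rewrite -udist_cst -(udist_mulr _ _ uh); apply: le_trans T.
    by under [X in udist _ X]eq_fun do rewrite mul1r.
  move=> h1; have := e_sub1_lower ((j * q n)%:R * theta).
  rewrite natrM -mulrA in h1 *.
  by have := dist_int_ge0 (j%:R * ((q n)%:R * theta)); lra.
have [n0 hn0] := close 8^-1 ltac:(lra).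
apply: (eigenvalue_expansion alpha_itv alpha_irr (n0 := n0)) => [n nn|].
  rewrite -dist_intMn_small; first exact: hn0.
  by move=> j ja; apply: le_lt_trans (hn0 n nn j ja) _; lra.
move=> eps ep0; have [n1 hn1] := close eps ep0; exists n1 => n nn.
rewrite ger0_norm ?dist_int_ge0//; have := hn1 n nn 1%N; rewrite mul1r; apply.
exact: partial_quotient_gt0.
Qed.

Variables (m : nat) (beta s : 'I_m.+1 -> R) (t : R) (f : R -> R[i]).
Hypothesis s0 : \sum_j s j = 0.
Hypothesis uf : unim f.
Hypothesis fE : {ae mu, forall x, e (saw s beta x) = e t * (f x / f (x + alpha))}.
Variables (j0 : 'I_m.+1) (b : 'I_m.+1 -> nat -> int).
Hypothesis b_j0 : forall n, b j0 n = 0.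
Hypothesis b_summ : summ (coef_density alpha b).
Hypothesis b_lim : forall j,
  tends0 (fun n => dist_int ((ksum (b j) n)%:~R * alpha - (beta j - beta j0))).

Lemma coef_summable j : summ (fun n => `|(b j n)%:~R| / (a n.+1)%:R : R).
Proof.
apply: summ_le b_summ => n; rewrite ler_pM2r ?invr_gt0//; exact: coef_le_sum.
Qed.

(** The sums cannot lie between 32 and 64, and each term is at most 4. *)
Lemma eps_summable : summ (fun n => dist_int (block_sum xpredT s b n) ^+ 2).
Proof.
have b_small := summ_tends0 (coef_density_ge0 alpha b) b_summ.
set Sg := \sum_j `|s j|; have Sg0 : 0 <= Sg by exact: sumr_ge0.
have m0 : 0 < m.+1%:R :> R by rewrite ltr0n.
have A0 : 0 < (64 * m.+1%:R ^+ 2)^-1 :> R by rewrite invr_gt0 mulr_gt0// exprn_gt0.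
have [rho [rho0 rho1 rho8 rS]] := small_parameter A0 Sg0.
have kap0 : 0 < 16^-1 :> R by rewrite invr_gt0.
have [r r0 hr] := birkhoff_almost_constant uf fE kap0.
have [n1 hn1] := b_small _ rho0.
have [n2 hn2] := ksum_norm_eventually alpha_itv alpha_irr b_small rho0.
have eta0 n : 0 <= block_eta alpha xpredT b n by exact: block_eta_ge0.
have eta_summ := summ_block_eta alpha_itv alpha_irr (P := xpredT) (fun j _ => coef_summable j).
have e128 : 0 < 128^-1 :> R by rewrite invr_gt0.
have [n4 hn4] := summ_tail eta0 eta_summ e128.
pose n3 := (Num.truncn (2 / r)).+1.
pose n0 := maxn (maxn n1 n2) (maxn n3 n4).
have density_le n : (n0 <= n)%N -> coef_density alpha b n <= rho.
  by rewrite !geq_max => /andP[/andP[h _] _]; apply: le_trans (hn1 n h); exact: ler_norm.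
have norm_le n : (n0 <= n)%N -> \sum_j ksum_norm alpha (b j) n <= rho * (q n)%:R.
  by rewrite !geq_max => /andP[/andP[_ h] _]; exact: hn2.
have n04 : (n4 <= n0)%N by rewrite /n0 !leq_max leqnn !orbT.
have q3 : 2 / (q n0)%:R <= r.
  rewrite ler_pdivrMr// mulrC -ler_pdivrMr//; apply: ltW.
  apply: (lt_le_trans (truncnS_gt _)); rewrite ler_nat.
  apply: leq_trans (cf_denominator_ge_id alpha_itv alpha_irr n0).
  by rewrite /n0 !leq_max leqnn !orbT.
pose u n := cabs (e (block_eps xpredT s b n) - 1) ^+ 2.
have u0 n : 0 <= u n by exact: sqr_ge0.
have tail N : \sum_(n0 <= n < N) u n <= 64 / 2.
  apply: bootstrap => [n _||M _ M64]; last 2 first.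
  - by lra.
  - have [Mn|nM] := leqP M n0; first by rewrite big_geq//; lra.
    have -> : 64 / 2 = 32 :> R by field.
    have tot : 16^-1 + 128 * rho * Sg + 8 * \sum_(n0 <= n < M) block_eta alpha xpredT b n <= 4^-1.
      by have := hn4 n0 M n04; lra.
    exact: (eps_sum_bound alpha_itv alpha_irr b_lim rho0 rho1 density_le norm_le s0 (ltnW nM)
      (cabs_e _) (hr _ (le_trans (dist_half_time alpha_itv alpha_irr b n0 M) q3)) tot rho8 M64).
  have := cabs_sub_le2 (cabs_e (block_eps xpredT s b n)) (@cabs1 R).
  have := cabs_ge0 (e (block_eps xpredT s b n) - 1); rewrite /u expr2; nra.
exists (\sum_(0 <= n < n0) u n + 64 / 2) => N.
apply: (@le_trans _ _ (\sum_(0 <= n < N) u n)).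
  apply: ler_sum => n _; have := e_sub1_lower (block_eps xpredT s b n).
  rewrite /u /block_eps dist_intBz; set d := dist_int _; have := dist_int_ge0 (block_sum xpredT s b n).
  rewrite -/d => d0 h; rewrite ler_pXn2r ?nnegrE ?cabs_ge0//; lra.
have [Nn|nN] := leqP N n0.
  rewrite [X in X + _](big_cat_nat (leq0n N) Nn) /= -addrA lerDl addr_ge0 ?sumr_ge0//; lra.
by rewrite (big_cat_nat (leq0n n0) (ltnW nN)) /= lerD2l.
Qed.

(** The explicit approximate solutions, which now converge, differ from f by an
    eigenfunction of the rotation: the constants in their equations converge to
    its eigenvalue, which is known modulo 1. *)
Lemma block_int_series : exists k : int,
  tends0 (fun n => dist_int ((ksum (block_int xpredT s b) n)%:~R * alpha - (k%:~R * alpha - t))).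
Proof.
have [Z [Z1 cauchy]] := block_converge alpha_itv alpha_irr (P := xpredT) (beta j0)
  (fun j _ => coef_summable j) eps_summable.
set S := ksum (block_int xpredT s b) in cauchy *.
pose B n x := e (block_trans alpha xpredT s b (beta j0) n x).
pose F n x := Z n * e ((- S n)%:~R * x) * B n x.
have uB n : unim (B n) by apply: unim_e_circ; exact: circ_block_trans.
have uF n : unim (F n).
  by apply: unimM => //; apply: unimM; [exact: unim_cst|exact: unim_character].
have [G uG FG] := unim_complete uF cauchy.
pose h x := f x / G x; have uh : unim h by exact: unim_div.
pose hn n x := f x / F n x; have uhn n : unim (hn n) by exact: unim_div.
have hnh : tends0 (fun n => udist (hn n) h).
  apply: tends0_le FG => n; rewrite ger0_norm ?udist_ge0// /hn /h.
  by rewrite (udist_mull (fun x => (F n x)^-1) (fun x => (G x)^-1) uf) udist_inv.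
pose z n := t + (S n)%:~R * alpha.
pose app n := saw_approx alpha s (fun=> beta j0) b n.
have appE n x : e (app n x) = e (- ((S n)%:~R * alpha)) * (F n x / F n (x + alpha)).
  have Z0 : Z n != 0 by exact: cabs_unit_neq0.
  have -> : e (app n x) = B n x / B n (x + alpha).
    rewrite /B -eB; congr e; rewrite block_trans_coboundary /app /saw_approx.
    have : (\sum_j s j) * psi (x - beta j0) = 0 by rewrite s0 mul0r.
    rewrite mulr_suml => p0; rewrite -[LHS]subr0 -[X in _ - X = _]p0 -sumrB.
    by apply: eq_bigr => j _; ring.
  rewrite /F; have -> : e ((- S n)%:~R * (x + alpha)) = e ((- S n)%:~R * x) * e (- ((S n)%:~R * alpha)).
    by rewrite -eD; congr e; rewrite mulrNz; ring.
  have B0 := unim_neq0 (x + alpha) (uB n).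
  by field; rewrite Z0 B0 !e_neq0.
have app_lim : tends0 (fun n => udist (fun x => e (saw s beta x)) (fun x => e (app n x))).
  exact: saw_approx_tends0 b_lim.
have step n : udist (fun x => e (z n) * h x) (fun x => h (x + alpha)) <=
    2 * udist (hn n) h + udist (fun x => e (saw s beta x)) (fun x => e (app n x)).
  have us1 := unim_shift alpha (uhn n).
  have ua : unim (fun x => e (app n x)) by apply: unim_e_circ; exact: circ_saw_approx.
  have usw : unim (fun x => e (saw s beta x)) by apply: unim_e_circ; exact: circ_saw.
  have mid : udist (fun x => e (z n) * hn n x) (fun x => hn n (x + alpha)) =
      udist (fun x => e (saw s beta x)) (fun x => e (app n x)).
    pose w x := hn n (x + alpha) / e (app n x).
    have uw : unim w by exact: unim_div.
    rewrite -[RHS](udist_mull _ _ uw).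
    have ae1 : {ae mu, forall x, e (z n) * hn n x = w x * e (saw s beta x)}.
      apply: aeS fE => x ->; rewrite /w appE /hn /z eD.
      have f0 y : f y != 0 by exact: unim_neq0.
      have F0 y : F n y != 0 by exact: unim_neq0.
      rewrite eN; field; rewrite !f0 !F0 !e_neq0//.
    have uws := unimM uw usw; have uwa := unimM uw ua; have uzh := unim_ce (z n) (uhn n).
    have E2 : (fun x => w x * e (app n x)) = (fun x => hn n (x + alpha)).
      by apply/funext => x; rewrite /w divfK// e_neq0.
    rewrite E2; apply/eqP; rewrite eq_le; apply/andP; split.
      by apply: (le_trans (udist_triangle uzh uws us1)); rewrite (udist_ae uzh uws ae1) add0r.
    apply: (le_trans (udist_triangle uws uzh us1)).
    by rewrite udistC (udist_ae uzh uws ae1) add0r.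
  have uzh := unim_ce (z n) uh; have uzhn := unim_ce (z n) (uhn n).
  have ush := unim_shift alpha uh.
  apply: (le_trans (udist_triangle uzh uzhn ush)).
  apply: (le_trans (lerD (lexx _) (udist_triangle uzhn us1 ush))).
  rewrite mid (udist_shift alpha (uhn n) uh).
  have -> : udist (fun x => e (z n) * h x) (fun x => e (z n) * hn n x) = udist (hn n) h.
    by rewrite udist_mull 1?udistC//; apply: unim_cst; exact: cabs_e.
  by lra.
have stepT : tends0 (fun n => udist (fun x => e (z n) * h x) (fun x => h (x + alpha))).
  apply: tends0_le (tends0D (tends0Z 2 hnh) app_lim) => n.
  by rewrite ger0_norm ?udist_ge0.
pose rt x := h (x + alpha) / h x.
have urt : unim rt by apply: unim_div => //; exact: unim_shift.
pose zeta := cmean rt.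
have rtn n : udist (fun=> e (z n)) rt = udist (fun x => e (z n) * h x) (fun x => h (x + alpha)).
  rewrite -(udist_mulr _ _ uh); congr udist; apply/funext => x.
  by rewrite /rt divfK// unim_neq0.
have uce y : unim (fun=> e y : R[i]) by apply: unim_cst; exact: cabs_e.
have zz n : cabs (e (z n) - zeta) <= 2 * udist (fun x => e (z n) * h x) (fun x => h (x + alpha)).
  by rewrite -rtn -[X in cabs (X - _)]cmean_cst; exact: cmean_udist.
have zeta1 : cabs zeta = 1.
  apply/eqP; rewrite -subr_eq0 -normr_le0; apply/ler_addgt0Pr => eps ep0; rewrite add0r.
  have [N hN] := tends0Z 2 stepT ep0.
  have := hN N (leqnn N); rewrite ger0_norm ?mulr_ge0 ?udist_ge0// => hh.
  apply: le_trans hh; apply: le_trans (zz N); rewrite -(cabs_e (z N)).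
  have A1 := cabsB_triangle zeta (e (z N)) 0; have A2 := cabsB_triangle (e (z N)) zeta 0.
  by rewrite !subr0 in A1 A2; rewrite (cabsBC zeta) in A1; rewrite ler_norml; apply/andP; split; lra.
have [theta thE] := e_surj zeta1.
have eig : udist (fun x => h (x + alpha)) (fun x => e theta * h x) = 0.
  apply/eqP; rewrite eq_le udist_ge0 andbT; apply/ler_addgt0Pr => eps ep0; rewrite add0r.
  have [N hN] := tends0Z 3 stepT ep0.
  have := hN N (leqnn N); rewrite ger0_norm ?mulr_ge0 ?udist_ge0//; apply: le_trans.
  have uzN := unim_ce (z N) uh.
  apply: (le_trans (udist_triangle (unim_shift alpha uh) uzN (unim_ce theta uh))).
  rewrite (udistC (fun x => h (x + alpha))) (udist_mulr (fun=> e (z N)) (fun=> e theta) uh).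
  by rewrite udist_cst -thE; have := zz N; lra.
have [k /intrP[l hl]] := eigenvalue_multiple uh eig.
exists k; apply: tends0_le (tends0Z 2 stepT) => n; rewrite ger0_norm ?dist_int_ge0//.
apply: le_trans (zz n); rewrite thE.
have -> : e theta = e (k%:~R * alpha) by apply: e_int_eq; rewrite hl intr_int.
have -> : e (z n) - e (k%:~R * alpha) = e (k%:~R * alpha) * (e (z n - k%:~R * alpha) - 1).
  by rewrite eB mulrBr mulr1 mulrCA mulfV ?mulr1// e_neq0.
rewrite Normc.normcM cabs_e mul1r.
have := e_sub1_lower (z n - k%:~R * alpha).
rewrite (_ : z n - k%:~R * alpha = (S n)%:~R * alpha - (k%:~R * alpha - t)); last by rewrite /z; ring.
by have := dist_int_ge0 ((S n)%:~R * alpha - (k%:~R * alpha - t)); lra.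
Qed.

End necessity_of_condition_C.

(** The partition with a single block is the only one that can satisfy the first
    part of the condition here. *)
Lemma condition_C_necessary (R : realType) (alpha : R) (m : nat) (beta s : 'I_m.+1 -> R)
    (t : R) (f : R -> R[i]) :
  0 < alpha < 1 -> irrational alpha -> \sum_j s j = 0 ->
  (forall J : {set 'I_m.+1}, J != finset.set0 -> J \proper [set: 'I_m.+1]%SET ->
     \sum_(j in J) s j \isn't a Num.int) ->
  unim f ->
  {ae @lebesgue_measure R, forall x, e2ipi (saw s beta x) = e2ipi t * (f x / f (x + alpha))} ->
  condition_C alpha beta s t.
Proof.
move=> alpha_itv alpha_irr s0 s_prop uf fE; rewrite /condition_C.
pose T : {set 'I_m.+1} := [set: 'I_m.+1]%SET.
have sumT (V : zmodType) (g : 'I_m.+1 -> V) : \sum_(j in T) g j = \sum_j g j.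
  by apply: eq_bigl => j; rewrite finset.in_setT.
have sumP (V : zmodType) (g : {set 'I_m.+1} -> V) : \sum_(J in [set T]%SET) g J = g T.
  by rewrite big_set1.
exists [set T]%SET.
  apply/and3P; split.
  - by rewrite /finset.cover big_set1.
  - exact: finset.trivIset1.
  - rewrite finset.in_set1 eq_sym; apply/set0Pn; exists ord0; exact: finset.in_setT.
move=> c _; split=> [J|]; first by rewrite finset.in_set1 => /eqP ->; rewrite sumT s0 int_num0.
set j0 := c T.
have [b [b_j0 b_small b_lim]] := aligned_expansions alpha_itv alpha_irr s0 s_prop uf fE j0.
have b_summ := densities_summable alpha_itv alpha_irr s0 s_prop uf fE b_j0 b_small b_lim.
have eps_summ := eps_summable alpha_itv alpha_irr s0 uf fE b_summ b_lim.
have [k hk] := block_int_series alpha_itv alpha_irr s0 uf fE b_summ b_lim.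
have blockE n : \sum_(j in T) (b j n)%:~R * s j = block_sum xpredT s b n by rewrite sumT.
exists b; split=> [J|].
  rewrite finset.in_set1 => /eqP ->; split=> [j _|].
    split.
      by apply/tends0P; under eq_fun do rewrite ksum_series; exact: b_lim.
    apply/summP => [n|]; first by rewrite divr_ge0.
    exact: coef_summable.
  apply/summP => [n|]; first exact: sqr_ge0.
  by under eq_fun do rewrite blockE.
exists k, (fun=> k%:~R * alpha - t); split=> [J|].
  rewrite finset.in_set1 => /eqP ->; rewrite sumT s0 mulr0 subr0.
  have -> : (fun n => (nearest_int (\sum_(j in T) (b j n)%:~R * s j))%:~R *
      (cf_denominator alpha n)%:R * alpha) =
      (fun n => (block_int xpredT s b n)%:~R * (cf_denominator alpha n)%:R * alpha).
    by apply/funext => n; rewrite blockE.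
  by apply/tends0P; under eq_fun do rewrite ksum_series.
by rewrite sumP subKr /eqmod1 subrr int_num0.
Qed.

Theorem mainTheorem5 (R : realType) (alpha : R)
    (alpha_itv : 0 < alpha < 1) (alpha_irr : irrational alpha)
    (m : nat) (m_ge1 : (1 <= m)%N) (beta s : 'I_m.+1 -> R) (phi : R -> R) (t : R)
    (phi_step : step_function phi)
    (phi_int0 : (\int[@lebesgue_measure R]_(x in `[0%R, 1%R]) (phi x)%:E = 0)%E)
    (beta_distinct : forall i j, eqmod1 (beta i) (beta j) -> i = j)
    (beta_disc : forall x : R,
       ~ {for x, continuous phi} <-> exists j, eqmod1 x (beta j))
    (phi_jump : forall j, jump phi (beta j) = - s j) :
  (condition_C alpha beta s t -> exists f : R -> R[i], cobounding alpha phi t f) /\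
  ((forall J : {set 'I_m.+1}, J != finset.set0 -> J \proper [set: 'I_m.+1]%SET ->
      \sum_(j in J) s j \isn't a Num.int) ->
   (exists f : R -> R[i], cobounding alpha phi t f) -> condition_C alpha beta s t).
Proof.
have saw_ae := step_function_sawtooth phi_step phi_int0 beta_distinct beta_disc phi_jump.
have s0 := sum_jumps_eq0 phi_step beta_distinct beta_disc phi_jump.
split=> [C|s_prop [f [pf mr mi f1 fE]]].
  have [f [mr mi pf f1] fE] := condition_C_sufficient alpha_itv alpha_irr s0 C.
  exists f; split=> // [x|]; first by apply/norm_cabs; exact: f1.
  by apply: aeS (aeI saw_ae fE) => x [-> ->].
apply: (@condition_C_necessary _ _ _ _ _ _ f) => //.
  by split => // x; apply/norm_cabs; exact: f1.
by apply: aeS (aeI saw_ae fE) => x [h1 h2]; rewrite -h2 h1.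
Qed.
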